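(* Assume the network assumption, the stochastic gradient assumption, the unbiased compressor assumption (with parameter $C>0$) and the smoothness assumption (with constant $L$) stated in the context. Let $\alpha,\gamma>0$ satisfy $$\gamma\le\min\left\{\frac12,\frac{\alpha^2(1-\lambda_2)}{15872\,C},\frac{\alpha}{2}\right\},\qquad \alpha\le\frac{1}{4(C+1)},$$ let $\Delta_0=f(\bar x_{-1})-f^{\inf}$, and run CEDAS with the constant stepsize $$\eta_k=\eta=\frac{1}{\sqrt{\frac{L\sigma^2K}{n\Delta_0}}+\frac{32L}{\gamma(1-\lambda_2)}}.$$ Then it takes $$K_T^{(ncvx)}=\max\left\{\mathcal{O}\left(\frac{n^3}{\gamma^2(1-\lambda_2)^2}\right),\ \mathcal{O}\left(\frac{\|\mathbf{x}_{-1}\|^4+\|H_0\|^4}{n\gamma^2(1-\lambda_2)^2}\right),\ \mathcal{O}\left(\left(\frac{n\|\nabla F(\mathbf{x}_{-1})\|^4}{\gamma^4(1-\lambda_2)^4}\right)^{1/3}\right)\right\}$$ iterations for CEDAS to achieve the asymptotic network independent convergence rate, where $K_T^{(ncvx)}$ is the transient time defined in the context.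
   Context: Notation. There are $n\ge2$ agents; $f_i:\mathbb{R}^p\to\mathbb{R}$ is differentiable, $f=\frac1n\sum_{i=1}^nf_i$, and $f^{\inf}=\inf_{x\in\mathbb{R}^p}f(x)$ (finite). For $\mathbf{x}\in\mathbb{R}^{n\times p}$ with $i$-th row $x_i^\top$, $\bar x=\frac1n\sum_ix_i$, and $\nabla F(\mathbf{x})\in\mathbb{R}^{n\times p}$ has $i$-th row $\nabla f_i(x_i)^\top$. $\mathbf{1}\in\mathbb{R}^n$ is the all-ones vector. $\|\cdot\|$ is the Euclidean norm of vectors and the Frobenius norm of matrices. Transient time. $K_T^{(ncvx)}=\inf\{K:\ \frac1k\sum_{t=0}^{k-1}\mathbb{E}[\|\nabla f(\bar x_t)\|^2]\le\mathcal{O}(1/\sqrt{nk})\ \text{for all }k\ge K\}$, where for each $k$ the iterates are those produced with the stepsize $\eta$ computed with horizon $K=k$. $\mathcal{O}(\cdot)$ hides factors independent of $n$, $1-\lambda_2$, the iteration count and all other displayed quantities (they may depend on e.g. $L,\sigma,\Delta_0$); an equality $K_T=\mathcal{O}(\cdot)$ is an upper bound in this sense. Network assumption. The communication graph on the agents is undirected and connected; $W=(w_{ij})\in\mathbb{R}^{n\times n}$ is symmetric, entrywise nonnegative, positive semidefinite, $W\mathbf{1}=\mathbf{1}$, and for $i\ne j$ one has $w_{ij}=w_{ji}>0$ if $i,j$ are linked and $w_{ij}=w_{ji}=0$ otherwise. Its eigenvalues are $1=\lambda_1>\lambda_2\ge\cdots\ge\lambda_n\ge0$. CEDAS. Given stepsizes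 $\eta_k>0$ ($k\ge-1$), parameters $\alpha,\gamma>0$, a (possibly random) compression operator $\mathcal{C}:\mathbb{R}^p\to\mathbb{R}^p$ applied row by row, and deterministic $\mathbf{x}_{-1},H_0\in\mathbb{R}^{n\times p}$, set $D_0=0$, $\mathbf{x}_0=\mathbf{x}_{-1}-\eta_{-1}G_{-1}$, and for $k\ge0$: $\mathbf{y}_k=\mathbf{x}_k-\eta_kG_k-D_k$; $Q_k=\mathcal{C}(\mathbf{y}_k-H_k)$; $D_{k+1}=D_k+\frac\gamma2(I-W)(H_k+Q_k)$; $H_{k+1}=H_k+\alpha Q_k$; $\mathbf{x}_{k+1}=\mathbf{x}_k-\eta_kG_k-D_{k+1}$. Here $G_k$ has rows $g_{i,k}^\top$ with $g_{i,k}=\nabla f_i(x_{i,k};\xi_{i,k})$ the stochastic gradient, and $x_{i,k}^\top$ is the $i$-th row of $\mathbf{x}_k$. Stochastic gradient assumption. For all $k\ge-1$, conditionally on all randomness generated before the samples $\xi_{1,k},\dots,\xi_{n,k}$ are drawn, these samples are independent across $i$, $g_{i,k}$ has mean $\nabla f_i(x_{i,k})$, and $\|g_{i,k}-\nabla f_i(x_{i,k})\|^2$ has expectation at most $\sigma^2$ ($\sigma>0$). Unbiased compressor assumption. $\mathbb{E}[\mathcal{C}(x)\mid x]=x$ and $\mathbb{E}[\|\mathcal{C}(x)-x\|^2\mid x]\le C\|x\|^2$ for all $x\in\mathbb{R}^p$, with $C>0$; at each use these hold conditionally on all randomness preceding the compression. Smoothness assumption. Each $\nabla f_i$ is $L$-Lipschitz.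 *)

(* Defs.v *)
From HB Require Import structures.
From mathcomp Require Import all_boot all_order all_algebra.
From mathcomp Require Import all_classical all_reals all_analysis.

Set Implicit Arguments.
Unset Strict Implicit.
Unset Printing Implicit Defensive.

Import Order.TTheory GRing.Theory Num.Theory.
Import numFieldNormedType.Exports.

Local Open Scope classical_set_scope.
Local Open Scope ring_scope.

(* Vectors of R^p are rows 'rV[R]_p, so that the i-th row of x : 'M[R]_(n, p)
   is the local copy x_i of agent i. *)

Section LinearAlgebra.
Context {R : realType}.

(* Frobenius norm, hence the Euclidean norm on 'rV[R]_p; the norm `|x| of
   the library on matrices is the sup norm. *)
Definition frob m n (A : 'M[R]_(m, n)) : R :=
  Num.sqrt (\sum_i \sum_j A i j ^+ 2).

Definition row_mean n p (x : 'M[R]_(n, p)) : 'rV[R]_p :=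
  n%:R^-1 *: \sum_i row i x.

Definition rowwise n p (h : 'I_n -> 'rV[R]_p -> 'rV[R]_p) (x : 'M[R]_(n, p)) :
    'M[R]_(n, p) :=
  \matrix_(i < n) h i (row i x).

(* Meaningful where f is differentiable. *)
Definition grad p (f : 'rV[R]_p -> R) (x : 'rV[R]_p) : 'rV[R]_p :=
  \row_j 'D_(delta_mx 0 j) f x.

Definition average n p (f : 'I_n -> 'rV[R]_p -> R) (x : 'rV[R]_p) : R :=
  n%:R^-1 * \sum_i f i x.

(* lam lists the eigenvalues of W with multiplicity, in nonincreasing order
   (0-based, so that lambda_2 is lam`_1). *)
Definition sorted_eigenvalues n (W : 'M[R]_n) (lam : seq R) : Prop :=
  sorted (fun a b => b <= a) lam /\
  char_poly W = \prod_(a <- lam) ('X - a%:P).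

Definition network_assumption n (e : rel 'I_n) (W : 'M[R]_n) : Prop :=
  [/\ [/\ symmetric e, irreflexive e & forall i j, connect e i j],
      [/\ W^T = W, forall i j, 0 <= W i j
        & forall x : 'rV[R]_n, 0 <= (x *m W *m x^T) 0 0],
      W *m const_mx 1 = const_mx 1 :> 'cV[R]_n
    & forall i j, i != j -> if e i j then 0 < W i j else W i j == 0].

Definition smoothness_assumption n p (f : 'I_n -> 'rV[R]_p -> R) (L : R) :
    Prop :=
  forall i x y, frob (grad (f i) x - grad (f i) y) <= L * frob (x - y).

End LinearAlgebra.

Section Cedas.
Context {R : realType} (n p : nat).
Variables (W : 'M[R]_n) (alpha gamma : R).

(* Sequences attached to gradient evaluations start at time -1 and are stored
   with a shift: eta t, G t are the stepsize and the stochastic gradient map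
   of time t - 1.  Compressions start at time 0 and are not shifted. *)
Variables (eta : nat -> R) (G : nat -> 'M[R]_(n, p) -> 'M[R]_(n, p)).
Variable Cmp : nat -> 'M[R]_(n, p) -> 'M[R]_(n, p).
Variables (xm1 H0 : 'M[R]_(n, p)).

(* (x_k, D_k, H_k) *)
Fixpoint cedas (k : nat) : 'M[R]_(n, p) * 'M[R]_(n, p) * 'M[R]_(n, p) :=
  match k with
  | 0%N => (xm1 - eta 0%N *: G 0%N xm1, 0, H0)
  | k'.+1 =>
      let: (x, D, H) := cedas k' in
      let g := eta k'.+1 *: G k'.+1 x in
      let y := x - g - D in
      let Q := Cmp k' (y - H) in
      let D' := D + (gamma / 2) *: ((1%:M - W) *m (H + Q)) in
      (x - g - D', D', H + alpha *: Q)
  end.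

Definition cedas_x (k : nat) : 'M[R]_(n, p) := (cedas k).1.1.

(* x_{t-1} *)
Definition cedas_query (t : nat) : 'M[R]_(n, p) :=
  if t is k.+1 then cedas_x k else xm1.

End Cedas.

Section Conditioning.
Context {R : realType} {d : measure_display} {Omega : measurableType d}.
Variable P : probability Omega R.

(* In this section G is a sigma-algebra on Omega contained in the measurable
   sets. *)
Definition sub_measurable (G : set (set Omega)) (Z : Omega -> R) : Prop :=
  forall B, measurable B -> G (Z @^-1` B).

(* Z is a version of E[X | G]. *)
Definition is_condexp (G : set (set Omega)) (X Z : Omega -> R) : Prop :=
  [/\ P.-integrable setT (EFin \o X), P.-integrable setT (EFin \o Z),
      sub_measurable G Z
    & forall A, G A ->
        (\int[P]_(w in A) (Z w)%:E = \int[P]_(w in A) (X w)%:E)%E].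

(* E[X | G] <= B almost surely. *)
Definition condexp_le (G : set (set Omega)) (X B : Omega -> R) : Prop :=
  exists2 Z, is_condexp G X Z & {ae P, forall w, Z w <= B w}.

(* The conditional probabilities given G factorize: Z i is a version of
   P(xi i \in A i | G). *)
Definition cond_independent {dS : measure_display} {S : measurableType dS}
    (G : set (set Omega)) n (xi : 'I_n -> Omega -> S) : Prop :=
  forall A : 'I_n -> set S, (forall i, measurable (A i)) ->
  exists2 Z : 'I_n -> Omega -> R,
    forall i, is_condexp G (\1_(xi i @^-1` A i)) (Z i)
    & is_condexp G (\1_[set w | forall i, A i (xi i w)])
                   (fun w => \prod_i Z i w).

End Conditioning.

Section Randomness.
Context {R : realType} {d dX dS : measure_display}.
Context {Omega : measurableType d} {Xi : measurableType dX}
        {S : measurableType dS}.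

(* Joint measurability in (vector, random seed); p.-tuple R carries the Borel
   sigma-algebra of R^p. *)
Definition jointly_measurable {dT : measure_display} {T : measurableType dT} p
    (h : 'rV[R]_p -> T -> 'rV[R]_p) : Prop :=
  forall j : 'I_p, measurable_fun [set: p.-tuple R * T]
    (fun z => h (\row_k tnth z.1 k) z.2 0 j).

Context {n : nat}.
Variables (xi : 'I_n -> nat -> Omega -> Xi) (zeta : 'I_n -> nat -> Omega -> S).

(* The sigma-algebra generated by the first a rounds of samples and the first
   b rounds of compression seeds. *)
Definition history (a b : nat) : set (set Omega) :=
  <<s [set A | (exists i t B, [/\ (t < a)%N, measurable B & A = xi i t @^-1` B])
            \/ (exists i t B,
                  [/\ (t < b)%N, measurable B & A = zeta i t @^-1` B])] >>.

(* The randomness is generated in the order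
   xi_{-1}, xi_0, zeta_0, xi_1, zeta_1, ..., where xi i t is the sample of
   agent i at time t - 1 and zeta i k its compression seed at time k. *)
Definition before_sample (t : nat) : set (set Omega) := history t t.-1.
Definition before_compression (k : nat) : set (set Omega) := history k.+2 k.

Variables (P : probability Omega R) (p : nat).

(* x t w is the matrix of the points at which the samples xi ^~ t are used. *)
Definition stochastic_gradient_assumption (f : 'I_n -> 'rV[R]_p -> R)
    (sgrad : 'I_n -> 'rV[R]_p -> Xi -> 'rV[R]_p)
    (x : nat -> Omega -> 'M[R]_(n, p)) (sigma : R) : Prop :=
  forall t,
  [/\ forall i, measurable_fun setT (xi i t),
      cond_independent P (before_sample t) (xi ^~ t),
      forall i j, is_condexp P (before_sample t)
        (fun w => sgrad i (row i (x t w)) (xi i t w) 0 j)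
        (fun w => grad (f i) (row i (x t w)) 0 j)
    & forall i, condexp_le P (before_sample t)
        (fun w => frob (sgrad i (row i (x t w)) (xi i t w)
                        - grad (f i) (row i (x t w))) ^+ 2)
        (fun=> sigma ^+ 2)].

(* The input X is any square-integrable random vector determined by the
   randomness preceding the compression; deterministic vectors are the
   constant X.  Square integrability makes the conditional expectations
   meaningful. *)
Definition unbiased_compressor_assumption
    (comp : 'rV[R]_p -> S -> 'rV[R]_p) (C : R) : Prop :=
  forall k i, measurable_fun setT (zeta i k) /\
  forall X : Omega -> 'rV[R]_p,
  (forall j, sub_measurable (before_compression k) (fun w => X w 0%R j)) ->
  ('E_P[fun w => (frob (X w) ^+ 2)%R] < +oo)%E ->
  (forall j, is_condexp P (before_compression k)
     (fun w => comp (X w) (zeta i k w) 0 j) (fun w => X w 0 j)) /\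
  condexp_le P (before_compression k)
    (fun w => frob (comp (X w) (zeta i k w) - X w) ^+ 2)
    (fun w => C * frob (X w) ^+ 2).

(* (1/k) sum_{t<k} E ||grad f(mean of x_t)||^2, as an extended real. *)
Definition mean_sq_grad (f : 'I_n -> 'rV[R]_p -> R)
    (x : nat -> Omega -> 'M[R]_(n, p)) (k : nat) : \bar R :=
  (k%:R^-1%:E * \sum_(t < k)
     'E_P[fun w => (frob (grad (average f) (row_mean (x t w))) ^+ 2)%R])%E.

(* x K is the run computed with horizon K, and c is the constant hidden in
   the bound O(1 / sqrt(n k)).  The infimum is +oo if no K qualifies. *)
Definition transient_time (c : R) (f : 'I_n -> 'rV[R]_p -> R)
    (x : nat -> nat -> Omega -> 'M[R]_(n, p)) : \bar R :=
  ereal_inf [set K%:R%:E | K in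
    [set K : nat | (0 < K)%N /\ forall k, (K <= k)%N ->
       (mean_sq_grad f (x k) k <= (c / Num.sqrt (n * k)%:R)%:E)%E]].

End Randomness.

Definition cedas_stepsize {R : realType} (n : nat)
    (L sigma Delta0 gamma lambda2 : R) (K : nat) : R :=
  (Num.sqrt (L * sigma ^+ 2 * K%:R / (n%:R * Delta0))
   + 32 * L / (gamma * (1 - lambda2)))^-1.

(* The run of CEDAS with the constant stepsize eta driven by the samples xi
   and the compression seeds zeta: the iterates x_k, and the points x_{t-1}
   at which the samples xi ^~ t are used. *)
Section RandomRun.
Context {R : realType} {Omega Xi S : Type} {n p : nat}.
Variables (W : 'M[R]_n) (alpha gamma eta : R).
Variables (sgrad : 'I_n -> 'rV[R]_p -> Xi -> 'rV[R]_p)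
          (comp : 'rV[R]_p -> S -> 'rV[R]_p) (xm1 H0 : 'M[R]_(n, p)).
Variables (xi : 'I_n -> nat -> Omega -> Xi) (zeta : 'I_n -> nat -> Omega -> S).

Let G (w : Omega) (t : nat) := rowwise (fun i v => sgrad i v (xi i t w)).
Let Cmp (w : Omega) (k : nat) := rowwise (fun i v => comp v (zeta i k w)).

Definition run_x (k : nat) (w : Omega) : 'M[R]_(n, p) :=
  cedas_x W alpha gamma (fun=> eta) (G w) (Cmp w) xm1 H0 k.

Definition run_query (t : nat) (w : Omega) : 'M[R]_(n, p) :=
  cedas_query W alpha gamma (fun=> eta) (G w) (Cmp w) xm1 H0 t.

End RandomRun.

(* Main.v *)
Require Import Defs.
From HB Require Import structures.
From mathcomp Require Import all_boot all_order all_algebra.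
From mathcomp Require Import all_classical all_reals all_analysis.
From mathcomp Require Import measurable_realfun.
From mathcomp Require Import complex spectral.
From mathcomp Require Import ring lra.

(** The proof follows three mean-square balances along the run and turns them
    into a rate.

    Write B = (gamma/2)(I - W), J for the averaging matrix, Pi = I - J, and
    delta = gamma (1 - lambda_2).  By the spectral gap, B lies between delta/2
    and gamma/2 on the vectors with zero mean.  There the iteration is a
    primal-dual one for X = Pi x_k and s = D_k + eta Pi gradF(J x_k), the gap
    of the dual variable to its target.  In a mode where B acts as b, the
    energy X^2 + s^2 / b - s^2 is contracted by exactly 1 - b
    ([energy_identity]).  Gradient noise and compression error have zero
    conditional mean, so they only add their variances; the motion of the
    target and the gradient disagreement are small because eta L <= delta / 32
    ([energy_step]).

    The compression error has variance at most C times the squared residual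
    y_k - H_k, which contracts by 1 - alpha/2 up to the quantities controlled
    by the energy ([residual_step]).  As gamma C / alpha^2 is small, summing the
    two balances over time closes the loop and bounds the accumulated consensus
    error ([sum_consensus]).

    The mean of the iterates feels neither B nor the dual variable: it makes a
    gradient step with an error bounded by the consensus error and a noise of
    variance sigma^2 / n, by conditional independence of the samples
    ([expect_sqn_row_mean]).  The descent lemma then bounds the accumulated
    squared gradients at the mean ([objective_step], [sum_gradient],
    [run_bound]).

    With the prescribed stepsize every term of the resulting bound is a
    constant over sqrt(n k) as soon as k passes one of three thresholds
    ([rate_bound]); up to a factor 2 they are the three terms of the maximum.

    Conditional expectations enter only through set integrals: a variable with
    zero integral over every event of G is orthogonal to every G-measurable
    factor ([centered_mul_eq0]), and conditional independence lets G grow by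
    the sample of another agent ([cond_independent_centered]). *)

Set Implicit Arguments.
Unset Strict Implicit.
Unset Printing Implicit Defensive.

Import Order.TTheory GRing.Theory Num.Theory.
Import numFieldNormedType.Exports.

Local Open Scope classical_set_scope.
Local Open Scope ring_scope.

(** * Expectations and centered variables *)

Section Integration.
Context {R : realType} {d : measure_display} {Omega : measurableType d}.
Variable P : probability Omega R.
Implicit Types (X Y Z : Omega -> R) (A : set Omega) (F : set (set Omega)).

Definition has_mean X := P.-integrable setT (EFin \o X).

Lemma has_mean_meas X : has_mean X -> measurable_fun setT X.
Proof. by move=> iX; apply/measurable_EFinP; exact: measurable_int iX. Qed.

Lemma has_meanD X Y : has_mean X -> has_mean Y -> has_mean (fun w => X w + Y w).
Proof.
move=> iX iY; have := integrableD measurableT iX iY.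
by apply: eq_integrable.
Qed.

Lemma has_meanZ k X : has_mean X -> has_mean (fun w => k * X w).
Proof.
move=> iX; have := integrableZl measurableT k iX.
by apply: eq_integrable.
Qed.

Lemma has_meanB X Y : has_mean X -> has_mean Y -> has_mean (fun w => X w - Y w).
Proof.
move=> iX iY; have := integrableB measurableT iX iY.
by apply: eq_integrable.
Qed.

Lemma has_mean_cst k : has_mean (fun=> k).
Proof. exact: finite_measure_integrable_cst. Qed.

Lemma has_mean_sum (I : Type) (s : seq I) (Xs : I -> Omega -> R) :
  (forall i, has_mean (Xs i)) -> has_mean (fun w => \sum_(i <- s) Xs i w).
Proof.
move=> iX; elim: s => [|i s IH].
  under eq_fun do rewrite big_nil.
  exact: has_mean_cst.
under eq_fun do rewrite big_cons.
exact: has_meanD.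
Qed.

Lemma le_has_mean X Y : measurable_fun setT X -> (forall w, `|X w| <= Y w) ->
  has_mean Y -> has_mean X.
Proof.
move=> mX XY iY; apply: (le_integrable measurableT _ _ iY).
  exact/measurable_EFinP.
by move=> w _ /=; rewrite lee_fin (le_trans (XY w))// ler_norm.
Qed.

Lemma expectD X Y : has_mean X -> has_mean Y ->
  \int[P]_w (X w + Y w) = \int[P]_w X w + \int[P]_w Y w.
Proof. exact: RintegralD. Qed.

Lemma expectB X Y : has_mean X -> has_mean Y ->
  \int[P]_w (X w - Y w) = \int[P]_w X w - \int[P]_w Y w.
Proof. exact: RintegralB. Qed.

Lemma expectZ k X : has_mean X ->
  \int[P]_w (k * X w) = k * \int[P]_w X w.
Proof. exact: RintegralZl. Qed.

Lemma expect_cst k : \int[P]_w k = k.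
Proof.
rewrite Rintegral_cst// [X in fine X](_ : _ = 1%E) ?mulr1//.
exact: probability_setT.
Qed.

Lemma expect_sum (I : Type) (s : seq I) (Xs : I -> Omega -> R) :
  (forall i, has_mean (Xs i)) ->
  \int[P]_w (\sum_(i <- s) Xs i w) = \sum_(i <- s) \int[P]_w Xs i w.
Proof.
move=> iX; elim: s => [|i s IH].
  rewrite big_nil -[RHS]expect_cst; apply: eq_Rintegral => w _.
  by rewrite big_nil.
rewrite big_cons -IH -expectD//; last exact: has_mean_sum.
by apply: eq_Rintegral => w _; rewrite big_cons.
Qed.

Lemma le_expect X Y : has_mean X -> has_mean Y -> (forall w, X w <= Y w) ->
  \int[P]_w X w <= \int[P]_w Y w.
Proof. by move=> iX iY XY; apply: le_Rintegral. Qed.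

Lemma expectE X : has_mean X -> (\int[P]_w (X w)%:E)%E = (\int[P]_w X w)%:E.
Proof. by move=> iX; rewrite fineK//; exact: integrable_fin_num. Qed.

Lemma Rintegral_in A X :
  \int[P]_(w in A) X w = \int[P]_w (\1_A w * X w).
Proof.
rewrite Rintegral_mkcond; apply: eq_Rintegral => w _.
by rewrite patchE indicE; case: ifP => _; rewrite (mul1r, mul0r).
Qed.

Lemma has_mean_indicM A X : measurable A -> has_mean X ->
  has_mean (fun w => \1_A w * X w).
Proof.
move=> mA iX; apply: (@le_has_mean _ (fun w => `|X w|)).
- apply: measurable_funM; last exact: has_mean_meas.
  exact: measurable_indic.
- move=> w; rewrite normrM indicE.
  by case: (_ \in _); rewrite ?normr1 ?normr0 ?mul1r ?mul0r.
- exact: integrable_norm.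
Qed.

(** The encoding of E[X | G] = 0 by set integrals. *)
Definition centered (G : set (set Omega)) X :=
  has_mean X /\ forall A, G A -> \int[P]_(w in A) X w = 0.

Lemma condexp_centered G X Z : G `<=` measurable -> is_condexp P G X Z ->
  centered G (fun w => X w - Z w).
Proof.
move=> mG [iX iZ _ XZ]; split; first exact: has_meanB.
move=> A GA; have mA := mG _ GA.
rewrite RintegralB//; last 2 first.
- by apply: integrableS iX.
- by apply: integrableS iZ.
by rewrite /Rintegral XZ// subrr.
Qed.

Section PullOut.
Variable F : set (set Omega).
Hypothesis mF : <<s F >> `<=` measurable.

Lemma sub_measurableP Z : sub_measurable <<s F >> Z <->
  measurable_fun [set: g_sigma_algebraType F] Z.
Proof.
split=> [mZ _ B mB|mZ B mB]; first by rewrite setTI; exact: mZ.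
by have := mZ measurableT B mB; rewrite setTI.
Qed.

Lemma sub_measurable_meas Z : sub_measurable <<s F >> Z -> measurable_fun setT Z.
Proof. by move=> mZ _ B mB; rewrite setTI; apply: mF; exact: mZ. Qed.

Import HBNNSimple.

Lemma simple_centered_eq0 (h : {nnsfun g_sigma_algebraType F >-> R}) X :
  centered <<s F >> X ->
  has_mean (fun w => h w * X w) /\ \int[P]_w (h w * X w) = 0.
Proof.
move=> [iX cX].
pose s := finmap.enum_fset (fset_set (range h)).
have hE w : h w * X w = \sum_(y <- s) y * (\1_(h @^-1` [set y]) w * X w).
  rewrite {1}fimfunE fsbig_finite//= mulr_suml; apply: eq_bigr => y _.
  by rewrite mulrA.
have Fy y : <<s F >> (h @^-1` [set y]).
  by have := measurable_sfunP h (measurable_set1 y).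
have my y : measurable (h @^-1` [set y] : set Omega) by exact: mF.
have iy y : has_mean (fun w => y * (\1_(h @^-1` [set y]) w * X w)).
  by apply: has_meanZ; exact: has_mean_indicM.
split.
  by under eq_fun do rewrite hE; exact: has_mean_sum.
under eq_Rintegral do rewrite hE.
rewrite expect_sum// big1// => y _.
by rewrite expectZ ?has_mean_indicM// -Rintegral_in cX ?mulr0.
Qed.

Lemma centered_ge0_mul_eq0 Z X : centered <<s F >> X ->
  sub_measurable <<s F >> Z -> (forall w, 0 <= Z w) ->
  has_mean (fun w => Z w * X w) -> \int[P]_w (Z w * X w) = 0.
Proof.
move=> cX /sub_measurableP mZ Z0 iZX.
have mZ' : measurable_fun [set: g_sigma_algebraType F] (EFin \o Z).
  exact/measurable_EFinP.
pose h := nnsfun_approx measurableT mZ'.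
have hZ (w : g_sigma_algebraType F) : EFin \o h ^~ w @ \oo --> (Z w)%:E.
  by have /= := @cvg_nnsfun_approx _ _ _ _ measurableT _ mZ' (fun x _ => Z0 x) w Logic.I.
have hZr (w : g_sigma_algebraType F) : (fun n => h n w) @ \oo --> Z w.
  exact: fine_cvg (hZ w).
have hle n w : h n w <= Z w.
  have nd : nondecreasing_seq (h ^~ w).
    by move=> m k mk; have /lefP := @nd_nnsfun_approx _ _ _ _ measurableT _ mZ' _ _ mk.
  rewrite -(cvg_lim _ (hZr w))//.
  by apply: nondecreasing_cvgn_le => //; apply/cvg_ex; eexists; exact: hZr.
have mhX n : measurable_fun setT (fun w : Omega => (h n w * X w)%:E).
  by have [/(measurable_int P)] := simple_centered_eq0 (h n) cX.
have hX : {ae P, forall w : Omega, setT w -> (h n w * X w)%:E @[n --> \oo] --> (Z w * X w)%:E}.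
  apply: aeW => w _; apply: cvg_EFin; first exact: nearW.
  by apply: cvgMr_tmp; exact: hZr.
have hXle : {ae P, forall (w : Omega) n, setT w -> (`|(h n w * X w)%:E| <= `|Z w * X w|%:E)%E}.
  apply: aeW => w n _ /=; rewrite lee_fin !normrM ler_wpM2r//.
  by rewrite !ger0_norm.
have [_ _] := dominated_convergence measurableT mhX (measurable_int _ iZX) hX
  (integrable_norm iZX) hXle.
rewrite (_ : (fun n => _) = cst 0%E); last first.
  apply/funext => n /=; have [ih h0] := simple_centered_eq0 (h n) cX.
  by rewrite expectE// h0.
by move/(cvg_unique _ (cvg_cst _)); rewrite /Rintegral => <-.
Qed.

(** Pulling a G-measurable factor out of E[_ | G] = 0: indicators by
    definition, then monotone simple approximations, dominated by [Z * X]. *)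
Lemma centered_mul_eq0 Z X : centered <<s F >> X ->
  sub_measurable <<s F >> Z -> has_mean (fun w => Z w * X w) ->
  \int[P]_w (Z w * X w) = 0.
Proof.
move=> cX mZ iZX.
have mZ' := (sub_measurableP Z).1 mZ.
have mX := has_mean_meas cX.1.
have absZ : forall w, Z w = Z^\+ w - Z^\- w by move=> w; rewrite -{1}(funrposBneg Z).
have part (Zp : Omega -> R) : sub_measurable <<s F >> Zp -> (forall w, 0 <= Zp w) ->
  (forall w, Zp w <= `|Z w|) -> has_mean (fun w => Zp w * X w) /\
  \int[P]_w (Zp w * X w) = 0.
  move=> mZp Zp0 ZpZ.
  have iZp : has_mean (fun w => Zp w * X w).
    apply: (@le_has_mean _ (fun w => `|Z w * X w|)); last exact: integrable_norm.
      by apply: measurable_funM => //; exact: sub_measurable_meas.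
    by move=> w; rewrite !normrM ler_wpM2r// ger0_norm.
  by split => //; exact: centered_ge0_mul_eq0.
have [||| ip p0] := part Z^\+.
- by apply/sub_measurableP; exact: measurable_funrpos.
- by move=> w; rewrite /funrpos le_max lexx orbT.
- by move=> w; rewrite /funrpos ge_max ler_norm normr_ge0.
have [||| im m0] := part Z^\-.
- by apply/sub_measurableP; exact: measurable_funrneg.
- by move=> w; rewrite /funrneg le_max lexx orbT.
- by move=> w; rewrite /funrneg ge_max -normrN ler_norm normr_ge0.
under eq_Rintegral do rewrite absZ mulrBl.
by rewrite expectB// p0 m0 subrr.
Qed.

End PullOut.
End Integration.

(** * Conditional expectation and conditional independence *)

Section CondExp.
Context {R : realType} {d : measure_display} {Omega : measurableType d}.
Variable P : probability Omega R.
Implicit Types (X Y Z : Omega -> R) (A : set Omega).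

Lemma le_expect_ae X Y : has_mean P X -> has_mean P Y ->
  {ae P, forall w, X w <= Y w} -> \int[P]_w X w <= \int[P]_w Y w.
Proof.
move=> iX iY XY.
have mX := has_mean_meas iX; have mY := has_mean_meas iY.
have mXY : measurable_fun setT (X \max Y) by exact: measurable_maxr.
have iXY : has_mean P (X \max Y).
  apply: (@le_has_mean _ _ _ _ _ (fun w => `|X w| + `|Y w|)) => //.
    move=> w /=; rewrite /Order.max; case: ifP => _.
      by rewrite lerDr.
    by rewrite lerDl.
  by apply: has_meanD; exact: integrable_norm.
rewrite [leRHS](_ : _ = \int[P]_w (X \max Y) w).
  by apply: le_expect => // w /=; rewrite le_max lexx.
congr fine; apply: ae_eq_integral => //; try exact/measurable_EFinP.
apply: filterS XY => w XYw _ /=; congr EFin.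
by rewrite /Order.max; case: ltgtP XYw.
Qed.

Lemma expect_ge0_eq0 X : has_mean P X -> (forall w, 0 <= X w) ->
  \int[P]_w X w <= 0 -> {ae P, forall w, X w = 0}.
Proof.
move=> iX X0 iX0.
have : (\int[P]_(w in setT) `|(X w)%:E| = 0)%E.
  under eq_integral do rewrite gee0_abs ?lee_fin//.
  rewrite expectE//; congr EFin; apply: le_anti.
  by rewrite iX0/= Rintegral_ge0.
move/ae_eq_integral_abs => /(_ measurableT (measurable_int _ iX)).
by apply: filterS => w /(_ Logic.I) [].
Qed.

Lemma has_meanM_bounded Z X : measurable_fun setT Z ->
  (forall w, 0 <= Z w <= 1) -> has_mean P X -> has_mean P (fun w => Z w * X w).
Proof.
move=> mZ Z01 iX; apply: (@le_has_mean _ _ _ _ _ (fun w => `|X w|)).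
- by apply: measurable_funM => //; exact: has_mean_meas iX.
- move=> w; have /andP[Z0 Z1] := Z01 w.
  by rewrite normrM ger0_norm// ler_piMl.
- exact: integrable_norm.
Qed.

Lemma indic01 A w : 0 <= (\1_A w : R) <= 1.
Proof. by rewrite indicE; case: (_ \in _); rewrite ?lexx ler01. Qed.

Lemma has_mean_indic A : measurable A -> has_mean P (\1_A : Omega -> R).
Proof. exact: integrable_indic. Qed.

Section Fixed.
Variable F : set (set Omega).
Hypothesis mF : <<s F >> `<=` measurable.
Let G := <<s F >>.

Lemma sub_measurable_indic A : G A -> sub_measurable G (\1_A : Omega -> R).
Proof.
move=> GA; apply/sub_measurableP.
by have := @measurable_indic _ (g_sigma_algebraType F) R setT A GA.
Qed.

Lemma sub_measurableM X Y : sub_measurable G X -> sub_measurable G Y ->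
  sub_measurable G (fun w => X w * Y w).
Proof.
move=> /sub_measurableP mX /sub_measurableP mY; apply/sub_measurableP.
exact: measurable_funM.
Qed.

(** Test the defining equalities on the event where the order fails. *)
Lemma condexp_mono X X' Z Z' : is_condexp P G X Z -> is_condexp P G X' Z' ->
  (forall w, X w <= X' w) -> {ae P, forall w, Z w <= Z' w}.
Proof.
move=> [iX iZ mZ XZ] [iX' iZ' mZ' XZ'] XX'.
pose A := [set w | Z' w < Z w].
have GA : G A.
  have := @measurable_fun_ltr _ (g_sigma_algebraType F) R setT Z' Z
    ((sub_measurableP F Z').1 mZ') ((sub_measurableP F Z).1 mZ).
  move=> /(_ measurableT [set true]) /=.
  by rewrite setTI; apply.
have mA := mF GA.
pose D w := \1_A w * (Z w - Z' w).
have iD : has_mean P D by apply: has_mean_indicM => //; exact: has_meanB.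
have [] : {ae P, forall w, D w = 0}.
  apply: expect_ge0_eq0 => //.
    move=> w; rewrite /D indicE; case: (boolP (w \in A)); rewrite ?mul0r// inE.
    by rewrite /A/= mul1r subr_ge0 => /ltW.
  rewrite -Rintegral_in RintegralB//; [|by apply: integrableS iZ|by apply: integrableS iZ'].
  rewrite subr_le0 /Rintegral XZ// XZ'//; apply: le_Rintegral => //.
    by apply: integrableS iX.
  by apply: integrableS iX'.
move=> N [mN N0 DN]; exists N; split => //; apply: subset_trans DN => w /= + Dw.
move=> /negP; rewrite -ltNge => ZZ; move: Dw.
rewrite /D indicE mem_set// mul1r => /eqP; rewrite subr_eq0 => /eqP ZE.
by move: ZZ; rewrite ZE ltxx.
Qed.

Lemma condexp_uniq X Z Z' : is_condexp P G X Z -> is_condexp P G X Z' ->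
  {ae P, forall w, Z w = Z' w}.
Proof.
move=> h h'.
have := condexp_mono h h' (fun=> lexx _); have := condexp_mono h' h (fun=> lexx _).
by apply: filterS2 => w a b; apply/le_anti/andP.
Qed.

Lemma condexp_cst k : is_condexp P G (fun=> k) (fun=> k).
Proof.
split; [exact: has_mean_cst|exact: has_mean_cst| |by []].
by apply/sub_measurableP.
Qed.

(** Versions of a conditional probability have values in [0, 1] almost surely
    only; clamping gives one that is bounded everywhere. *)
Lemma condprob_version A Z : is_condexp P G (\1_A) Z ->
  exists z, [/\ is_condexp P G (\1_A) z, forall w, 0 <= z w <= 1
             & {ae P, forall w, z w = Z w}].
Proof.
move=> cZ; have [iA iZ mZ AZ] := cZ.
pose z := (fun=> 0 : R) \max ((fun=> 1) \min Z).
have z01 w : 0 <= z w <= 1.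
  by rewrite /z /= le_max lexx/= ge_max ler01/= ge_min lexx.
have mz : sub_measurable G z.
  apply/sub_measurableP; apply: measurable_maxr => //.
  by apply: measurable_minr => //; exact/sub_measurableP.
have zZ : {ae P, forall w, z w = Z w}.
  have l0 := condexp_mono (condexp_cst 0) cZ (fun w => (andP (indic01 A w)).1).
  have l1 := condexp_mono cZ (condexp_cst 1) (fun w => (andP (indic01 A w)).2).
  apply: filterS2 l0 l1 => w Z0 Z1; rewrite /z /=.
  by rewrite (min_idPr Z1) (max_idPr Z0).
have mz' := sub_measurable_meas mF mz.
exists z; split => //; split => //.
- apply: (@le_has_mean _ _ _ _ _ (fun=> 1)) => //; last exact: has_mean_cst.
  by move=> w; have /andP[z0 z1] := z01 w; rewrite ger0_norm.
- move=> B GB; rewrite -AZ//; have mB := mF GB.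
  apply: ae_eq_integral => //.
  + apply: measurable_funTS; exact/measurable_EFinP.
  + by apply: measurable_funTS; exact: measurable_int iZ.
  + by apply: filterS zZ => w -> _.
Qed.

End Fixed.

(** Dynkin's pi-lambda argument, applied to the events of zero integral. *)
Lemma centered_pi_system (Pi : set (set Omega)) X :
  <<s Pi >> `<=` measurable -> setI_closed Pi -> Pi setT -> has_mean P X ->
  (forall A, Pi A -> \int[P]_w (\1_A w * X w) = 0) -> centered P <<s Pi >> X.
Proof.
move=> mPi PiI PiT iX Pi0; split => // A; rewrite Rintegral_in.
move: A; apply: (@dynkin_induction _ (g_sigma_algebraType Pi) Pi
  (fun A => \int[P]_w (\1_A w * X w) = 0)) => //.
- exact: Pi0.
- move=> A mA A0.
  rewrite (_ : (fun w => _) = fun w => \1_setT w * X w - \1_A w * X w).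
    rewrite expectB ?(Pi0 setT PiT) ?A0 ?subrr//; apply: has_mean_indicM => //.
    exact: mPi.
  apply/funext => w; rewrite indicC !indicE in_setT.
  by case: (w \in A) => /=; rewrite !(mul1r, mul0r) ?subrr ?subr0.
- move=> H mH tH H0; rewrite -Rintegral_in /Rintegral integral_bigcup//.
  + rewrite eseries0// => i _ _.
    have mHi : measurable (H i : set Omega) := mPi _ (mH i).
    transitivity (\int[P]_(w in H i) X w)%:E; last by rewrite Rintegral_in H0.
    rewrite fineK//; apply: integrable_fin_num => //.
    by apply: integrableS iX.
  + by move=> k; exact: mPi (mH k).
  + apply: integrableS iX => //; apply: bigcup_measurable => k _.
    exact: mPi (mH k).
Qed.

Section CondIndep.
Context {dS : measure_display} {S : measurableType dS} {n : nat}.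
Variables (F : set (set Omega)) (xi : 'I_n -> Omega -> S).
Hypothesis mF : <<s F >> `<=` measurable.
Hypothesis mxi : forall i, measurable_fun setT (xi i).
Hypothesis cxi : cond_independent P <<s F >> xi.
Let G := <<s F >>.

(** A pi-system generating the join of G and sigma(xi i). *)
Definition rectangles (i : 'I_n) : set (set Omega) :=
  [set A | exists B E, [/\ G B, measurable E & A = B `&` xi i @^-1` E]].

Lemma rectangles_measurable i : <<s rectangles i >> `<=` measurable.
Proof.
apply: smallest_sub; first exact: sigma_algebra_measurable.
move=> _ [B [E [GB mE ->]]]; apply: measurableI; first exact: mF.
by rewrite -[_ @^-1` _]setTI; exact: mxi.
Qed.

Lemma rectangles_setI i : setI_closed (rectangles i).
Proof.
move=> _ _ [B [E [GB mE ->]]] [B' [E' [GB' mE' ->]]].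
exists (B `&` B'), (E `&` E'); split; last by rewrite setIACA preimage_setI.
  exact: (@measurableI _ (g_sigma_algebraType F)).
exact: measurableI.
Qed.

Lemma GsetT : G setT.
Proof. exact: (@measurableT _ (g_sigma_algebraType F)). Qed.

Lemma rectangles_setT i : rectangles i setT.
Proof. by exists setT, setT; split; rewrite ?preimage_setT ?setTI//; exact: GsetT. Qed.

(** The factorization for two agents, from events that are trivial for the
    other agents. *)
Lemma cond_independent_pair i j (Ei Ej : set S) zi zj : i != j ->
  measurable Ei -> measurable Ej ->
  is_condexp P G (\1_(xi i @^-1` Ei)) zi ->
  is_condexp P G (\1_(xi j @^-1` Ej)) zj ->
  forall B, G B -> \int[P]_(w in B) (\1_(xi i @^-1` Ei) w * \1_(xi j @^-1` Ej) w)
    = \int[P]_(w in B) (zi w * zj w).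
Proof.
move=> ij mEi mEj ci cj B GB.
pose E k := if k == i then Ei else if k == j then Ej else setT.
have Ei_ : E i = Ei by rewrite /E eqxx.
have Ej_ : E j = Ej by rewrite /E eq_sym (negbTE ij) eqxx.
have mE k : measurable (E k) by rewrite /E; case: ifP => // _; case: ifP.
have [Z cZ [_ iZ _ ZE]] := cxi mE.
have -> : (fun w => \1_(xi i @^-1` Ei) w * \1_(xi j @^-1` Ej) w)
    = \1_[set w | forall k, E k (xi k w)] :> (Omega -> R).
  apply/funext => w; rewrite !indicE -natrM mulnb; congr (_ %:R); congr nat_of_bool.
  apply/idP/idP.
    move=> /andP[/set_mem /= hi /set_mem /= hj]; apply/mem_set => k /=.
    rewrite /E; case: eqP => [->//|_]; by case: eqP => [->|].
  move=> /set_mem /= h; apply/andP; split; apply/mem_set => /=.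
    by move: (h i); rewrite Ei_.
  by move: (h j); rewrite Ej_.
rewrite /Rintegral -ZE//; congr fine.
have mB := mF GB.
have mz z X : is_condexp P G X z -> measurable_fun setT z.
  by case=> _ /has_mean_meas.
apply: ae_eq_integral => //.
- by apply: measurable_funTS; exact: measurable_int iZ.
- apply: measurable_funTS; apply/measurable_EFinP.
  by apply: measurable_funM; [exact: mz ci|exact: mz cj].
have ei : {ae P, forall w, Z i w = zi w}.
  by apply: (condexp_uniq mF (cZ i)); rewrite Ei_.
have ej : {ae P, forall w, Z j w = zj w}.
  by apply: (condexp_uniq mF (cZ j)); rewrite Ej_.
have ek : {ae P, forall w k, k != i -> k != j -> Z k w = 1}.
  apply: filter_forall => k; have [->|ki] := eqVneq k i; first exact: aeW.
  have [->|kj] := eqVneq k j; first exact: aeW.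
  have := cZ k; rewrite /E (negbTE ki) (negbTE kj) preimage_setT => ck.
  have := condexp_uniq mF ck.
  by rewrite indicT => /(_ _ (condexp_cst F 1)); apply: filterS.
apply: filterS3 ei ej ek => w hi hj hk _ /=; congr EFin.
rewrite (bigD1 i)//= (bigD1 j) 1?eq_sym//= hi hj big1 ?mulr1// => k /andP[ki kj].
exact: hk.
Qed.

(** Under conditional independence, E[X | G] = 0 for an [X] seen through
    [xi j] survives enlarging G by [xi i]. *)
Lemma cond_independent_centered i j X : i != j ->
  sub_measurable <<s rectangles j >> X -> centered P G X ->
  centered P <<s rectangles i >> X.
Proof.
move=> ij mX cX; have iX := cX.1.
apply: centered_pi_system => //.
- exact: rectangles_measurable.
- exact: rectangles_setI.
- exact: rectangles_setT.
move=> _ [D [Ei [GD mEi ->]]].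
pose fam (k : 'I_n) (E : set S) := fun l : 'I_n => if l == k then E else setT.
have version k E : measurable E -> exists z,
    is_condexp P G (\1_(xi k @^-1` E)) z /\ forall w, 0 <= z w <= 1.
  move=> mE; have mfam l : measurable (fam k E l) by rewrite /fam; case: ifP.
  have [Z cZ _] := cxi mfam.
  have := cZ k; rewrite /fam eqxx => /(condprob_version mF)[z [cz z01 _]].
  by exists z.
have [zi [ci zi01]] := version i Ei mEi.
have mzi : sub_measurable G zi by case: ci.
have mzi' := sub_measurable_meas mF mzi.
have mD := mF GD.
pose a : Omega -> R := \1_(xi i @^-1` Ei).
have mai : measurable (xi i @^-1` Ei) by rewrite -[_ @^-1` _]setTI; exact: mxi.
have ia : has_mean P a by exact: has_mean_indic.
have izi : has_mean P zi by case: ci.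
have iV : has_mean P (fun w => \1_D w * (a w - zi w)).
  by apply: has_mean_indicM => //; exact: has_meanB.
have cV : centered P <<s rectangles j >> (fun w => \1_D w * (a w - zi w)).
  apply: centered_pi_system => //.
  - exact: rectangles_measurable.
  - exact: rectangles_setI.
  - exact: rectangles_setT.
  move=> _ [B [Ej [GB mEj ->]]].
  have [zj [cj zj01]] := version j Ej mEj.
  have mB := mF GB.
  pose b : Omega -> R := \1_(xi j @^-1` Ej).
  have maj : measurable (xi j @^-1` Ej) by rewrite -[_ @^-1` _]setTI; exact: mxi.
  have ib : has_mean P b by exact: has_mean_indic.
  have izj : has_mean P zj by case: cj.
  have GBD : G (B `&` D) by exact: (@measurableI _ (g_sigma_algebraType F)).
  have mBD := mF GBD.
  have iab : has_mean P (fun w => a w * b w) by exact: has_mean_indicM.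
  have izb : has_mean P (fun w => zi w * b w) by exact: has_meanM_bounded.
  have izz : has_mean P (fun w => zi w * zj w) by exact: has_meanM_bounded.
  have cbz := condexp_centered mF cj.
  have b_zj : \int[P]_w (\1_(B `&` D) w * (zi w * b w)) =
              \int[P]_w (\1_(B `&` D) w * (zi w * zj w)).
    apply/eqP; rewrite -subr_eq0 -expectB; [|exact: has_mean_indicM..].
    apply/eqP; rewrite -[RHS](centered_mul_eq0 mF
        (Z := fun w => \1_(B `&` D) w * zi w) cbz).
    - by apply: eq_Rintegral => w _; rewrite mulrBr !mulrA.
    - by apply: sub_measurableM => //; exact: sub_measurable_indic.
    - under eq_fun do rewrite -mulrA.
      apply: has_mean_indicM => //; apply: has_meanM_bounded => //.
      exact: has_meanB.
  have := cond_independent_pair ij mEi mEj ci cj GBD.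
  rewrite [LHS]Rintegral_in [RHS]Rintegral_in -b_zj -/a -/b => ab.
  rewrite (_ : (fun w => _) = fun w => \1_(B `&` D) w * (a w * b w)
                                    - \1_(B `&` D) w * (zi w * b w)).
    by rewrite expectB ?ab ?subrr//; exact: has_mean_indicM.
  by apply/funext => w; rewrite !indicI /= -/b; ring.
have iXV : has_mean P (fun w => X w * (\1_D w * (a w - zi w))).
  rewrite (_ : (fun w => _) = fun w => \1_D w * (a w * X w) - \1_D w * (zi w * X w)).
    apply: has_meanB; apply: has_mean_indicM => //; first exact: has_mean_indicM.
    exact: has_meanM_bounded.
  by apply/funext => w; ring.
have XV0 := centered_mul_eq0 (@rectangles_measurable j) cV mX iXV.
have izX : has_mean P (fun w => (\1_D w * zi w) * X w).
  under eq_fun do rewrite -mulrA.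
  by apply: has_mean_indicM => //; exact: has_meanM_bounded.
have zX0 : \int[P]_w ((\1_D w * zi w) * X w) = 0.
  apply: (centered_mul_eq0 mF cX) => //.
  by apply: sub_measurableM => //; exact: sub_measurable_indic.
rewrite -[RHS]addr0 -{1}XV0 -zX0 -expectD//; apply: eq_Rintegral => w _.
by rewrite indicI /= -/a; ring.
Qed.

Lemma cond_independent_mul_eq0 i j X Y : i != j ->
  sub_measurable <<s rectangles i >> X -> sub_measurable <<s rectangles j >> Y ->
  centered P G Y -> has_mean P (fun w => X w * Y w) -> \int[P]_w (X w * Y w) = 0.
Proof.
move=> ij mX mY cY iXY.
apply: (centered_mul_eq0 (@rectangles_measurable i)) => //.
exact: (cond_independent_centered ij mY cY).
Qed.

End CondIndep.
End CondExp.

(** * The spectral gap *)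

Section SpectralGap.
Context {R : realType}.

Let C : numClosedFieldType := (complex.complex R).
Local Notation toC := (@complex.real_complex_def R (Phant R)).

Let toC_conj (x : R) : (toC x)^* = toC x :> C.
Proof. exact: complex.conjc_real. Qed.

Let toC_le (x y : R) : ((toC x : C) <= toC y) = (x <= y).
Proof. exact: complex.lecR. Qed.

Let toM m n (A : 'M[R]_(m, n)) : 'M[C]_(m, n) := map_mx toC A.

Let toM_mul m n p (A : 'M[R]_(m, n)) (B : 'M[R]_(n, p)) :
  toM (A *m B) = toM A *m toM B.
Proof. exact: map_mxM. Qed.

(** A real symmetric matrix is normal over R[i], where the spectral theorem
    applies. *)
Lemma symmetric_diagonalization n (W : 'M[R]_n) : W^T = W ->
  exists (U : 'M[C]_n) (sp : 'rV[C]_n),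
    [/\ U \in unitmx, invmx U = (map_mx Num.conj U)^T,
        toM W = invmx U *m diag_mx sp *m U
      & char_poly (toM W) = \prod_i ('X - (sp 0 i)%:P)].
Proof.
move=> WT; pose W' := toM W.
have W'T : W'^T = W' by rewrite /W' /toM map_trmx WT.
have W'c : map_mx Num.conj W' = W'.
  by apply/matrixP => i j; rewrite !mxE toC_conj.
have normalW : W' \is normalmx by apply/normalmxP; rewrite W'T W'c.
have E := orthomx_spectralP normalW.
exists (spectralmx W'), (spectral_diag W'); split => //.
- exact: spectral_unit.
- by rewrite invmx_unitary ?spectral_unitarymx// map_trmx.
rewrite -/W'; set U := spectralmx W' in E *; set sp := spectral_diag W' in E *.
have Uu : U \in unitmx by exact: spectral_unit.
have -> : char_poly W' = char_poly (diag_mx sp).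
  rewrite /char_poly /char_poly_mx E !map_mxM/=.
  have UV : map_mx polyC (invmx U) *m map_mx polyC U = 1%:M.
    by rewrite -map_mxM mulVmx// map_mx1.
  rewrite -{1}(mulmx1 'X%:M) -UV mulmxA -scalar_mxC -mulmxBl -mulmxBr.
  rewrite !det_mulmx mulrAC -det_mulmx UV det1 mul1r.
  by [].
rewrite char_poly_trig; last exact: diag_mx_is_trig.
by apply: eq_bigr => i _; rewrite mxE eqxx mulr1n.
Qed.

(** Expand in an eigenbasis: 1 is a simple eigenvalue, so a vector orthogonal
    to the all-ones vector has no component on it, and every other eigenvalue
    is at most lambda_2. *)
Lemma spectral_gap n (W : 'M[R]_n) (lam : seq R) : W^T = W ->
  W *m const_mx 1 = const_mx 1 :> 'cV[R]_n -> sorted_eigenvalues W lam ->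
  lam`_1 < 1 ->
  forall v : 'rV[R]_n, v *m const_mx 1 = 0 :> 'M[R]_1 ->
  (v *m W *m v^T) 0 0 <= lam`_1 * (v *m v^T) 0 0.
Proof.
move=> WT W1 [lam_sorted lamE] lam1 v v1.
have [U [sp [Uu Uinv WE spE]]] := symmetric_diagonalization WT.
have lam_perm : perm_eq [seq sp 0 i | i <- index_enum 'I_n] [seq toC x | x <- lam].
  apply: prod_XsubC_eq; rewrite !big_map -spE.
  rewrite -map_char_poly lamE map_prod_XsubC.
  by apply: eq_bigr.
pose coord (u : 'rV[R]_n) : 'rV[C]_n := toM u *m invmx U.
have coordE (u : 'rV[R]_n) i : (U *m (toM u)^T) i 0 = (coord u 0 i)^*.
  rewrite /coord Uinv !mxE rmorph_sum; apply: eq_bigr => k _.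
  by rewrite !mxE rmorphM/= toC_conj conjCK mulrC.
pose o : 'rV[R]_n := const_mx 1.
have dotE (u u' : 'rV[R]_n) :
    toC ((u *m u'^T) 0 0) = \sum_i coord u 0 i * (coord u' 0 i)^*.
  have -> : toC ((u *m u'^T) 0 0) = (toM u *m (toM u')^T) 0 0 :> C.
    by rewrite /toM map_trmx -/(toM _) -toM_mul [in RHS]mxE.
  rewrite -[toM u](mulmxKV Uu) -(mulmxA (toM u *m invmx U)) mxE.
  by apply: eq_bigr => i _; rewrite coordE.
have quadE : toC ((v *m W *m v^T) 0 0) =
    \sum_i sp 0 i * (coord v 0 i * (coord v 0 i)^*).
  have -> : toC ((v *m W *m v^T) 0 0) =
      (toM v *m toM W *m (toM v)^T) 0 0 :> C.
    by rewrite {2}/toM map_trmx -/(toM _) -!toM_mul [in RHS]mxE.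
  rewrite WE !mulmxA -mulmxA mxE; apply: eq_bigr => i _.
  rewrite coordE mulrA; congr (_ * _).
  by rewrite mul_mx_diag mxE mulrC.
have o_eig i : coord o 0 i * sp 0 i = coord o 0 i.
  have oW : toM o *m toM W = toM o :> 'rV[C]_n.
    rewrite -toM_mul; congr toM.
    by rewrite -[LHS]trmxK trmx_mul WT trmx_const W1 trmx_const.
  have := congr1 (fun u : 'rV[C]_n => (u *m invmx U) 0 i) oW.
  by rewrite WE !mulmxA mulmxK// mul_mx_diag mxE.
have lam_ge k : (0 < k)%N -> (k < size lam)%N -> lam`_k <= lam`_1.
  move=> k0 ks; have [->//|k1] := eqVneq k 1%N.
  have tr : transitive (fun a b : R => b <= a) by move=> a b c ab ca; exact: le_trans ca ab.
  have s1 : (1 < size lam)%N by rewrite (leq_ltn_trans _ ks).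
  apply: (sorted_ltn_nth tr 0 lam_sorted 1%N k) => //.
  by rewrite ltn_neqAle eq_sym k1.
have [z|/eqP/rowP] := eqVneq v 0.
  by rewrite z !mul0mx mxE mulr0.
move=> vn0.
have n_gt0 : (0 < n)%N.
  by case: n W lam_sorted v v1 {lamE WT W1 U sp Uu Uinv WE spE lam_perm coord coordE o dotE quadE o_eig lam_ge} vn0 => // W _ v _ []; case.
have oo : \sum_i coord o 0 i * (coord o 0 i)^* = n%:R.
  rewrite -dotE !mxE (eq_bigr (fun=> 1)) => [|i _]; last by rewrite !mxE mulr1.
  by rewrite sumr_const card_ord rmorph_nat.
have [i0 oi0] : exists i0, coord o 0 i0 != 0.
  apply/existsP; apply: contraPT oo => /existsPn h; rewrite big1.
    by move/esym/eqP; rewrite pnatr_eq0 -leqn0 leqNgt n_gt0.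
  by move=> i _; have /negPn/eqP -> := h i; rewrite mul0r.
have spi0 : sp 0 i0 = 1.
  by apply: (mulfI oi0); rewrite o_eig mulr1.
have inlam i : exists2 k, (k < size lam)%N & sp 0 i = toC lam`_k.
  have : sp 0 i \in [seq toC x | x <- lam].
    by rewrite -(perm_mem lam_perm) map_f ?mem_index_enum.
  by case/mapP => x /(nthP 0)[k ks <-] ->; exists k.
have spn1 i : i != i0 -> sp 0 i <= toC lam`_1.
  move=> ii0; have [k ks spk] := inlam i.
  have [k0|k0] := posnP k; last first.
    by rewrite spk toC_le lam_ge.
  rewrite {}k0 in ks spk; exfalso.
  have l0 : lam`_0 = 1.
    have [k1 ks1] := inlam i0; rewrite spi0 => /esym k1E.
    have {}k1E : lam`_k1 = 1 by apply: (@complexI R); rewrite k1E.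
    case: k1 ks1 k1E => // k1 ks1 k1E.
    by move: (lam_ge _ (ltn0Sn k1) ks1); rewrite k1E leNgt lam1.
  rewrite l0 in spk.
  have c1 : (count_mem (toC 1) [seq toC x | x <- lam] <= 1)%N.
    case: lam l0 lam1 lam_ge {lam_sorted lamE lam_perm inlam ks} => //= a s ->.
    move=> s1 sge; rewrite eqxx add1n ltnS leqNgt -has_count.
    apply/hasPn => _ /mapP[x /(nthP 0)[k' ks' <-] ->] /=.
    apply/eqP => /complexI E; have := sge k'.+1 isT ks'.
    by rewrite /= E leNgt s1.
  move: c1; have /permP <- := lam_perm; rewrite count_map -size_filter.
  set l := seq.filter _ _; have ll : {subset [:: i; i0] <= l}.
    move=> x; rewrite !inE mem_filter mem_index_enum /= andbT.
    by move=> /orP[]/eqP ->; rewrite ?spk ?spi0.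
  have : uniq [:: i; i0] by rewrite /= inE ii0.
  by move=> /uniq_leq_size/(_ ll)/leq_trans h /h.
have c0 : coord v 0 i0 = 0.
  have : toC ((v *m o^T) 0 0) = 0 :> C by rewrite /o trmx_const v1 mxE.
  rewrite dotE (bigD1 i0)//= big1 ?addr0 => [/eqP|i ii0].
    by rewrite mulf_eq0 conjC_eq0 (negbTE oi0) orbF => /eqP.
  suff -> : coord o 0 i = 0 by rewrite conjC0 mulr0.
  apply/eqP; apply: contraTT (spn1 i ii0) => oi.
  have -> : sp 0 i = 1 by apply: (mulfI oi); rewrite o_eig mulr1.
  by rewrite -[1]/(toC 1) toC_le leNgt lam1.
rewrite -toC_le quadE.
have -> : toC (lam`_1 * (v *m v^T) 0 0) = toC lam`_1 * toC ((v *m v^T) 0 0) :> C.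
  exact: rmorphM.
rewrite dotE mulr_sumr; apply: ler_sum => i _.
have [->|ii0] := eqVneq i i0; first by rewrite c0 !mul0r !mulr0.
by rewrite ler_wpM2r ?spn1// mul_conjC_ge0.
Qed.

End SpectralGap.

(** * Inner products and the gossip form *)

Section InnerProduct.
Context {R : realType}.

Definition dot m n (A B : 'M[R]_(m, n)) : R := \sum_i \sum_j A i j * B i j.

Definition sqn m n (A : 'M[R]_(m, n)) : R := dot A A.

Section Bilinear.
Variables (m n : nat).
Implicit Types A B : 'M[R]_(m, n).

Lemma dotC A B : dot A B = dot B A.
Proof. by apply: eq_bigr => i _; apply: eq_bigr => j _; rewrite mulrC. Qed.

Lemma dotDl A A' B : dot (A + A') B = dot A B + dot A' B.
Proof.
rewrite /dot -big_split; apply: eq_bigr => i _; rewrite -big_split.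
by apply: eq_bigr => j _; rewrite mxE mulrDl.
Qed.

Lemma dotZl k A B : dot (k *: A) B = k * dot A B.
Proof.
rewrite /dot mulr_sumr; apply: eq_bigr => i _; rewrite mulr_sumr.
by apply: eq_bigr => j _; rewrite mxE mulrA.
Qed.

Lemma dotNl A B : dot (- A) B = - dot A B.
Proof. by rewrite -scaleN1r dotZl mulN1r. Qed.

Lemma dotDr A B B' : dot A (B + B') = dot A B + dot A B'.
Proof. by rewrite dotC dotDl !(dotC _ A). Qed.

Lemma dotZr k A B : dot A (k *: B) = k * dot A B.
Proof. by rewrite dotC dotZl dotC. Qed.

Lemma dotNr A B : dot A (- B) = - dot A B.
Proof. by rewrite dotC dotNl dotC. Qed.

Lemma dot0l B : dot 0 B = 0.
Proof. by rewrite -(scale0r 0) dotZl mul0r. Qed.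

Lemma sqn_ge0 A : 0 <= sqn A.
Proof. by apply: sumr_ge0 => i _; apply: sumr_ge0 => j _; exact: sqr_ge0. Qed.

Lemma frob_sqr A : frob A ^+ 2 = sqn A.
Proof.
have E : sqn A = \sum_i \sum_j A i j ^+ 2 by [].
by rewrite /frob sqr_sqrtr -E ?sqn_ge0.
Qed.

Lemma frob_ge0 A : 0 <= frob A.
Proof. exact: sqrtr_ge0. Qed.

Lemma sqnZ k A : sqn (k *: A) = k ^+ 2 * sqn A.
Proof. by rewrite /sqn dotZl dotZr mulrA. Qed.

Lemma sqnN A : sqn (- A) = sqn A.
Proof. by rewrite /sqn dotNl dotNr opprK. Qed.

Lemma sqnD A B : sqn (A + B) = sqn A + 2 * dot A B + sqn B.
Proof. by rewrite /sqn dotDl !dotDr (dotC B A); ring. Qed.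

Lemma sqnB A B : sqn (A - B) = sqn A - 2 * dot A B + sqn B.
Proof. by rewrite sqnD dotNr sqnN; ring. Qed.

Lemma sqnD_young t A B : 0 < t ->
  sqn (A + B) <= (1 + t) * sqn A + (1 + t^-1) * sqn B.
Proof.
move=> t0; have := sqn_ge0 (t *: A - B).
rewrite sqnB sqnZ dotZl sqnD => h.
have -> : (1 + t) * sqn A + (1 + t^-1) * sqn B =
  sqn A + 2 * dot A B + sqn B
  + t^-1 * (t ^+ 2 * sqn A - 2 * (t * dot A B) + sqn B) by field; rewrite gt_eqF.
by rewrite lerDl mulr_ge0// invr_ge0 ltW.
Qed.

Lemma sqnD_le2 A B : sqn (A + B) <= 2 * sqn A + 2 * sqn B.
Proof. by have := sqnD_young A B ltr01; rewrite invr1. Qed.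

Lemma sqnD_le3 A B D : sqn (A + B + D) <= 3 * sqn A + 3 * sqn B + 3 * sqn D.
Proof.
have h2 : (0 : R) < 2^-1 by [].
by have := sqnD_young (A + B) D h2; have := sqnD_le2 A B; lra.
Qed.

Lemma sqnD_le4 A B D E :
  sqn (A + B + D + E) <= 4 * sqn A + 4 * sqn B + 4 * sqn D + 4 * sqn E.
Proof.
have h2 : (0 : R) < 3^-1 by [].
by have := sqnD_young (A + B + D) E h2; have := sqnD_le3 A B D; lra.
Qed.

Lemma sqnD_le5 A B D E H : sqn (A + B + D + E + H) <=
  5 * sqn A + 5 * sqn B + 5 * sqn D + 5 * sqn E + 5 * sqn H.
Proof.
have h2 : (0 : R) < 4^-1 by [].
by have := sqnD_young (A + B + D + E) H h2; have := sqnD_le4 A B D E; lra.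
Qed.

End Bilinear.

Lemma dot_trace m n (A B : 'M[R]_(m, n)) : dot A B = \tr (A *m B^T).
Proof.
apply: eq_bigr => i _; rewrite mxE; apply: eq_bigr => j _.
by rewrite mxE.
Qed.

Lemma dot_adj m k n (M : 'M[R]_(m, k)) (A : 'M[R]_(k, n)) (B : 'M[R]_(m, n)) :
  dot (M *m A) B = dot A (M^T *m B).
Proof.
by rewrite !dot_trace -mulmxA mxtrace_mulC trmx_mul trmxK mulmxA.
Qed.

Lemma dot_rows m n (A B : 'M[R]_(m, n)) :
  dot A B = \sum_i dot (row i A) (row i B).
Proof.
apply: eq_bigr => i _; rewrite /dot big_ord1; apply: eq_bigr => j _.
by rewrite !mxE.
Qed.

Lemma sqn_rows m n (A : 'M[R]_(m, n)) : sqn A = \sum_i sqn (row i A).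
Proof. exact: dot_rows. Qed.

Section Averaging.
Variable n : nat.
Hypothesis n_gt0 : (0 < n)%N.

Definition avg_mx : 'M[R]_n := const_mx n%:R^-1.
Local Notation J := avg_mx.

Let n0 : (n%:R : R) != 0. Proof. by rewrite pnatr_eq0 -lt0n. Qed.

Lemma avg_mx_tr : J^T = J.
Proof. exact: trmx_const. Qed.

Lemma avg_mx_idem : J *m J = J.
Proof.
apply/matrixP => i j; rewrite !mxE (eq_bigr (fun=> n%:R^-1 * n%:R^-1)).
  by rewrite sumr_const card_ord -(mulr_natl (_ * _)) mulrA mulfV// mul1r.
by move=> k _; rewrite !mxE.
Qed.

Lemma row_avg_mx p (x : 'M[R]_(n, p)) i : row i (J *m x) = row_mean x.
Proof.
apply/rowP => j; rewrite !mxE summxE mulr_sumr; apply: eq_bigr => k _.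
by rewrite !mxE.
Qed.

Lemma sqn_avg_mx p (x : 'M[R]_(n, p)) : sqn (J *m x) = n%:R * sqn (row_mean x).
Proof.
rewrite sqn_rows (eq_bigr (fun=> sqn (row_mean x))) => [|i _]; last by rewrite row_avg_mx.
by rewrite sumr_const card_ord mulr_natl.
Qed.

Lemma row_mean_avg p (x : 'M[R]_(n, p)) : row_mean (J *m x) = row_mean x.
Proof.
rewrite /row_mean (eq_bigr (fun=> row_mean x)) => [|i _]; last exact: row_avg_mx.
by rewrite sumr_const card_ord -(scaler_nat _ (row_mean x)) scalerA mulVf// scale1r.
Qed.

Lemma row_meanD p (x y : 'M[R]_(n, p)) : row_mean (x + y) = row_mean x + row_mean y.
Proof.
rewrite /row_mean -scalerDr -big_split; congr (_ *: _).
by apply: eq_bigr => i _; rewrite linearD.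
Qed.

Lemma row_meanZ p k (x : 'M[R]_(n, p)) : row_mean (k *: x) = k *: row_mean x.
Proof.
rewrite /row_mean [RHS]scalerA mulrC -scalerA [in RHS]scaler_sumr; congr (_ *: _).
by apply: eq_bigr => i _; rewrite linearZ.
Qed.

Lemma row_meanB p (x y : 'M[R]_(n, p)) : row_mean (x - y) = row_mean x - row_mean y.
Proof. by rewrite -scaleN1r row_meanD row_meanZ scaleN1r. Qed.

Definition cen_mx : 'M[R]_n := 1%:M - J.
Local Notation Pi := cen_mx.

Lemma cen_mx_tr : Pi^T = Pi.
Proof. by rewrite linearB/= trmx1 avg_mx_tr. Qed.

Lemma cen_avg0 : Pi *m J = 0.
Proof. by rewrite mulmxBl mul1mx avg_mx_idem subrr. Qed.

Lemma avg_cen0 : J *m Pi = 0.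
Proof. by rewrite mulmxBr mulmx1 avg_mx_idem subrr. Qed.

Lemma cen_mx_idem : Pi *m Pi = Pi.
Proof. by rewrite {1}/cen_mx mulmxBl mul1mx avg_cen0 subr0. Qed.

Lemma cen_avgE p (x : 'M[R]_(n, p)) : Pi *m x = x - J *m x.
Proof. by rewrite mulmxBl mul1mx. Qed.

Lemma sqn_cen_avg p (x : 'M[R]_(n, p)) : sqn x = sqn (Pi *m x) + sqn (J *m x).
Proof.
have {1}-> : x = Pi *m x + J *m x by rewrite -mulmxDl subrK mul1mx.
rewrite sqnD dot_adj cen_mx_tr mulmxA cen_avg0 mul0mx dotC dot0l; ring.
Qed.

Lemma sqn_cen_le p (x : 'M[R]_(n, p)) : sqn (Pi *m x) <= sqn x.
Proof. by rewrite [leRHS]sqn_cen_avg lerDl sqn_ge0. Qed.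

Lemma sqn_avg_le p (x : 'M[R]_(n, p)) : sqn (J *m x) <= sqn x.
Proof. by rewrite [leRHS]sqn_cen_avg lerDr sqn_ge0. Qed.

Lemma sqn_row_mean_le p (x : 'M[R]_(n, p)) : sqn (row_mean x) <= n%:R^-1 * sqn x.
Proof.
by rewrite ler_pdivlMl ?ltr0n// -sqn_avg_mx sqn_avg_le.
Qed.

End Averaging.

(** B stands for (gamma/2)(I - W), with [lo] and [hi] bounding its spectrum on
    the vectors with zero mean. *)
Section GossipForm.
Variables (n p : nat) (B : 'M[R]_n) (lo hi : R).
Hypothesis n_gt0 : (0 < n)%N.
Hypotheses (lo_gt0 : 0 < lo) (hi_gt0 : 0 < hi).
Hypothesis B_tr : B^T = B.
Hypothesis BJ : B *m avg_mx n = 0.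
Hypothesis B_ge : forall m (v : 'M[R]_(n, m)), avg_mx n *m v = 0 ->
  lo * sqn v <= dot v (B *m v).
Hypothesis B_le : forall m (v : 'M[R]_(n, m)), dot v (B *m v) <= hi * sqn v.

Local Notation J := (avg_mx n).
Local Notation Pi := (cen_mx n).
Implicit Types v s t : 'M[R]_(n, p).

Lemma gossip_JB : J *m B = 0.
Proof. by rewrite -[LHS]trmxK trmx_mul B_tr avg_mx_tr BJ trmx0. Qed.

Lemma gossip_cen : B *m Pi = B.
Proof. by rewrite mulmxBr mulmx1 BJ subr0. Qed.

Lemma gossip_ge0 m (v : 'M[R]_(n, m)) : 0 <= dot v (B *m v).
Proof.
have -> : dot v (B *m v) = dot (Pi *m v) (B *m (Pi *m v)).
  rewrite mulmxA gossip_cen dot_adj cen_mx_tr mulmxA.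
  by rewrite [Pi *m B]mulmxBl mul1mx gossip_JB subr0.
apply: le_trans (B_ge _).
  by rewrite mulr_ge0 ?sqn_ge0// ltW.
by rewrite mulmxA avg_cen0// mul0mx.
Qed.

(** B^2 <= hi B, from the nonnegativity of the form of B at
    [hi *: v - B *m v]. *)
Lemma gossip_sqn_le m (v : 'M[R]_(n, m)) : sqn (B *m v) <= hi * dot v (B *m v).
Proof.
have := gossip_ge0 (hi *: v - B *m v).
have -> : dot (hi *: v - B *m v) (B *m (hi *: v - B *m v)) =
  hi ^+ 2 * dot v (B *m v) - 2 * hi * sqn (B *m v) + dot (B *m v) (B *m (B *m v)).
  rewrite mulmxBr -scalemxAr !(dotDl, dotDr, dotNl, dotNr, dotZl, dotZr).
  have -> : dot v (B *m (B *m v)) = sqn (B *m v) by rewrite /sqn [in RHS]dot_adj B_tr.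
  by rewrite -/(sqn _); ring.
move=> h; have h2 := B_le (B *m v).
have : 0 <= hi * (hi * dot v (B *m v) - sqn (B *m v)) by rewrite /sqn in h h2 *; lra.
by rewrite pmulr_rge0// subr_ge0.
Qed.

(** On the vectors with zero mean this inverts B; on the constants, where B
    vanishes, it is the identity. *)
Definition gossip_pinv : 'M[R]_n := invmx (B + J).
Local Notation T := gossip_pinv.

Lemma gossip_unit : B + J \in unitmx.
Proof.
rewrite -row_free_unit -kermx_eq0; apply/rowV0P => u /sub_kermxP uBJ.
have uJ : u *m J = 0.
  have := congr1 (mulmx^~ J) uBJ.
  by rewrite mul0mx -mulmxA mulmxDl BJ add0r avg_mx_idem.
have uB : u *m B = 0 by move: uBJ; rewrite mulmxDr uJ addr0.
have Ju : J *m u^T = 0 by rewrite -[LHS]trmxK trmx_mul trmxK avg_mx_tr uJ trmx0.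
have := B_ge Ju; rewrite (_ : B *m u^T = 0); last first.
  by rewrite -[LHS]trmxK trmx_mul trmxK B_tr uB trmx0.
rewrite dotC dot0l pmulr_rle0// => h.
have {h} : sqn u^T = 0 by apply/le_anti; rewrite h sqn_ge0.
rewrite /sqn /dot => /eqP; rewrite psumr_eq0; last first.
  by move=> i _; apply: sumr_ge0 => j _; exact: sqr_ge0.
move=> /allP h; apply/rowP => j; rewrite mxE; have := h j (mem_index_enum _).
by rewrite /= big_ord1 mxE mulf_eq0 orbb => /eqP.
Qed.

Lemma gossip_pinv_tr : T^T = T.
Proof. by rewrite /T trmx_inv linearD/= B_tr avg_mx_tr. Qed.

Lemma pinv_avg : T *m J = J.
Proof.
have h : (B + J) *m J = J by rewrite mulmxDl BJ add0r avg_mx_idem.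
by rewrite -{1}h mulmxA mulVmx ?gossip_unit// mul1mx.
Qed.

Lemma pinv_gossip : T *m B = Pi.
Proof.
rewrite /cen_mx -(mulVmx gossip_unit) mulmxDr -/T pinv_avg; by rewrite addrK.
Qed.

Lemma gossip_pinvK : B *m T = Pi.
Proof. by rewrite -[LHS]trmxK trmx_mul B_tr gossip_pinv_tr pinv_gossip cen_mx_tr. Qed.

Lemma avg_pinv : J *m T = J.
Proof. by rewrite -[LHS]trmxK trmx_mul avg_mx_tr gossip_pinv_tr pinv_avg avg_mx_tr. Qed.

Lemma pinv_le s : J *m s = 0 -> dot s (T *m s) <= lo^-1 * sqn s.
Proof.
move=> Js; set t := T *m s.
have Jt : J *m t = 0 by rewrite mulmxA avg_pinv.
have Bt : B *m t = s by rewrite mulmxA gossip_pinvK cen_avgE Js subr0.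
have h := B_ge Jt; rewrite Bt dotC in h.
have := sqn_ge0 (lo *: t - s); rewrite sqnB sqnZ dotZl (dotC t).
have : lo * (lo * sqn t) <= lo * dot s t by rewrite ler_pM2l.
move=> h1 h2; rewrite ler_pdivlMl//; move: h1 h2; lra.
Qed.

Lemma pinv_ge s : J *m s = 0 -> sqn s <= hi * dot s (T *m s).
Proof.
move=> Js; have := gossip_sqn_le (T *m s).
by rewrite mulmxA gossip_pinvK cen_avgE Js subr0 dotC.
Qed.

(** One primal-dual step, mode by mode: in a mode where B acts as b, the pair
    (X, s) is sent to ((1 - b)(X - s), b X + (1 - b) s), and the variance of
    this convex combination makes the weighted energy X^2 + s^2 / b - s^2
    contract by 1 - b.  The perturbation [e] of the gossiped vector enters
    through a linear term and [dot e (B *m e)] only. *)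
Lemma energy_identity (X s e : 'M[R]_(n, p)) : J *m s = 0 ->
  let Y := X - s in let sh := s + B *m (Y + e) in
  sqn (Y - B *m (Y + e)) + dot sh (T *m sh) - sqn sh =
  sqn X - dot X (B *m X) + dot s (T *m s) - 2 * sqn s + dot s (B *m s)
  + dot e (B *m e) + 2 * dot e (s - B *m s).
Proof.
move=> Js /=; set v := X - s + e.
have vE : v = X - s + e by [].
move: v vE => v vE; set sh := s + B *m v.
have Ps : Pi *m s = s by rewrite cen_avgE Js subr0.
have PB : Pi *m B = B by rewrite mulmxBl mul1mx gossip_JB subr0.
have TBv : T *m (B *m v) = Pi *m v by rewrite mulmxA pinv_gossip.
have BC a b : dot (B *m a) b = dot a (B *m b) by rewrite dot_adj B_tr.
have TC (a b : 'M[R]_(n, p)) : dot (T *m a) b = dot a (T *m b).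
  by rewrite dot_adj gossip_pinv_tr.
have sv : dot s (Pi *m v) = dot s v by rewrite dotC dot_adj cen_mx_tr Ps dotC.
have Bvv : dot (B *m v) (Pi *m v) = dot v (B *m v).
  by rewrite dotC dot_adj cen_mx_tr mulmxA PB.
have BvT : dot (B *m v) (T *m s) = dot s v.
  by rewrite -TC TBv dotC sv.
have -> : dot sh (T *m sh) = dot s (T *m s) + 2 * dot s v + dot v (B *m v).
  rewrite /sh (mulmxDr T s) TBv !(dotDl, dotDr) BvT sv Bvv; ring.
rewrite /sh (sqnB (X - s)) (sqnD s) (sqnB X s).
move: (sqn (B *m v)) => q; rewrite vE !(mulmxDr, mulmxN).
rewrite !(dotDl, dotDr, dotNl, dotNr).
have BCs (a b : 'M[R]_(n, p)) : dot a (B *m b) = dot b (B *m a) by rewrite dotC BC.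
rewrite (BCs s X) (BCs e X) (BCs e s) (dotC s X) (dotC s e).
rewrite -/(sqn s); ring.
Qed.

(** Young's inequality for the form T - I, which is nonnegative as B <= I, with
    the last term bounded through the spectral gap. *)
Lemma energy_young (t : R) (a b : 'M[R]_(n, p)) : hi <= 1 -> 0 < t ->
  J *m a = 0 -> J *m b = 0 ->
  dot (a + b) (T *m (a + b)) - sqn (a + b) <=
  (1 + t) * (dot a (T *m a) - sqn a) + (1 + t^-1) * (lo^-1 * sqn b).
Proof.
move=> hi1 t0 Ja Jb.
have TC : dot b (T *m a) = dot a (T *m b).
  by rewrite dotC dot_adj gossip_pinv_tr.
have Jc : J *m (t *: a - b) = 0 by rewrite mulmxBr -scalemxAr Ja Jb scaler0 subr0.
have h0 := pinv_ge Jc; have hb := pinv_le Jb.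
have q0 : sqn (t *: a - b) <= dot (t *: a - b) (T *m (t *: a - b)).
  apply: (le_trans h0); rewrite -[leRHS]mul1r ler_wpM2r//.
  by rewrite -(pmulr_rge0 _ hi_gt0); exact: le_trans (sqn_ge0 _) h0.
have : 0 <= t^-1 * (dot (t *: a - b) (T *m (t *: a - b)) - sqn (t *: a - b)).
  by rewrite mulr_ge0 ?subr_ge0// invr_ge0 ltW.
rewrite mulmxBr mulmxDr -scalemxAr sqnB sqnZ sqnD.
rewrite !(dotDl, dotDr, dotNl, dotNr, dotZl, dotZr) TC.
set u := dot a (T *m a); set v := dot a (T *m b); set w := dot b (T *m b).
have tinv : 0 < 1 + t^-1 by rewrite ltr_wpDl// invr_gt0.
have := ler_wpM2l (ltW tinv) hb; rewrite -/w.
have := ler_wpM2l (ltW tinv) (sqn_ge0 b); rewrite mulr0.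
set k := t^-1 * _; have -> : k = t * (u - sqn a) - 2 * (v - dot a b) + t^-1 * (w - sqn b).
  by rewrite /k; field; rewrite gt_eqF.
by lra.
Qed.

End GossipForm.
End InnerProduct.

(** * Smooth functions and averages of gradients *)

Section Smoothness.
Context {R : realType} {p : nat}.
Implicit Types (f : 'rV[R]_p -> R) (x y v : 'rV[R]_p).

Lemma derive_grad f x v : differentiable f x -> 'D_v f x = dot (grad f x) v.
Proof.
move=> df; rewrite deriveE// [v in LHS]matrix_sum_delta big_ord1 linear_sum.
rewrite /dot big_ord1; apply: eq_bigr => j _.
by rewrite linearZ mxE deriveE//= mulrC.
Qed.

Lemma line_derive f x v (t : R) : (forall y, differentiable f y) ->
  is_derive t 1 (fun s : R => f (x + s *: v)) (dot (grad f (x + t *: v)) v).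
Proof.
move=> df; rewrite -derive_grad//.
have E : (fun h : R => h^-1 *: ((fun s : R => f (x + s *: v)) (h *: 1 + t) - f (x + t *: v)))
       = (fun h : R => h^-1 *: (f (h *: v + (x + t *: v)) - f (x + t *: v))).
  apply/funext => h; congr (_ *: (f _ - _)).
  by rewrite [h *: 1]mulr1 scalerDl addrCA.
have dv : derivable f (x + t *: v) v by exact: diff_derivable.
split; first by rewrite /derivable E.
by rewrite /derive E.
Qed.

(** The descent lemma: along the segment, the gap to the quadratic upper model
    is nonincreasing. *)
Lemma smooth_descent f (L : R) x v : 0 < L -> (forall y, differentiable f y) ->
  (forall y z, sqn (grad f y - grad f z) <= L ^+ 2 * sqn (y - z)) ->
  f (x + v) <= f x + dot (grad f x) v + L / 2 * sqn v.
Proof.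
move=> L0 df Lf.
pose a := dot (grad f x) v; pose b := L / 2 * sqn v.
pose phi := (fun s : R => f (x + s *: v)) - (a *: id + b *: (id ^+ 2)).
have dphi t : is_derive t (1:R) phi
    (dot (grad f (x + t *: v)) v - (a *: 1 + b *: (2 * t))).
  apply: is_deriveB; first exact: line_derive.
  apply: is_deriveD; apply: is_deriveZ.
  have := is_deriveX 2 (is_derive_id t (1 : R)); rewrite /= expr1 => d2.
  by apply: (is_derive_eq d2); rewrite -[LHS]/(2 * t * 1) mulr1.
have phiE t : phi t = f (x + t *: v) - (a * t + b * t ^+ 2) by [].
have : phi 1 <= phi 0.
  apply: (@ler0_derive1_le_cc _ phi 0 1) => //; rewrite ?in_itv/= ?lexx ?ler01//.
  - move=> t; rewrite in_itv/= => /andP[t0 t1].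
    have [_ dt] := dphi t; rewrite derive1E dt -{1}[a *: 1]/(a * 1) -[b *: _]/(b * _).
    have := sqnB (grad f (x + t *: v) - grad f x) ((L * t) *: v).
    have := sqn_ge0 (grad f (x + t *: v) - grad f x - (L * t) *: v).
    have := Lf (x + t *: v) x.
    rewrite [x + _]addrC addrK !sqnZ dotZr dotDl dotNl -/a => h1 + h2; rewrite h2.
    set D := dot _ v => h3; rewrite /b mulr1 subr_le0.
    have : (L * t) * (2 * (D - a)) <= (L * t) * (2 * (L * t * sqn v)) by move: h1 h3; lra.
    by rewrite ler_pM2l ?mulr_gt0//; lra.
  - by apply: derivable_within_continuous => t _; case: (dphi t).
rewrite !phiE scale1r scale0r addr0 !mulr1 expr1n mulr1 expr0n /= !mulr0 addr0 subr0.
by rewrite /a /b; lra.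
Qed.

End Smoothness.

Section Aggregate.
Context {R : realType} {n p : nat}.
Variables (f : 'I_n -> 'rV[R]_p -> R) (L : R).
Hypothesis n_gt0 : (0 < n)%N.
Hypothesis L_ge0 : 0 <= L.
Hypothesis df : forall i v, differentiable (f i) v.
Hypothesis Lf : smoothness_assumption f L.

Definition stacked_grad : 'M[R]_(n, p) -> 'M[R]_(n, p) :=
  rowwise (fun i => grad (f i)).
Local Notation gF := stacked_grad.

Lemma row_rowwise (h : 'I_n -> 'rV[R]_p -> 'rV[R]_p) x i :
  row i (rowwise h x) = h i (row i x).
Proof. by apply/rowP => j; rewrite !mxE. Qed.

Lemma sqn_grad_le i x y : sqn (grad (f i) x - grad (f i) y) <= L ^+ 2 * sqn (x - y).
Proof. by rewrite -!frob_sqr -exprMn ler_pXn2r ?nnegrE ?mulr_ge0 ?frob_ge0. Qed.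

Lemma sqn_stacked_grad_le x y : sqn (gF x - gF y) <= L ^+ 2 * sqn (x - y).
Proof.
rewrite !sqn_rows mulr_sumr; apply: ler_sum => i _.
by rewrite !linearB/= !row_rowwise sqn_grad_le.
Qed.

Lemma average_differentiable v : differentiable (average f) v.
Proof.
have -> : average f = n%:R^-1 *: (\sum_i f i).
  by apply/funext => x; rewrite /average /= fct_sumE.
by apply: differentiableZ; apply: differentiable_sum.
Qed.

Lemma grad_average v : grad (average f) v = row_mean (gF (\matrix_(i < n) v)).
Proof.
have -> : average f = n%:R^-1 *: (\sum_i f i).
  by apply/funext => x; rewrite /average /= fct_sumE.
apply/rowP => j; rewrite !mxE deriveZ ?derive_sum; last 2 first.
- by move=> i; exact: diff_derivable.
- by apply: derivable_sum => i; exact: diff_derivable.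
rewrite /= summxE; congr (_ * _); apply: eq_bigr => i _.
by rewrite !mxE rowK.
Qed.

Lemma grad_average_mean (x : 'M[R]_(n, p)) :
  grad (average f) (row_mean x) = row_mean (gF (avg_mx n *m x)).
Proof.
rewrite grad_average; congr (row_mean (gF _)); apply/row_matrixP => i.
by rewrite rowK row_avg_mx.
Qed.

Lemma sqn_grad_average_le v w :
  sqn (grad (average f) v - grad (average f) w) <= L ^+ 2 * sqn (v - w).
Proof.
rewrite !grad_average -row_meanB; apply: le_trans (sqn_row_mean_le n_gt0 _) _.
rewrite ler_pdivrMl ?ltr0n//; apply: le_trans (sqn_stacked_grad_le _ _) _.
rewrite mulrCA ler_wpM2l ?sqr_ge0// sqn_rows (eq_bigr (fun=> sqn (v - w))).
  by rewrite sumr_const card_ord mulr_natl.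
by move=> i _; rewrite linearB/= !rowK.
Qed.

End Aggregate.

(** * Measurability of Lipschitz functions *)

Section LipschitzMeasurable.
Context {R : realType} {d : measure_display} {T : measurableType d}.

(** The Borel structure of R^p enters only through coordinates, so a Lipschitz
    function of a random vector is measured as the pointwise limit of its
    values on finer and finer grids; on each grid it has countably many
    values. *)
Lemma lipschitz_measurable p (g : 'rV[R]_p -> R) (K : R) (X : T -> 'rV[R]_p) :
  0 <= K -> (forall x y, (g x - g y) ^+ 2 <= K * sqn (x - y)) ->
  (forall j, measurable_fun setT (fun w => X w 0 j)) ->
  measurable_fun setT (fun w => g (X w)).
Proof.
move=> K0 gK mX.
pose grid m (v : 'rV[int]_p) : 'rV[R]_p := \row_j ((v 0 j)%:~R / m.+1%:R).
pose idx m w : 'rV[int]_p := \row_j Num.floor (X w 0 j * m.+1%:R).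
apply: (@measurable_fun_cvg _ _ _ _ (fun m w => g (grid m (idx m w)))).
  move=> m _ B mB; rewrite setTI.
  have -> : (fun w => g (grid m (idx m w))) @^-1` B =
      \bigcup_v (if pselect (B (g (grid m v))) then
         \bigcap_j [set w | idx m w 0 j = v 0 j] else set0).
    apply/seteqP; split=> [w /= Bw|w [v _]].
      exists (idx m w) => //; by case: pselect => [_ j|].
    case: pselect => //= Bv h; have -> : idx m w = v by apply/rowP => j; exact: h.
    exact: Bv.
  apply: countable_bigcupT_measurable => // v.
  case: pselect => [Bv|nBv] /=; last by [].
  apply: fin_bigcap_measurable => // j _.
  have -> : [set w | idx m w 0 j = v 0 j] =
      (fun w => X w 0 j * m.+1%:R) @^-1` `[(v 0 j)%:~R, (v 0 j + 1)%:~R[%classic.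
    apply/seteqP; split=> w /=; rewrite !mxE in_itv/=.
      by move=> <-; rewrite floor_itv.
    by move=> h; apply: Num.Theory.floor_def.
  by rewrite -[_ @^-1` _]setTI; apply: measurable_funM => //; exact: mX.
move=> w _; pose c := Num.sqrt (K * p%:R).
have bound m : `|g (X w) - g (grid m (idx m w))| <= c * harmonic m.
  rewrite -[leLHS](@ger0_norm _ `|_|)// -sqrtr_sqr real_normK ?num_real//.
  rewrite -(@ger0_norm _ (c * _)) ?mulr_ge0 ?sqrtr_ge0 ?invr_ge0//.
  rewrite -[leRHS]sqrtr_sqr ler_sqrt ?sqr_ge0// exprMn sqr_sqrtr ?mulr_ge0//.
  apply: le_trans (gK _ _) _; rewrite -mulrA ler_wpM2l//.
  rewrite /sqn /dot big_ord1 (_ : p%:R * _ = \sum_(j < p) harmonic m ^+ 2); last first.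
    by rewrite sumr_const card_ord mulr_natl.
  apply: ler_sum => j _.
  rewrite !mxE -expr2 -[leLHS]real_normK ?num_real// ler_pXn2r ?nnegrE ?invr_ge0//.
  have m0 : 0 < m.+1%:R :> R by rewrite ltr0n.
  have -> : X w 0 j = (X w 0 j * m.+1%:R) / m.+1%:R by rewrite mulfK ?gt_eqF.
  rewrite [in X in `|_ - X|]mulfK ?gt_eqF// -mulrBl normrM [ `|_^-1| ]ger0_norm ?invr_ge0//.
  rewrite /harmonic ler_piMl ?invr_ge0//.
  have := floor_le (X w 0 j * m.+1%:R); have := floorD1_gt (X w 0 j * m.+1%:R).
  rewrite intrD => h1 h2; rewrite ger0_norm ?subr_ge0//; lra.
apply/cvgrPdist_le => e e0.
have c1 : 0 < c + 1 by rewrite ltr_wpDl ?sqrtr_ge0.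
have /cvgrPdist_le/(_ (e / (c + 1))) := @cvg_harmonic R.
rewrite divr_gt0// => /(_ isT); apply: filterS => m.
rewrite sub0r normrN ger0_norm ?invr_ge0// => hm.
apply: le_trans (bound m) _; apply: (@le_trans _ _ ((c + 1) * harmonic m)).
  by rewrite ler_wpM2r ?invr_ge0// lerDl.
by rewrite mulrC -ler_pdivlMr.
Qed.

End LipschitzMeasurable.

(** * One step of the iteration *)

Section Step.
Context {R : realType} {n p : nat}.
Variables (f : 'I_n -> 'rV[R]_p -> R) (L : R).
Hypothesis n_gt0 : (0 < n)%N.
Hypothesis L_gt0 : 0 < L.
Hypothesis df : forall i v, differentiable (f i) v.
Hypothesis Lf : smoothness_assumption f L.

(* delta stands for gamma (1 - lambda_2), the bottom of the spectrum of 2 B on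
   the vectors with zero mean *)
Variables (B : 'M[R]_n) (alpha gamma delta eta : R).
Hypothesis gamma_gt0 : 0 < gamma.
Hypothesis gamma_le : gamma <= 1 / 2.
Hypothesis delta_gt0 : 0 < delta.
Hypothesis delta_le : delta <= gamma.
Hypothesis eta_gt0 : 0 < eta.
Hypothesis eta_le : eta * L <= delta / 32.
Hypothesis B_tr : B^T = B.
Hypothesis BJ : B *m avg_mx n = 0.
Hypothesis B_ge : forall m (v : 'M[R]_(n, m)), avg_mx n *m v = 0 ->
  delta / 2 * sqn v <= dot v (B *m v).
Hypothesis B_le : forall m (v : 'M[R]_(n, m)),
  dot v (B *m v) <= gamma / 2 * sqn v.

Local Notation J := (avg_mx n).
Local Notation Pi := (cen_mx n).
Local Notation T := (gossip_pinv B).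
Local Notation gF := (stacked_grad f).
Implicit Types x y D H N e : 'M[R]_(n, p).

(** The heterogeneity of the gradients at the mean; [- D] tracks [eta] times
    it. *)
Definition drift x : 'M[R]_(n, p) := Pi *m gF (J *m x).

Definition dual_gap x D := D + eta *: drift x.

Definition consensus_res x : 'M[R]_(n, p) := Pi *m (gF x - gF (J *m x)).

(** In a mode where B acts as b, the energy of [energy_identity],
    X^2 + (1 / b - 1) s^2. *)
Definition energy x D :=
  sqn (Pi *m x) + dot (dual_gap x D) (T *m dual_gap x D) - sqn (dual_gap x D).

Let lo_gt0 : 0 < delta / 2. Proof. by rewrite divr_gt0. Qed.
Let hi_gt0 : 0 < gamma / 2. Proof. by rewrite divr_gt0. Qed.
Let hi_le1 : gamma / 2 <= 1. Proof. by move: gamma_le; lra. Qed.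
Let L_ge0 : 0 <= L. Proof. exact: ltW. Qed.
Let d12 : delta <= 1 / 2. Proof. exact: le_trans delta_le gamma_le. Qed.

Let etaL2 : eta ^+ 2 * L ^+ 2 <= delta ^+ 2 / 1024.
Proof.
have h : 0 <= eta * L by rewrite mulr_ge0// ltW.
rewrite -exprMn (_ : delta ^+ 2 / 1024 = (delta / 32) ^+ 2); last by field.
by rewrite ler_pXn2r ?nnegrE// divr_ge0// ltW.
Qed.

(* Linear arithmetic in which inner products and objective values are atoms. *)
Ltac slra :=
  repeat match goal with x := _ |- _ => clearbody x end;
  repeat match goal with
  | |- context [sqn ?A] => generalize (sqn A)
  | |- context [dot ?A ?B] => generalize (dot A B)
  | |- context [average ?h ?x] => generalize (average h x)
  end;
  clear - n_gt0 L_gt0 df Lf gamma_gt0 gamma_le delta_gt0 delta_le eta_gt0 eta_le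
    B_tr BJ B_ge B_le lo_gt0 hi_gt0 hi_le1 L_ge0 d12 etaL2 alpha;
  intros; lra.

Lemma avg_cenM (x : 'M[R]_(n, p)) : J *m (Pi *m x) = 0.
Proof. by rewrite mulmxA avg_cen0// mul0mx. Qed.

Lemma avg_gossipM (x : 'M[R]_(n, p)) : J *m (B *m x) = 0.
Proof. by rewrite mulmxA (gossip_JB B_tr BJ) mul0mx. Qed.

Lemma avg_dual_gap x D : J *m D = 0 -> J *m dual_gap x D = 0.
Proof. by move=> JD; rewrite mulmxDr JD -scalemxAr avg_cenM scaler0 addr0. Qed.

Lemma sqn_consensus_res x :
  eta ^+ 2 * sqn (consensus_res x) <= delta ^+ 2 / 1024 * sqn (Pi *m x).
Proof.
have h : sqn (consensus_res x) <= L ^+ 2 * sqn (Pi *m x).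
  apply: le_trans (sqn_cen_le n_gt0 _) _.
  by apply: le_trans (sqn_stacked_grad_le L_ge0 Lf _ _) _; rewrite cen_avgE.
apply: (@le_trans _ _ (eta ^+ 2 * (L ^+ 2 * sqn (Pi *m x)))).
  by rewrite ler_wpM2l ?sqr_ge0.
by rewrite mulrA ler_wpM2r ?sqn_ge0.
Qed.

Lemma energy_ge0 x D : J *m D = 0 -> 0 <= energy x D.
Proof.
move=> JD; have Js := avg_dual_gap x JD.
have := pinv_ge n_gt0 lo_gt0 hi_gt0 B_tr BJ B_ge B_le Js.
have := sqn_ge0 (Pi *m x); have := sqn_ge0 (dual_gap x D).
rewrite /energy; set a := sqn _; set b := sqn _; set c := dot _ _ => b0 a0 bc.
have c0 : 0 <= c by rewrite -(pmulr_rge0 _ hi_gt0); exact: le_trans bc.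
by have := ler_wpM2r c0 hi_le1; move: b0 a0 c0 bc; slra.
Qed.

Lemma energy_le x D : J *m D = 0 ->
  energy x D <= sqn (Pi *m x) + 2 / delta * sqn (dual_gap x D).
Proof.
move=> JD; have Js := avg_dual_gap x JD.
have := pinv_le n_gt0 lo_gt0 B_tr BJ B_ge Js; have := sqn_ge0 (dual_gap x D).
by rewrite /energy invf_div; slra.
Qed.

(** The linear terms of the energy balance; they have zero mean once [N] and
    [e] are the gradient noise and the compression error. *)
Definition energy_cross x D N e :=
  (1 + delta / 8) * ((1 - delta / 2) *
      (- 2 * eta * dot (Pi *m x - eta *: consensus_res x) N)
    + 2 * dot e (dual_gap x D - B *m dual_gap x D)).

(** [energy_identity] with the gradient noise and the gradient disagreement as
    perturbations of the consensus error; the motion of the mean perturbs the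
    dual gap afterwards, at the price of the factor [1 + delta / 8]. *)
Lemma energy_step x D N e y D' x' : J *m D = 0 ->
  y = x - eta *: (gF x + N) - D -> D' = D + B *m (y + e) ->
  x' = x - eta *: (gF x + N) - D' ->
  energy x' D' <= energy x D - delta / 4 * sqn (Pi *m x)
    - 1 / 2 * sqn (dual_gap x D)
    + gamma * sqn e + 3 * eta ^+ 2 * sqn N
    + 1 / 30 * eta ^+ 2 * sqn (J *m gF x) + energy_cross x D N e.
Proof.
move=> JD yE D'E x'E0.
set s := dual_gap x D; set E := consensus_res x.
have Js : J *m s = 0 by exact: avg_dual_gap.
pose a := Pi *m x - eta *: E.
pose Xt := a - eta *: (Pi *m N).
have PD : Pi *m D = D by rewrite cen_avgE JD subr0.
have PE : Pi *m gF x = E + drift x.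
  by rewrite /E /consensus_res /drift -mulmxDr subrK.
have PyE : Pi *m y = Xt - s.
  rewrite yE !mulmxBr PD -scalemxAr mulmxDr PE /Xt /a /E /s /dual_gap.
  move: (Pi *m x) (Pi *m N) (consensus_res x) (drift x) => u1 u2 u3 u4.
  by apply/matrixP => i j; rewrite !mxE; ring.
have ByE : B *m (y + e) = B *m (Xt - s + e).
  by rewrite (mulmxDr B y) (mulmxDr B (Xt - s)) -PyE mulmxA (gossip_cen BJ).
have PB (v : 'M[R]_(n, p)) : Pi *m (B *m v) = B *m v.
  by rewrite cen_avgE avg_gossipM subr0.
have x'E : x' = y - B *m (Xt - s + e).
  by rewrite x'E0 D'E ByE yE opprD addrA.
have Px'E : Pi *m x' = Xt - s - B *m (Xt - s + e).
  by rewrite x'E mulmxBr PyE PB.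
pose sh := s + B *m (Xt - s + e).
pose Jk := Pi *m (gF (J *m x') - gF (J *m x)).
have s'E : dual_gap x' D' = sh + eta *: Jk.
  rewrite /dual_gap D'E ByE /sh; move: (B *m (Xt - s + e)) => u1.
  rewrite /s /dual_gap /Jk /drift (mulmxBr Pi (gF (J *m x'))).
  move: (Pi *m gF (J *m x')) (Pi *m gF (J *m x)) => u2 u3.
  by apply/matrixP => i j; rewrite !mxE; ring.
have JJk : J *m (eta *: Jk) = 0 by rewrite -scalemxAr avg_cenM scaler0.
have Jsh : J *m sh = 0 by rewrite mulmxDr Js avg_gossipM addr0.
have := energy_identity n_gt0 lo_gt0 B_tr BJ B_ge Xt e Js.
rewrite /= -/sh -Px'E => I1.
have t0 : 0 < delta / 8 by rewrite divr_gt0.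
have := energy_young n_gt0 lo_gt0 hi_gt0 B_tr BJ B_ge B_le hi_le1 t0 Jsh JJk.
rewrite -s'E sqnZ => YG.
have hJk : sqn Jk <= L ^+ 2 * (eta ^+ 2 * (2 * sqn (J *m gF x) + 2 * sqn N)).
  apply: le_trans (sqn_cen_le n_gt0 _) _.
  apply: le_trans (sqn_stacked_grad_le L_ge0 Lf _ _) _.
  rewrite ler_wpM2l ?sqr_ge0// -mulmxBr x'E yE.
  rewrite (_ : _ - x = - (eta *: (gF x + N)) - D - B *m (Xt - s + e)); last first.
    move: (B *m _) (gF x) => u1 u2.
    by apply/matrixP => i j; rewrite !mxE; ring.
  rewrite !mulmxBr JD avg_gossipM !subr0 mulmxN sqnN -scalemxAr sqnZ.
  rewrite ler_wpM2l ?sqr_ge0// mulmxDr; apply: le_trans (sqnD_le2 _ _) _.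
  by rewrite lerD2l ler_wpM2l// sqn_avg_le.
have XtE : sqn Xt = sqn a - 2 * eta * dot a N + eta ^+ 2 * sqn (Pi *m N).
  rewrite sqnB sqnZ dotZr; have -> : dot a (Pi *m N) = dot a N.
    rewrite dotC dot_adj cen_mx_tr dotC; congr (dot _ _).
    by rewrite mulmxBr -scalemxAr /E /consensus_res !mulmxA cen_mx_idem.
  by rewrite mulrA.
have aE : sqn a <= (1 + delta / 15) * sqn (Pi *m x).
  have t1 : 0 < delta / 32 by rewrite divr_gt0.
  have := sqnD_young (Pi *m x) (- (eta *: E)) t1; rewrite -/a sqnN sqnZ.
  have := sqn_consensus_res x; rewrite -/E => h1 h2.
  apply: (le_trans h2); have h3 := sqn_ge0 (Pi *m x).
  have t1i : 0 <= 1 + (delta / 32)^-1 by rewrite addr_ge0// invr_ge0 ltW.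
  have := ler_wpM2l t1i h1.
  have -> : (1 + (delta / 32)^-1) * (delta ^+ 2 / 1024 * sqn (Pi *m x)) =
     (delta ^+ 2 / 1024 + delta / 32) * sqn (Pi *m x) by field; rewrite gt_eqF.
  have : 0 <= delta * sqn (Pi *m x) by rewrite mulr_ge0// ltW.
  have : delta * (delta * sqn (Pi *m x)) <= 1 / 2 * (delta * sqn (Pi *m x)).
    by rewrite ler_wpM2r ?mulr_ge0// ltW.
  by rewrite expr2; move: h3; slra.
have PN := sqn_cen_le n_gt0 N.
have JXt : J *m Xt = 0.
  by rewrite !mulmxBr -!scalemxAr !avg_cenM !scaler0 !subr0.
have BXt := B_ge JXt.
have Bs := B_le s; have Be := B_le e.
have sT := pinv_le n_gt0 lo_gt0 B_tr BJ B_ge Js.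
rewrite /energy /energy_cross -/s -/E -/a.
clearbody s E a Xt sh Jk.
move: I1 YG hJk XtE aE PN BXt Bs Be sT.
have := sqn_ge0 (Pi *m x); have := sqn_ge0 s; have := sqn_ge0 e; have := sqn_ge0 N.
have := sqn_ge0 (J *m gF x); have := sqn_ge0 a; have := sqn_ge0 Xt; have := sqn_ge0 (Pi *m x').
set sX' := sqn (Pi *m x'); set sXt := sqn Xt; set sa := sqn a; set g := sqn (J *m gF x).
set sN := sqn N; set se := sqn e; set ss := sqn s; set sX := sqn (Pi *m x).
set sPN := sqn (Pi *m N); set sJk := sqn Jk.
set q1 := dot (dual_gap x' D') _; set q2 := sqn (dual_gap x' D').
set q3 := dot sh _; set q4 := sqn sh; set q5 := dot s (T *m s).
set q6 := dot s (B *m s); set q7 := dot e (B *m e).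
rewrite [dot e (s - _)]dotDr dotNr; set q8 := dot e s; set q9 := dot e (B *m s).
set q10 := dot Xt _; set q11 := dot a N.
move=> sX'0 sXt0 sa0 g0 sN0 se0 ss0 sX0 I1 YG hJk XtE aE PN BXt Bs Be sT.
have eta2 : 0 <= eta ^+ 2 by exact: sqr_ge0.
have dn0 : delta != 0 by rewrite gt_eqF.
pose K := (1 + (delta / 8)^-1) * ((delta / 2)^-1 * (eta ^+ 2 * sJk)).
have hK : K <= 1 / 30 * eta ^+ 2 * (g + sN).
  have c0 : 0 <= (1 + (delta / 8)^-1) * (delta / 2)^-1.
    by rewrite mulr_ge0 ?addr_ge0// invr_ge0 ltW.
  have M0 : 0 <= eta ^+ 2 * (2 * g + 2 * sN) by rewrite mulr_ge0// addr_ge0// mulr_ge0.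
  have h1 : eta ^+ 2 * sJk <= delta ^+ 2 / 1024 * (eta ^+ 2 * (2 * g + 2 * sN)).
    apply: (@le_trans _ _ (eta ^+ 2 * (L ^+ 2 * (eta ^+ 2 * (2 * g + 2 * sN))))).
      by rewrite ler_wpM2l.
    by rewrite [leLHS]mulrA ler_wpM2r.
  have := ler_wpM2l c0 h1; rewrite -[leLHS]mulrA -/K => h2; apply: (le_trans h2).
  have -> : (1 + (delta / 8)^-1) * (delta / 2)^-1 *
      (delta ^+ 2 / 1024 * (eta ^+ 2 * (2 * g + 2 * sN))) =
      (2 * delta + 16) / 1024 * (eta ^+ 2 * (2 * g + 2 * sN)) by field.
  by have := ler_wpM2r M0 d12; move: M0; slra.
have hX : (1 + delta / 8) * (1 - delta / 2) * (1 + delta / 15) * sX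
    <= (1 - delta / 4) * sX.
  have d3 : 0 <= delta * sX by rewrite mulr_ge0// ltW.
  have d4 : 0 <= delta * (delta * sX) by rewrite mulr_ge0// ltW.
  have d5 : 0 <= delta * (delta * (delta * sX)) by rewrite mulr_ge0// ltW.
  by move: d3 d4 d5 sX0; slra.
have hs : (1 + delta / 8) * (q5 - 7 / 4 * ss) <= q5 - 3 / 2 * ss.
  have := ler_wpM2l (ltW t0) sT.
  have -> : delta / 8 * ((delta / 2)^-1 * ss) = 1 / 4 * ss by field.
  have : 0 <= delta / 8 * ss by rewrite mulr_ge0// ltW.
  by slra.
have he : (1 + delta / 8) * (gamma / 2 * se) <= gamma * se.
  have : delta * (gamma * se) <= 1 / 2 * (gamma * se).
    by rewrite ler_wpM2r// mulr_ge0// ltW.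
  have : 0 <= gamma * se by rewrite mulr_ge0// ltW.
  by slra.
have c1 : 0 <= 1 + delta / 8 by rewrite addr_ge0// ltW.
have c2 : 0 <= 1 - delta / 2 by move: d12; slra.
have c12 : (1 + delta / 8) * (1 - delta / 2) <= 1.
  have : 0 <= delta * delta by rewrite mulr_ge0// ltW.
  by move: delta_gt0; slra.
have hN : (1 + delta / 8) * (1 - delta / 2) * (eta ^+ 2 * sPN) <= eta ^+ 2 * sN.
  apply: (@le_trans _ _ (eta ^+ 2 * sPN)); last by rewrite ler_wpM2l.
  by rewrite ler_piMl// mulr_ge0// sqn_ge0.
have hR : sX' + q3 - q4 <= (1 - delta / 2) *
     ((1 + delta / 15) * sX - 2 * eta * q11 + eta ^+ 2 * sPN)
     + (q5 - 7 / 4 * ss) + gamma / 2 * se + 2 * (q8 - q9).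
  have hg : gamma / 2 * ss <= 1 / 4 * ss by rewrite ler_wpM2r//; move: gamma_le; slra.
  have : (1 - delta / 2) * sXt <= (1 - delta / 2) *
     ((1 + delta / 15) * sX - 2 * eta * q11 + eta ^+ 2 * sPN).
    by rewrite ler_wpM2l// XtE; move: aE; slra.
  by move: I1 BXt Bs Be hg; slra.
have hR' := ler_wpM2l c1 hR.
have hX' : 0 <= delta / 8 * sX' by rewrite mulr_ge0// ltW.
have eN : 0 <= eta ^+ 2 * sN by rewrite mulr_ge0.
move: YG; rewrite -/K => YG.
by move: hR' YG hK hX hs he hN hX' eN; rewrite -/K; slra.
Qed.

(** The error tracked by the compressor; its contraction is limited by how far
    the compressed vector moves in one step. *)
Lemma residual_step x D H N e y D' x' N' y' H' : J *m D = 0 ->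
  0 < alpha -> alpha <= 1 ->
  y = x - eta *: (gF x + N) - D -> D' = D + B *m (y + e) ->
  x' = x - eta *: (gF x + N) - D' -> H' = H + alpha *: (y - H + e) ->
  y' = x' - eta *: (gF x' + N') - D' ->
  sqn (y' - H') <= (1 + alpha) * ((1 - alpha) ^+ 2 * sqn (y - H)
      + alpha ^+ 2 * sqn e - 2 * alpha * (1 - alpha) * dot (y - H) e)
    + 2 / alpha * (6 * gamma ^+ 2 * sqn (Pi *m x') + 5 * gamma ^+ 2 * sqn e
      + 5 * sqn (dual_gap x' D') + 5 * eta ^+ 2 * sqn N'
      + 5 * eta ^+ 2 * sqn (J *m gF x')).
Proof.
move=> JD alpha_gt0 alpha_le1 yE D'E x'E H'E y'E.
pose v := Pi *m y + e.
have PD : Pi *m D = D by rewrite cen_avgE JD subr0.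
have Bv : B *m (y + e) = B *m v.
  by rewrite /v (mulmxDr B y) (mulmxDr B (Pi *m y)) mulmxA (gossip_cen BJ).
have PB (u : 'M[R]_(n, p)) : Pi *m (B *m u) = B *m u.
  by rewrite cen_avgE avg_gossipM subr0.
have x'y : x' = y - B *m v by rewrite x'E D'E Bv yE opprD addrA.
have Px' : Pi *m x' = Pi *m y - B *m v by rewrite x'y mulmxBr PB.
pose w := - (B *m v) - dual_gap x' D' - eta *: consensus_res x' - eta *: N'
          - eta *: (J *m gF x').
have rE : y' - H' = ((1 - alpha) *: (y - H) - alpha *: e) + w.
  have gE : gF x' = consensus_res x' + drift x' + J *m gF x'.
    by rewrite /consensus_res /drift -mulmxDr subrK -mulmxDl subrK mul1mx.
  rewrite y'E H'E {1}gE {1}x'y /w /dual_gap.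
  move: (B *m v) (consensus_res x') (drift x') (J *m gF x') => u1 u2 u3 u4.
  by apply/matrixP => i j; rewrite !mxE; ring.
have aE : sqn ((1 - alpha) *: (y - H) - alpha *: e) =
    (1 - alpha) ^+ 2 * sqn (y - H) + alpha ^+ 2 * sqn e
    - 2 * alpha * (1 - alpha) * dot (y - H) e.
  by rewrite [LHS]sqnB !sqnZ dotZl dotZr; ring.
have hv : sqn (B *m v) <= gamma ^+ 2 * (sqn (Pi *m x') + sqn e).
  have vE : v = Pi *m x' + B *m v + e by rewrite Px' subrK.
  have := sqnD_le3 (Pi *m x') (B *m v) e; rewrite -vE => h3.
  have h1 := gossip_sqn_le n_gt0 lo_gt0 hi_gt0 B_tr BJ B_ge B_le v.
  have h2 := ler_wpM2l (ltW hi_gt0) (B_le v).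
  have sv0 := sqn_ge0 v.
  have g16 : gamma / 2 * (gamma / 2) <= 1 / 16.
    have : gamma / 2 <= 1 / 4 by move: gamma_le; slra.
    move=> h; apply: (@le_trans _ _ (1 / 4 * (1 / 4))); last by slra.
    by apply: ler_pM => //; exact: ltW.
  have h4 := ler_wpM2l (sqr_ge0 (gamma / 2)) h3.
  have h5 := ler_wpM2r (sqn_ge0 (B *m v)) g16.
  have h6 : 0 <= gamma ^+ 2 * sqn (Pi *m x') by rewrite mulr_ge0 ?sqr_ge0 ?sqn_ge0.
  have h7 : 0 <= gamma ^+ 2 * sqn e by rewrite mulr_ge0 ?sqr_ge0 ?sqn_ge0.
  by move: h1 h2 h4 h5 h6 h7 sv0; rewrite -!expr2; slra.
have hE := sqn_consensus_res x'.
have dg : delta ^+ 2 <= gamma ^+ 2.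
  by rewrite ler_pXn2r ?nnegrE// ltW.
have hE' := ler_wpM2r (sqn_ge0 (Pi *m x')) dg.
have hw : sqn w <= 6 * gamma ^+ 2 * sqn (Pi *m x') + 5 * gamma ^+ 2 * sqn e
      + 5 * sqn (dual_gap x' D') + 5 * eta ^+ 2 * sqn N'
      + 5 * eta ^+ 2 * sqn (J *m gF x').
  have := sqnD_le5 (- (B *m v)) (- dual_gap x' D') (- (eta *: consensus_res x'))
    (- (eta *: N')) (- (eta *: (J *m gF x'))).
  have h6 : 0 <= gamma ^+ 2 * sqn (Pi *m x') by rewrite mulr_ge0 ?sqr_ge0 ?sqn_ge0.
  by rewrite -/w !sqnN !sqnZ; move: hv hE hE' h6; slra.
rewrite rE -aE; apply: (le_trans (sqnD_young _ _ alpha_gt0)).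
rewrite lerD2l; apply: (@le_trans _ _ (2 / alpha * sqn w)).
  rewrite ler_wpM2r ?sqn_ge0// ler_pdivlMr// mulrDl mulVf ?gt_eqF// mul1r.
  by rewrite -lerBrDr; apply: (le_trans alpha_le1); slra.
by rewrite ler_wpM2l// divr_ge0// ltW.
Qed.

(** Corrections in the range of B have zero mean over the agents, so the mean
    makes a gradient step whose only errors are the disagreement of the agents
    and the averaged noise. *)
Lemma objective_step x D N e y D' x' : J *m D = 0 ->
  y = x - eta *: (gF x + N) - D -> D' = D + B *m (y + e) ->
  x' = x - eta *: (gF x + N) - D' ->
  average f (row_mean x') <= average f (row_mean x)
    - eta / 2 * sqn (grad (average f) (row_mean x))
    - eta / 2 * (1 - L * eta) * sqn (row_mean (gF x))
    + eta / 2 * (L ^+ 2 / n%:R * sqn (Pi *m x))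
    + L / 2 * eta ^+ 2 * sqn (row_mean N)
    - dot (eta *: grad (average f) (row_mean x)
           - (L * eta ^+ 2) *: row_mean (gF x)) (row_mean N).
Proof.
move=> JD yE D'E x'E.
have mx' : row_mean x' = row_mean x + (- (eta *: (row_mean (gF x) + row_mean N))).
  have JD' : J *m D' = 0 by rewrite D'E mulmxDr JD avg_gossipM addr0.
  rewrite -(row_mean_avg n_gt0 x') x'E mulmxBr JD' subr0 row_mean_avg//.
  by rewrite row_meanB row_meanZ row_meanD.
have := smooth_descent (row_mean x) (- (eta *: (row_mean (gF x) + row_mean N)))
  L_gt0 (average_differentiable df) (sqn_grad_average_le n_gt0 L_ge0 df Lf).
rewrite -mx' => h; apply: (le_trans h) => {h}.
set g := grad _ _; set h := row_mean (gF x); set m := row_mean N.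
have hg : sqn (g - h) <= L ^+ 2 / n%:R * sqn (Pi *m x).
  rewrite /g (grad_average_mean df) -row_meanB.
  apply: le_trans (sqn_row_mean_le n_gt0 _) _.
  rewrite mulrAC mulrC ler_wpM2r ?invr_ge0//.
  apply: le_trans (sqn_stacked_grad_le L_ge0 Lf _ _) _.
  by rewrite cen_avgE -opprB sqnN.
have he : 0 <= eta / 2 by rewrite divr_ge0// ltW.
have := ler_wpM2l he hg.
rewrite sqnN sqnZ (sqnB g) (sqnD h) !(dotNr, dotZr, dotDr, dotDl, dotNl, dotZl); slra.
Qed.

(** Size of the starting point of the telescoping sums. *)
Lemma initial_bound x H N N' x' :
  x' = x - eta *: (gF x + N) ->
  energy x' 0 + sqn (x' - eta *: (gF x' + N') - H) <=
  40 * (sqn x + sqn H + eta ^+ 2 * (sqn N + sqn N')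
        + delta^-1 * eta ^+ 2 * sqn (gF x)).
Proof.
move=> x'E; set A := sqn x; set g := sqn (gF x).
pose G := sqn (gF x + N).
have hG : G <= 2 * g + 2 * sqn N by exact: sqnD_le2.
have hx' : sqn x' <= 2 * A + 2 * (eta ^+ 2 * G).
  by rewrite x'E; apply: le_trans (sqnD_le2 _ _) _; rewrite sqnN sqnZ.
have hs : sqn (dual_gap x' 0) <= eta ^+ 2 * (2 * g + 2 * (L ^+ 2 * (2 * A + 2 * (eta ^+ 2 * G)))).
  rewrite /dual_gap add0r sqnZ ler_wpM2l ?sqr_ge0//.
  apply: le_trans (sqn_cen_le n_gt0 _) _.
  rewrite -[gF (J *m x')](subrK (gF x)) addrC; apply: le_trans (sqnD_le2 _ _) _.
  rewrite lerD2l ler_wpM2l//; apply: le_trans (sqn_stacked_grad_le L_ge0 Lf _ _) _.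
  rewrite ler_wpM2l ?sqr_ge0//.
  have -> : J *m x' - x = - (Pi *m x) - eta *: (J *m (gF x + N)).
    rewrite x'E mulmxBr -scalemxAr cen_avgE.
    move: (J *m _) (J *m _) => u1 u2; by apply/matrixP => i j; rewrite !mxE; ring.
  apply: le_trans (sqnD_le2 _ _) _; rewrite !sqnN sqnZ lerD// ler_wpM2l//.
    exact: sqn_cen_le.
  by rewrite ler_wpM2l ?sqr_ge0// sqn_avg_le.
have hg' : sqn (gF x') <= 2 * g + 2 * (L ^+ 2 * (eta ^+ 2 * G)).
  rewrite -[gF x'](subrK (gF x)) addrC; apply: le_trans (sqnD_le2 _ _) _.
  rewrite lerD2l ler_wpM2l//; apply: le_trans (sqn_stacked_grad_le L_ge0 Lf _ _) _.
  rewrite ler_wpM2l ?sqr_ge0// x'E.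
  have -> : x - eta *: (gF x + N) - x = - (eta *: (gF x + N)) by rewrite addrAC subrr add0r.
  by rewrite sqnN sqnZ.
have hr : sqn (x' - eta *: (gF x' + N') - H) <=
    4 * sqn x' + 4 * (eta ^+ 2 * sqn (gF x')) + 4 * (eta ^+ 2 * sqn N') + 4 * sqn H.
  have := sqnD_le4 x' (- (eta *: gF x')) (- (eta *: N')) (- H).
  by rewrite !sqnN !sqnZ scalerDr opprD !addrA.
have JZ : J *m (0 : 'M[R]_(n, p)) = 0 by rewrite mulmx0.
have hE := energy_le x' JZ.
have hP := sqn_cen_le n_gt0 x'.
have A0 : 0 <= A by exact: sqn_ge0.
have g0 : 0 <= g by exact: sqn_ge0.
have G0 : 0 <= G by exact: sqn_ge0.
have H0 := sqn_ge0 H; have N0 := sqn_ge0 N; have N0' := sqn_ge0 N'.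
have e2 : 0 <= eta ^+ 2 by exact: sqr_ge0.
have di : 0 <= delta^-1 by rewrite invr_ge0 ltW.
(* eta^2 L^2 <= delta^2 / 1024 makes every term carrying L negligible *)
have dd : delta ^+ 2 <= 1 / 4.
  by rewrite (_ : 1 / 4 = (1 / 2) ^+ 2) ?ler_pXn2r ?nnegrE// ?ltW//; slra.
have hs' : 2 / delta * sqn (dual_gap x' 0) <=
    4 * (delta^-1 * eta ^+ 2 * g) + A + eta ^+ 2 * G.
  have d2 : 0 <= 2 / delta by rewrite divr_ge0// ltW.
  apply: le_trans (ler_wpM2l d2 hs) _.
  have -> : 2 / delta * (eta ^+ 2 * (2 * g + 2 * (L ^+ 2 * (2 * A + 2 * (eta ^+ 2 * G))))) =
    4 * (delta^-1 * eta ^+ 2 * g) + 8 / delta * (eta ^+ 2 * L ^+ 2 * (A + eta ^+ 2 * G)).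
    by field; rewrite gt_eqF.
  rewrite -addrA lerD2l.
  have M0 : 0 <= A + eta ^+ 2 * G by rewrite addr_ge0// mulr_ge0.
  have h1 := ler_wpM2r M0 etaL2.
  have d8 : 0 <= 8 / delta by rewrite divr_ge0// ltW.
  apply: le_trans (ler_wpM2l d8 h1) _.
  have -> : 8 / delta * (delta ^+ 2 / 1024 * (A + eta ^+ 2 * G)) =
    delta / 128 * (A + eta ^+ 2 * G) by field; rewrite gt_eqF.
  by rewrite ler_piMl//; move: d12; slra.
have e2G : 0 <= eta ^+ 2 * G by rewrite mulr_ge0.
have hg2 : eta ^+ 2 * sqn (gF x') <= 2 * (eta ^+ 2 * g) + eta ^+ 2 * G.
  have := ler_wpM2l e2 hg'; have := ler_wpM2r e2G etaL2.
  by have := ler_wpM2r e2G dd; move: e2G; slra.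
have eG := ler_wpM2l e2 hG.
have gd : 2 * (eta ^+ 2 * g) <= delta^-1 * eta ^+ 2 * g.
  rewrite -[leRHS]mulrA ler_wpM2r//; first exact: mulr_ge0.
  rewrite -(ler_pM2r delta_gt0) mulVf ?gt_eqF//.
  by move: d12; slra.
have eN := mulr_ge0 e2 N0; have eN' := mulr_ge0 e2 N0'; have eg := mulr_ge0 e2 g0.
by move: hE hP hr hs' hg2 eG gd hx' A0 eg H0 eN eN' e2G; slra.
Qed.

End Step.

(** * Summation over time *)

Section Summation.
Context {R : realType}.
Implicit Types (a s r g ph : nat -> R).

Lemma sum_telescope (F drop : nat -> R) K :
  (forall t, F t.+1 <= F t - drop t) -> \sum_(t < K) drop t <= F 0%N - F K.
Proof.
move=> step; elim: K => [|K IH]; first by rewrite big_ord0 subrr.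
by rewrite big_ord_recr/=; have := step K; move: IH; lra.
Qed.

(** A geometric contraction with rate 1 - alpha/2 amplifies the sum of its
    forcing by 2 / alpha. *)
Lemma sum_contraction (alpha : R) r b K : 0 < alpha -> alpha <= 1 ->
  (forall k, 0 <= r k) -> (forall k, 0 <= b k) ->
  (forall k, r k.+1 <= (1 - alpha / 2) * r k + 2 / alpha * b k.+1) ->
  \sum_(k < K) r k <= 2 / alpha * r 0%N + 4 / alpha ^+ 2 * \sum_(k < K) b k.
Proof.
move=> a0 a1 r0 b0 step.
have a2 : 0 < alpha / 2 by rewrite divr_gt0.
have a2i : 0 < 2 / alpha by rewrite divr_gt0.
have main m : alpha / 2 * \sum_(k < m) r k + r m
    <= r 0%N + 2 / alpha * \sum_(k < m.+1) b k.
  elim: m => [|m IH].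
    by rewrite big_ord0 mulr0 add0r big_ord1 lerDl mulr_ge0// ltW.
  rewrite big_ord_recr/= [in leRHS]big_ord_recr/= !mulrDr.
  by have := step m; move: IH; lra.
case: K => [|m].
  by rewrite !big_ord0 mulr0 addr0 mulr_ge0// ltW.
have -> : 4 / alpha ^+ 2 = 2 / alpha * (2 / alpha) by field; rewrite gt_eqF.
rewrite -(mulrA (2 / alpha)) -mulrDr -{1}(invf_div alpha 2) ler_pdivlMl//.
apply: le_trans (main m); rewrite big_ord_recr/= mulrDr lerD2l ler_piMl//.
by move: a1; lra.
Qed.

(** Telescoping the two energy balances: the compression error is paid for by
    the decrease of the energy, since gamma C / alpha^2 is small. *)
Lemma sum_consensus (alpha gamma omega C e2 V : R) a s r g ph K :
  0 < alpha -> alpha <= 1 -> 0 < gamma -> gamma <= 1 / 2 -> 0 < omega ->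
  omega <= 1 -> 0 < C -> gamma * C <= alpha ^+ 2 * omega / 15872 ->
  alpha * (C + 1) <= 1 / 4 -> 0 <= e2 -> 0 <= V ->
  (forall k, 0 <= a k) -> (forall k, 0 <= s k) -> (forall k, 0 <= r k) ->
  (forall k, 0 <= g k) -> (forall k, 0 <= ph k) ->
  (forall k, ph k.+1 <= ph k - gamma * omega / 4 * a k - 1 / 2 * s k
     + gamma * (C * r k) + 3 * e2 * V + 1 / 30 * e2 * g k) ->
  (forall k, r k.+1 <= (1 + alpha) * ((1 - alpha) ^+ 2 * r k + alpha ^+ 2 * (C * r k))
     + 2 / alpha * (6 * gamma ^+ 2 * a k.+1 + 5 * gamma ^+ 2 * (C * r k)
       + 5 * s k.+1 + 5 * e2 * V + 5 * e2 * g k.+1)) ->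
  gamma * omega / 5 * \sum_(k < K) a k <=
    ph 0%N + r 0%N + 4 * K%:R * e2 * V + 1 / 20 * e2 * \sum_(k < K) g k.
Proof.
move=> al0 al1 ga0 ga1 om0 om1 C0 gC aC e0 V0 a0 s0 r0 g0 ph0 P1 P2.
pose b k := 6 * gamma ^+ 2 * a k + 5 * s k + 5 * e2 * V + 5 * e2 * g k.
have b0 k : 0 <= b k.
  by rewrite /b; repeat first [done | exact: sqr_ge0 | apply: addr_ge0 | apply: mulr_ge0].
have step k : r k.+1 <= (1 - alpha / 2) * r k + 2 / alpha * b k.+1.
  apply: (le_trans (P2 k)).
  have -> : 2 / alpha * (6 * gamma ^+ 2 * a k.+1 + 5 * gamma ^+ 2 * (C * r k)
       + 5 * s k.+1 + 5 * e2 * V + 5 * e2 * g k.+1) =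
       10 * gamma * (gamma * C / alpha) * r k + 2 / alpha * b k.+1.
    by rewrite /b; field; rewrite gt_eqF.
  rewrite addrA lerD2r.
  suff coef : (1 + alpha) * ((1 - alpha) ^+ 2 + alpha ^+ 2 * C) +
      10 * gamma * (gamma * C / alpha) <= 1 - alpha / 2.
    by have := ler_wpM2r (r0 k) coef; clear; intros; lra.
  have gCa : gamma * C / alpha <= alpha / 15872.
    rewrite ler_pdivrMr//; apply: (le_trans gC).
    have : alpha ^+ 2 * omega <= alpha ^+ 2 by rewrite ler_piMr ?sqr_ge0.
    by rewrite expr2; clear; intros; lra.
  have h1 : gamma * (gamma * C / alpha) <= 1 / 2 * (alpha / 15872).
    by apply: ler_pM => //; rewrite ?divr_ge0 ?mulr_ge0// ltW.
  have h2 : alpha * (alpha * (C + 1)) <= alpha * (1 / 4) by rewrite ler_pM2l.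
  have h3 : alpha * (alpha * (alpha * (C + 1))) <= alpha * (alpha * (1 / 4)).
    by rewrite !ler_pM2l.
  have h4 : 0 <= alpha * alpha by rewrite mulr_ge0// ltW.
  by move: h1 h2 h3 h4 al0; clear; intros; lra.
have sb := sum_contraction K al0 al1 r0 b0 step.
have sP m : ph m + \sum_(k < m) (gamma * omega / 4 * a k + 1 / 2 * s k) <=
    ph 0%N + \sum_(k < m) (gamma * (C * r k) + 3 * e2 * V + 1 / 30 * e2 * g k).
  elim: m => [|m IH]; first by rewrite !big_ord0 !addr0.
  by rewrite !big_ord_recr/=; have := P1 m; move: IH; clear; intros; lra.
have := sP K; rewrite !big_split/= -!mulr_sumr !sumr_const !card_ord -(mulr_natl V).
have sbE : \sum_(k < K) b k = 6 * gamma ^+ 2 * (\sum_(k < K) a k)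
  + 5 * (\sum_(k < K) s k) + 5 * e2 * (K%:R * V) + 5 * e2 * \sum_(k < K) g k.
  by rewrite /b !big_split/= -!mulr_sumr sumr_const card_ord -(mulr_natl V).
move: sb; rewrite sbE.
have Sa0 : 0 <= \sum_(k < K) a k by exact: sumr_ge0.
have Ss0 : 0 <= \sum_(k < K) s k by exact: sumr_ge0.
have Sg0 : 0 <= \sum_(k < K) g k by exact: sumr_ge0.
have phK := ph0 K; have r00 := r0 0%N.
set Sa := \sum_(k < K) a k in Sa0 *; set Ss := \sum_(k < K) s k in Ss0 *.
set Sg := \sum_(k < K) g k in Sg0 *; set Sr := \sum_(k < K) r k.
set k := K%:R : R; have k0 : 0 <= k by [].
have eV : 0 <= e2 * (k * V) by rewrite !mulr_ge0.
have eS : 0 <= e2 * Sg by rewrite mulr_ge0.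
move=> sb sE.
have gCpos : 0 <= gamma * C by rewrite mulr_ge0// ltW.
have := ler_wpM2l gCpos sb.
clearbody Sa Ss Sg Sr k; set Z := 6 * gamma ^+ 2 * Sa + 5 * Ss + 5 * e2 * (k * V) + 5 * e2 * Sg.
have ZE : Z = 6 * gamma ^+ 2 * Sa + 5 * Ss + 5 * e2 * (k * V) + 5 * e2 * Sg by [].
have Z0 : 0 <= Z.
  by rewrite /Z; repeat first [done | exact: sqr_ge0 | apply: addr_ge0 | apply: mulr_ge0].
clearbody Z; have h1 : gamma * C * (4 / alpha ^+ 2 * Z) <= omega / 3968 * Z.
  have c1 : gamma * C * (4 / alpha ^+ 2) <= omega / 3968.
    have a2 : 0 < alpha ^+ 2 by exact: exprn_gt0.
    by rewrite mulrA ler_pdivrMr//; move: gC; clear; intros; lra.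
  by have := ler_wpM2r Z0 c1; rewrite -[leLHS]mulrA.
have h2 : gamma * C * (2 / alpha * r 0%N) <= r 0%N.
  rewrite mulrA ler_piMl// mulrA ler_pdivrMr// mul1r.
  have : alpha ^+ 2 * omega <= alpha * 1.
    by rewrite expr2 -mulrA ler_pM2l//; rewrite -[leRHS]mulr1 ler_pM// ltW.
  by move: gC al0; clear; intros; lra.
have o1 : omega * (5 * Ss + 5 * e2 * (k * V) + 5 * e2 * Sg) <=
   1 * (5 * Ss + 5 * e2 * (k * V) + 5 * e2 * Sg).
  rewrite ler_wpM2r//.
  by repeat first [done | apply: addr_ge0 | apply: mulr_ge0].
have o2 : gamma * (gamma * omega * Sa) <= 1 / 2 * (gamma * omega * Sa).
  by rewrite ler_wpM2r// !mulr_ge0// ltW.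
have o3 : 0 <= gamma * omega * Sa by rewrite !mulr_ge0// ltW.
rewrite mulrDr => h3; move: sE h1 h2 h3 o1 o2; rewrite ZE.
by move: phK Ss0 eV eS o3 r00; clear; intros; lra.
Qed.

(** Inserting the consensus error in the summed descent; the mean gradients it
    brings back are absorbed by the descent itself, [eta * L] being small. *)
Lemma sum_gradient (eta L delta N D Q A V v : R) (Gq hq xq : nat -> R) K :
  0 < eta -> 0 < L -> 0 < delta -> delta <= 1 / 2 -> eta * L <= delta / 32 -> 0 < N ->
  (forall t, 0 <= Gq t) -> (forall t, 0 <= hq t) -> xq 0%N <= A ->
  \sum_(t < K.+1) (eta / 2 * Gq t + eta / 2 * (1 - L * eta) * hq t
     - eta / 2 * (L ^+ 2 / N * xq t) - L / 2 * eta ^+ 2 * v) <= D ->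
  delta / 5 * \sum_(k < K) xq k.+1 <= Q + 4 * K%:R * eta ^+ 2 * V
     + 1 / 20 * eta ^+ 2 * \sum_(k < K) (N * hq k.+1) ->
  \sum_(k < K) Gq k.+1 <= 2 / eta * D
     + L ^+ 2 / N * (A + 5 / delta * (Q + 4 * K%:R * eta ^+ 2 * V))
     + K.+1%:R * (L * eta * v).
Proof.
move=> e0 L0 d0 d12 eL N0 G0 h0 xA obj cons.
have Lh : L * eta <= 1 / 64 by rewrite mulrC; move: eL d12; clear; intros; lra.
move: obj cons; rewrite !big_split/= !sumrN -!mulr_sumr !sumr_const !card_ord.
rewrite !big_ord_recl/= -(mulr_natl v).
under eq_bigr do rewrite /bump add1n.
under [\sum_(i < K) hq _]eq_bigr do rewrite /bump add1n.
under [\sum_(i < K) xq (bump _ _)]eq_bigr do rewrite /bump add1n.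
have Sh0 : 0 <= \sum_(k < K) hq k.+1 by exact: sumr_ge0.
set SG := \sum_(k < K) Gq k.+1; set Sh := \sum_(k < K) hq k.+1 in Sh0 *.
set Sx := \sum_(k < K) xq k.+1; set c := 4 * K%:R * eta ^+ 2 * V.
set k1 := K.+1%:R : R; move: SG Sh Sx c k1 Sh0 => SG Sh Sx c k1 Sh0 obj cons.
have cx : Sx <= 5 / delta * (Q + c) + 1 / (4 * delta) * eta ^+ 2 * (N * Sh).
  have := ler_wpM2l (ltW (divr_gt0 (ltr0Sn R 4) d0)) cons.
  have -> : 5 / delta * (delta / 5 * Sx) = Sx by field; rewrite gt_eqF.
  move/le_trans; apply; rewrite mulrDr lerD2l.
  by rewrite le_eqVlt; apply/orP; left; apply/eqP; field; rewrite gt_eqF.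
have L2N : 0 <= L ^+ 2 / N by rewrite divr_ge0 ?sqr_ge0// ltW.
have c1 := ler_wpM2l L2N cx.
have c2 : L ^+ 2 / N * (1 / (4 * delta) * eta ^+ 2 * (N * Sh)) <= 1 / 64 * Sh.
  have -> : L ^+ 2 / N * (1 / (4 * delta) * eta ^+ 2 * (N * Sh)) =
    (eta * L) ^+ 2 / (4 * delta) * Sh by field; rewrite !gt_eqF.
  rewrite ler_wpM2r// ler_pdivrMr ?mulr_gt0//.
  have : (eta * L) ^+ 2 <= (delta / 32) ^+ 2.
    by rewrite ler_pXn2r ?nnegrE ?mulr_ge0 ?divr_ge0// ltW.
  have : delta * delta <= 1 / 2 * delta by rewrite ler_pM2r.
  by move: d0; rewrite !expr2; clear; intros; lra.
have c3 := ler_wpM2l L2N xA.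
have c4 : (L * eta) * (hq 0%N + Sh) <= 1 / 64 * (hq 0%N + Sh).
  by rewrite ler_wpM2r// addr_ge0.
suff : eta / 2 * SG <= D + eta / 2 * (L ^+ 2 / N * (A + 5 / delta * (Q + c)))
    + eta / 2 * (k1 * (L * eta * v)).
  have e2 : 0 < eta / 2 by rewrite divr_gt0.
  move=> h; rewrite -(ler_pM2l e2); apply: (le_trans h).
  have E : eta / 2 * (2 / eta * D) = D by field; rewrite gt_eqF.
  by rewrite 2!(mulrDr (eta / 2)) E.
have e2 : 0 <= eta / 2 by rewrite divr_ge0// ltW.
have c5 : L ^+ 2 / N * (xq 0%N + Sx) <= L ^+ 2 / N * (A + 5 / delta * (Q + c)) + 1 / 64 * Sh.
  by move: c1 c2 c3; rewrite !mulrDr; clear; intros; lra.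
have := ler_wpM2l e2 c5; have := ler_wpM2l e2 c4.
have h1 : 0 <= eta / 2 * (hq 0%N + Sh) by rewrite mulr_ge0// addr_ge0.
have h2 : 0 <= eta / 2 * Gq 0%N by rewrite mulr_ge0.
have h3 : 0 <= eta / 2 * hq 0%N by rewrite mulr_ge0.
by move: obj h1 h2 h3; rewrite !mulrDr; clear; intros; lra.
Qed.

End Summation.

(** * Square-integrable adapted matrices *)

Section Adapted.
Context {R : realType} {d : measure_display} {Omega : measurableType d}.
Variable P : probability Omega R.
Implicit Types (F : set (set Omega)) (X Y : Omega -> R).

(** The generator [F], not the sigma-algebra, is the parameter because measurability for <<s F >> is
    measurability on the type [g_sigma_algebraType F]. *)
Definition adapted F X :=
  sub_measurable <<s F >> X /\ has_mean P (fun w => X w ^+ 2).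

Lemma adapted_meas F X : <<s F >> `<=` measurable -> adapted F X ->
  measurable_fun setT X.
Proof. by move=> mF [mX _]; exact: sub_measurable_meas mX. Qed.

Lemma adapted_sub F F' X : <<s F >> `<=` <<s F' >> -> adapted F X -> adapted F' X.
Proof. by move=> FF' [mX iX]; split => // B mB; apply: FF'; exact: mX. Qed.

Lemma has_mean_mul F F' X Y : <<s F >> `<=` measurable -> <<s F' >> `<=` measurable ->
  adapted F X -> adapted F' Y -> has_mean P (fun w => X w * Y w).
Proof.
move=> mF mF' aX aY.
apply: (@le_has_mean _ _ _ _ _ (fun w => X w ^+ 2 + Y w ^+ 2)).
- by apply: measurable_funM; [exact: adapted_meas aX|exact: adapted_meas aY].
- move=> w; rewrite normrM.
  have := sqr_ge0 (`|X w| - `|Y w|); have := sqr_ge0 (`|X w| + `|Y w|).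
  rewrite -[X w ^+ 2]real_normK ?num_real// -[Y w ^+ 2]real_normK ?num_real//.
  by lra.
- by apply: has_meanD; [case: aX|case: aY].
Qed.

Section Closure.
Variable F : set (set Omega).
Hypothesis mF : <<s F >> `<=` measurable.

Lemma adapted_cst k : adapted F (fun=> k).
Proof. by split; [apply/sub_measurableP|exact: has_mean_cst]. Qed.

Lemma adaptedD X Y : adapted F X -> adapted F Y -> adapted F (fun w => X w + Y w).
Proof.
move=> aX aY; have iXY := has_mean_mul mF mF aX aY.
move: aX aY => [mX iX] [mY iY]; split.
  by apply/sub_measurableP; apply: measurable_funD; exact/sub_measurableP.
under eq_fun do rewrite sqrrD.
apply: has_meanD => //; apply: has_meanD => //.
by under eq_fun do rewrite -mulr_natl; exact: has_meanZ.
Qed.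

Lemma adaptedZ k X : adapted F X -> adapted F (fun w => k * X w).
Proof.
move=> [mX iX]; split.
  apply/sub_measurableP; apply: measurable_funM; [exact: measurable_cst|exact/sub_measurableP].
by under eq_fun do rewrite exprMn; exact: has_meanZ.
Qed.

Lemma adapted_sum (I : Type) (s : seq I) (Xs : I -> Omega -> R) :
  (forall i, adapted F (Xs i)) -> adapted F (fun w => \sum_(i <- s) Xs i w).
Proof.
move=> aX; elim: s => [|i s IH].
  by under eq_fun do rewrite big_nil; exact: adapted_cst.
by under eq_fun do rewrite big_cons; exact: adaptedD.
Qed.

End Closure.

Definition adapted_mx F m q (A : Omega -> 'M[R]_(m, q)) :=
  forall i j, adapted F (fun w => A w i j).

Lemma adapted_mx_sub F F' m q (A : Omega -> 'M[R]_(m, q)) :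
  <<s F >> `<=` <<s F' >> -> adapted_mx F A -> adapted_mx F' A.
Proof. by move=> FF' aA i j; exact: adapted_sub (aA i j). Qed.

Section ClosureMx.
Variable F : set (set Omega).
Hypothesis mF : <<s F >> `<=` measurable.
Context {m q : nat}.
Implicit Types A B : Omega -> 'M[R]_(m, q).

Lemma adapted_mx_cst (M : 'M[R]_(m, q)) : adapted_mx F (fun=> M).
Proof. by move=> i j; exact: adapted_cst. Qed.

Lemma adapted_mxD A B : adapted_mx F A -> adapted_mx F B ->
  adapted_mx F (fun w => A w + B w).
Proof.
by move=> aA aB i j; under eq_fun do rewrite mxE; exact: adaptedD.
Qed.

Lemma adapted_mxZ k A : adapted_mx F A -> adapted_mx F (fun w => k *: A w).
Proof. by move=> aA i j; under eq_fun do rewrite mxE; exact: adaptedZ. Qed.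

Lemma adapted_mxB A B : adapted_mx F A -> adapted_mx F B ->
  adapted_mx F (fun w => A w - B w).
Proof.
move=> aA aB; under eq_fun do rewrite -scaleN1r.
by apply: adapted_mxD => //; exact: adapted_mxZ.
Qed.

Lemma adapted_mxM l (M : 'M[R]_(l, m)) A : adapted_mx F A ->
  adapted_mx F (fun w => M *m A w).
Proof.
move=> aA i j; under eq_fun do rewrite mxE.
by apply: adapted_sum => // k; exact: adaptedZ.
Qed.

Lemma adapted_row A i : adapted_mx F A -> adapted_mx F (fun w => row i (A w)).
Proof. by move=> aA i' j; under eq_fun do rewrite mxE; exact: aA. Qed.

Lemma adapted_row_mean A : adapted_mx F A -> adapted_mx F (fun w => row_mean (A w)).
Proof.
move=> aA i j; under eq_fun do rewrite mxE summxE.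
by apply: adaptedZ; apply: adapted_sum => // k; exact: adapted_row.
Qed.

End ClosureMx.

Lemma has_mean_dot F F' m q (A B : Omega -> 'M[R]_(m, q)) :
  <<s F >> `<=` measurable -> <<s F' >> `<=` measurable ->
  adapted_mx F A -> adapted_mx F' B -> has_mean P (fun w => dot (A w) (B w)).
Proof.
move=> mF mF' aA aB; apply: has_mean_sum => i; apply: has_mean_sum => j.
exact: (has_mean_mul mF mF').
Qed.

Lemma has_mean_sqn F m q (A : Omega -> 'M[R]_(m, q)) :
  <<s F >> `<=` measurable -> adapted_mx F A -> has_mean P (fun w => sqn (A w)).
Proof. by move=> mF aA; exact: (has_mean_dot mF mF). Qed.

(** Entry by entry, the past is pulled out of a zero conditional mean. *)
Lemma expect_dot_eq0 F F' m q (A N : Omega -> 'M[R]_(m, q)) :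
  <<s F >> `<=` measurable -> <<s F' >> `<=` measurable ->
  adapted_mx F A -> adapted_mx F' N ->
  (forall i j, centered P <<s F >> (fun w => N w i j)) ->
  \int[P]_w dot (A w) (N w) = 0.
Proof.
move=> mF mF' aA aN cN.
have iij i j : has_mean P (fun w => A w i j * N w i j).
  exact: (has_mean_mul mF mF').
rewrite expect_sum => [|i]; last exact: has_mean_sum.
rewrite big1// => i _; rewrite expect_sum// big1// => j _.
by apply: (centered_mul_eq0 mF (cN i j)) => //; case: (aA i j).
Qed.

(** Lipschitz maps preserve adapted square integrable vectors: their values are
    measurable, and bounded by an affine function of the norm. *)
Lemma adapted_lipschitz F q (g : 'rV[R]_q -> R) (K : R) (X : Omega -> 'rV[R]_q) :
  <<s F >> `<=` measurable -> 0 <= K ->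
  (forall x y, (g x - g y) ^+ 2 <= K * sqn (x - y)) ->
  adapted_mx F X -> adapted F (fun w => g (X w)).
Proof.
move=> mF K0 gK aX.
have mgX : measurable_fun [set: g_sigma_algebraType F] (fun w => g (X w)).
  apply: (lipschitz_measurable K0 gK) => j.
  by apply/sub_measurableP; case: (aX 0 j).
split; first exact/sub_measurableP.
apply: (@le_has_mean _ _ _ _ _ (fun w => 2 * (K * sqn (X w)) + 2 * g 0 ^+ 2)).
- apply: measurable_funX; apply: (sub_measurable_meas mF).
  exact/sub_measurableP.
- move=> w; rewrite ger0_norm ?sqr_ge0//.
  have := gK (X w) 0; rewrite subr0.
  by have := sqr_ge0 (g (X w) - 2 * g 0); lra.
- apply: has_meanD; last exact: has_mean_cst.
  by do 2 apply: has_meanZ; exact: has_mean_sqn aX.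
Qed.

(** [h] is composed with the pair of [X] and [xi], measurable into the product
    space. *)
Lemma sub_measurable_seed F {dT : measure_display} {T : measurableType dT} q
    (h : 'rV[R]_q -> T -> 'rV[R]_q) (X : Omega -> 'rV[R]_q) (xi : Omega -> T) j :
  jointly_measurable h -> (forall j, sub_measurable <<s F >> (fun w => X w 0 j)) ->
  (forall B, measurable B -> <<s F >> (xi @^-1` B)) ->
  sub_measurable <<s F >> (fun w => h (X w) (xi w) 0 j).
Proof.
move=> mh mX mxi; apply/sub_measurableP.
pose z (w : g_sigma_algebraType F) : q.-tuple R * T := ([tuple X w 0 k | k < q], xi w).
have mz : measurable_fun setT z.
  apply/measurable_fun_pairP; split.
    apply/measurable_fun_tnthP => k.
    rewrite (_ : _ \o _ = fun w => X w 0 k); first exact/sub_measurableP.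
    by apply/funext => w /=; rewrite tnth_mktuple.
  by move=> _ B mB; rewrite setTI; exact: mxi.
have := measurableT_comp (mh j) mz; apply: eq_measurable_fun => w _ /=.
congr (h _ _ 0 j); apply/rowP => k; rewrite mxE.
by rewrite tnth_mktuple.
Qed.

End Adapted.

(** * The random run *)

Section History.
Context {R : realType} {d dX dS : measure_display}.
Context {Omega : measurableType d} {Xi : measurableType dX} {S : measurableType dS}.
Context {n : nat}.
Variables (xi : 'I_n -> nat -> Omega -> Xi) (zeta : 'I_n -> nat -> Omega -> S).
Hypothesis mxi : forall i t, measurable_fun setT (xi i t).
Hypothesis mzeta : forall i k, measurable_fun setT (zeta i k).

Definition history_gen (a b : nat) : set (set Omega) :=
  [set A | (exists i t B, [/\ (t < a)%N, measurable B & A = xi i t @^-1` B])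
        \/ (exists i t B, [/\ (t < b)%N, measurable B & A = zeta i t @^-1` B])].

Lemma history_measurable a b : <<s history_gen a b >> `<=` measurable.
Proof.
apply: smallest_sub; first exact: sigma_algebra_measurable.
by move=> _ [] [i [t [B [_ mB ->]]]]; rewrite -[_ @^-1` _]setTI;
  [exact: mxi|exact: mzeta].
Qed.

Lemma history_le a b a' b' : (a <= a')%N -> (b <= b')%N ->
  <<s history_gen a b >> `<=` <<s history_gen a' b' >>.
Proof.
move=> aa bb; apply: smallest_sub; first exact: smallest_sigma_algebra.
move=> A gA; apply: sub_sigma_algebra; move: gA.
move=> [] [i [t [B [ta mB ->]]]]; [left|right]; exists i, t, B; split => //.
  exact: leq_trans ta aa.
exact: leq_trans ta bb.
Qed.

Lemma history_sample a b i t B : (t < a)%N -> measurable B ->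
  <<s history_gen a b >> (xi i t @^-1` B).
Proof.
by move=> ta mB; apply: sub_sigma_algebra; left; exists i, t, B.
Qed.

Lemma history_seed a b i t B : (t < b)%N -> measurable B ->
  <<s history_gen a b >> (zeta i t @^-1` B).
Proof.
by move=> tb mB; apply: sub_sigma_algebra; right; exists i, t, B.
Qed.

End History.

Section Noise.
Context {R : realType} {d : measure_display} {Omega : measurableType d}.
Variable P : probability Omega R.

Lemma condexp_le_expect (F : set (set Omega)) (X Y : Omega -> R) :
  <<s F >> `<=` measurable -> has_mean P Y -> condexp_le P <<s F >> X Y ->
  has_mean P X /\ \int[P]_w X w <= \int[P]_w Y w.
Proof.
move=> mF iY [Z [iX iZ _ ZX] ZY]; split => //.
have -> : \int[P]_w X w = \int[P]_w Z w.
  by rewrite /Rintegral ZX//; exact: (@measurableT _ (g_sigma_algebraType F)).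
exact: le_expect_ae.
Qed.

(** Averaging conditionally independent centered noises divides the variance by
    their number, as the cross terms vanish. *)
Lemma expect_sqn_row_mean n p (F : set (set Omega)) {dX : measure_display}
    {Xi : measurableType dX} (xi : 'I_n -> Omega -> Xi)
    (N : Omega -> 'M[R]_(n, p)) F' (V : R) : (0 < n)%N ->
  <<s F >> `<=` measurable -> <<s F' >> `<=` measurable ->
  (forall i, measurable_fun setT (xi i)) -> cond_independent P <<s F >> xi ->
  (forall i j, sub_measurable <<s rectangles F xi i >> (fun w => N w i j)) ->
  (forall i j, centered P <<s F >> (fun w => N w i j)) ->
  adapted_mx P F' N -> \int[P]_w sqn (N w) <= n%:R * V ->
  \int[P]_w sqn (row_mean (N w)) <= V / n%:R.
Proof.
move=> n0 mF mF' mxi cxi rN cN aN NV.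
have n0' : n%:R != 0 :> R by rewrite pnatr_eq0 -lt0n.
have ijk i k j : has_mean P (fun w => N w i j * N w k j).
  exact: (has_mean_mul mF' mF').
have sE w : sqn (row_mean (N w)) =
    n%:R^-1 ^+ 2 * \sum_j \sum_i \sum_k N w i j * N w k j.
  rewrite /sqn /dot big_ord1 mulr_sumr; apply: eq_bigr => j _.
  rewrite !mxE summxE -expr2 exprMn; congr (_ * _); rewrite expr2 mulr_suml.
  by apply: eq_bigr => i _; rewrite mulr_sumr; apply: eq_bigr => k _; rewrite !mxE.
under eq_Rintegral do rewrite sE.
rewrite expectZ; last first.
  by do 3 (apply: has_mean_sum => ?).
have -> : \int[P]_w (\sum_j \sum_i \sum_k N w i j * N w k j) = \int[P]_w sqn (N w).
  rewrite expect_sum => [|j]; last by do 2 (apply: has_mean_sum => ?).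
  have -> : \int[P]_w sqn (N w) = \sum_j \sum_i \int[P]_w (N w i j * N w i j).
    under eq_Rintegral do rewrite /sqn /dot exchange_big.
    rewrite expect_sum => [|j]; last exact: has_mean_sum.
    by apply: eq_bigr => j _; rewrite expect_sum.
  apply: eq_bigr => j _; rewrite expect_sum => [|i]; last exact: has_mean_sum.
  apply: eq_bigr => i _; rewrite expect_sum// (bigD1 i)//= big1 ?addr0// => k ki.
  by apply: (cond_independent_mul_eq0 mF mxi cxi) => //; rewrite eq_sym.
have -> : V / n%:R = n%:R^-1 ^+ 2 * (n%:R * V) by field.
by rewrite ler_wpM2l ?sqr_ge0.
Qed.

End Noise.

Section Run.
Context {R : realType} {d dX dS : measure_display}.
Context {Omega : measurableType d} {Xi : measurableType dX} {S : measurableType dS}.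
Variable P : probability Omega R.
Context {n p : nat}.
Variables (f : 'I_n -> 'rV[R]_p -> R) (L : R).
Hypothesis n_gt0 : (0 < n)%N.
Hypothesis L_gt0 : 0 < L.
Hypothesis df : forall i v, differentiable (f i) v.
Hypothesis Lf : smoothness_assumption f L.
Variables (W : 'M[R]_n) (alpha gamma eta sigma C : R).
Hypothesis C_gt0 : 0 < C.
Variables (sgrad : 'I_n -> 'rV[R]_p -> Xi -> 'rV[R]_p)
          (comp : 'rV[R]_p -> S -> 'rV[R]_p) (xm1 H0 : 'M[R]_(n, p)).
Variables (xi : 'I_n -> nat -> Omega -> Xi) (zeta : 'I_n -> nat -> Omega -> S).
Hypothesis msgrad : forall i, jointly_measurable (sgrad i).
Hypothesis mcomp : jointly_measurable comp.

Let G (w : Omega) (t : nat) := rowwise (fun i v => sgrad i v (xi i t w)).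
Let Cmp (w : Omega) (k : nat) := rowwise (fun i v => comp v (zeta i k w)).

Definition state k w := cedas W alpha gamma (fun=> eta) (G w) (Cmp w) xm1 H0 k.
Definition iter_x k w := (state k w).1.1.
Definition iter_D k w := (state k w).1.2.
Definition iter_H k w := (state k w).2.
Definition query t w := if t is k.+1 then iter_x k w else xm1.

Hypothesis SG : stochastic_gradient_assumption xi zeta P f sgrad query sigma.
Hypothesis UC : unbiased_compressor_assumption xi zeta P comp C.

Local Notation gF := (stacked_grad f).
Local Notation HG := (history_gen xi zeta).

Definition gossip_mx : 'M[R]_n := (gamma / 2) *: (1%:M - W).
Local Notation B := gossip_mx.

(* Samples of index t are drawn given [HG t t.-1] and belong to [HG t.+1 t.-1];
   compressions of index k are drawn given [HG k.+2 k] and belong to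
   [HG k.+2 k.+1]. *)
Definition noise t w : 'M[R]_(n, p) := G w t (query t w) - gF (query t w).
Definition iter_y k w : 'M[R]_(n, p) :=
  iter_x k w - eta *: (gF (iter_x k w) + noise k.+1 w) - iter_D k w.
Definition residual k w : 'M[R]_(n, p) := iter_y k w - iter_H k w.
Definition comp_err k w : 'M[R]_(n, p) := Cmp w k (residual k w) - residual k w.

Lemma iter_x0 w : iter_x 0 w = xm1 - eta *: (gF xm1 + noise 0 w).
Proof. by rewrite /noise [gF xm1 + _]addrC subrK. Qed.

(** The iteration in terms of its gradient noise and its compression error, the
    form in which the one-step estimates apply. *)
Lemma stateS k w : state k.+1 w =
  let y := iter_y k w in
  let D' := iter_D k w + B *m (y + comp_err k w) in
  (iter_x k w - eta *: (gF (iter_x k w) + noise k.+1 w) - D', D',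
   iter_H k w + alpha *: (y - iter_H k w + comp_err k w)).
Proof.
have GE : gF (iter_x k w) + noise k.+1 w = G w k.+1 (iter_x k w).
  by rewrite /noise [gF (iter_x k w) + _]addrC subrK.
have yE : iter_x k w - eta *: G w k.+1 (iter_x k w) - iter_D k w = iter_y k w.
  by rewrite /iter_y GE.
have QE : Cmp w k (iter_y k w - iter_H k w) = iter_y k w - iter_H k w + comp_err k w.
  by rewrite /comp_err /residual [RHS]addrC subrK.
rewrite GE /state /=; move: yE QE; rewrite /iter_x /iter_D /iter_H -/(state k w).
case: (state k w) => [[x D] H] /= -> ->.
have -> : H + (iter_y k w - H + comp_err k w) = iter_y k w + comp_err k w.
  by rewrite addrA [H + _]addrC subrK.
by rewrite -scalemxAl.
Qed.

Lemma iter_DS k w : iter_D k.+1 w = iter_D k w + B *m (iter_y k w + comp_err k w).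
Proof. by rewrite /iter_D stateS. Qed.

Lemma iter_xS k w : iter_x k.+1 w =
  iter_x k w - eta *: (gF (iter_x k w) + noise k.+1 w) - iter_D k.+1 w.
Proof. by rewrite iter_DS {1}/iter_x stateS. Qed.

Lemma iter_HS k w : iter_H k.+1 w =
  iter_H k w + alpha *: (iter_y k w - iter_H k w + comp_err k w).
Proof. by rewrite {1}/iter_H stateS. Qed.

Let mxi i t : measurable_fun setT (xi i t).
Proof. by have [h _ _ _] := SG t; exact: h. Qed.

Let mzeta i k : measurable_fun setT (zeta i k).
Proof. by have [] := UC k i. Qed.

Let mH a b : <<s HG a b >> `<=` measurable.
Proof. exact: history_measurable. Qed.

Let L_ge0 : 0 <= L. Proof. exact: ltW. Qed.

Lemma entry_sqr_le m (v : 'rV[R]_m) j : v 0 j ^+ 2 <= sqn v.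
Proof.
rewrite /sqn /dot big_ord1 (bigD1 j)//= -expr2 lerDl.
by apply: sumr_ge0 => k _; exact: sqr_ge0.
Qed.

Lemma adapted_stacked_grad a b (A : Omega -> 'M[R]_(n, p)) :
  adapted_mx P (HG a b) A -> adapted_mx P (HG a b) (fun w => gF (A w)).
Proof.
move=> aA i j; under eq_fun do rewrite mxE.
apply: (@adapted_lipschitz _ _ _ _ _ _ (fun v => grad (f i) v 0 j) (L ^+ 2)) => //.
- exact: sqr_ge0.
- move=> x y; apply: le_trans (sqn_grad_le L_ge0 Lf i x y).
  by have := entry_sqr_le (grad (f i) x - grad (f i) y) j; rewrite !mxE.
- exact: adapted_row.
Qed.

Lemma noise_entry t w i j : noise t w i j =
  sgrad i (row i (query t w)) (xi i t w) 0 j - grad (f i) (row i (query t w)) 0 j.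
Proof. by rewrite !mxE. Qed.

Lemma noise_row t w i : row i (noise t w) =
  sgrad i (row i (query t w)) (xi i t w) - grad (f i) (row i (query t w)).
Proof. by apply/rowP => j; rewrite mxE noise_entry !mxE. Qed.

Lemma noise_centered t i j : centered P <<s HG t t.-1 >> (fun w => noise t w i j).
Proof.
under eq_fun do rewrite noise_entry.
have [_ _ cg _] := SG t; apply: condexp_centered => //; exact: cg.
Qed.

Lemma noise_row_le t i : has_mean P (fun w => sqn (row i (noise t w))) /\
  \int[P]_w sqn (row i (noise t w)) <= sigma ^+ 2.
Proof.
have [_ _ _ cle] := SG t.
have [] := condexp_le_expect (@mH t t.-1) (has_mean_cst P (sigma ^+ 2)) (cle i).
have E w : frob (sgrad i (row i (query t w)) (xi i t w) - grad (f i) (row i (query t w))) ^+ 2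
         = sqn (row i (noise t w)) by rewrite noise_row frob_sqr.
under eq_fun do rewrite E.
by rewrite expect_cst.
Qed.

Lemma expect_noise_le t : \int[P]_w sqn (noise t w) <= n%:R * sigma ^+ 2.
Proof.
under eq_Rintegral do rewrite sqn_rows.
rewrite expect_sum => [|i]; last by case: (noise_row_le t i).
rewrite mulr_natl -[in leRHS](card_ord n) -sumr_const.
by apply: ler_sum => i _; case: (noise_row_le t i).
Qed.

Lemma adapted_noise t : adapted_mx P (HG t t.-1) (query t) ->
  adapted_mx P (HG t.+1 t.-1) (noise t).
Proof.
move=> aq i j.
have sub : <<s HG t t.-1 >> `<=` <<s HG t.+1 t.-1 >> by apply: history_le.
have aq' := adapted_mx_sub sub aq.
have ms : sub_measurable <<s HG t.+1 t.-1 >>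
    (fun w => sgrad i (row i (query t w)) (xi i t w) 0 j).
  apply: (sub_measurable_seed (T := Xi)) => //.
    by move=> k; under eq_fun do rewrite mxE; case: (aq' i k).
  by move=> E mE; exact: history_sample.
have [mg _] := adapted_stacked_grad aq' i j.
have mN : sub_measurable <<s HG t.+1 t.-1 >> (fun w => noise t w i j).
  apply/sub_measurableP; under eq_fun do rewrite noise_entry.
  apply: measurable_funB; first exact/sub_measurableP.
  by apply/sub_measurableP; move: mg; under eq_fun do rewrite mxE.
split => //.
apply: (@le_has_mean _ _ _ _ _ (fun w => sqn (row i (noise t w)))).
- by apply: measurable_funX; exact: sub_measurable_meas mN.
- move=> w; rewrite ger0_norm ?sqr_ge0//.
  by have := entry_sqr_le (row i (noise t w)) j; rewrite mxE.
- by case: (noise_row_le t i).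
Qed.

(** The noise of agent i is a function of the past and of the sample of agent i
    alone. *)
Lemma expect_mean_noise_le t : adapted_mx P (HG t t.-1) (query t) ->
  \int[P]_w sqn (row_mean (noise t w)) <= sigma ^+ 2 / n%:R.
Proof.
move=> aq; have [_ ci _ _] := SG t.
apply: (@expect_sqn_row_mean _ _ _ _ _ _ (HG t t.-1) _ _ (xi ^~ t) _ (HG t.+1 t.-1)) => //.
- move=> i j; set F := rectangles _ _ i.
  have sub : <<s HG t t.-1 >> `<=` <<s F >>.
    move=> A GA; apply: sub_sigma_algebra; exists A, setT; split => //.
    by rewrite preimage_setT setIT.
  have aq' := adapted_mx_sub sub aq.
  apply/sub_measurableP; under eq_fun do rewrite noise_entry.
  apply: measurable_funB; apply/sub_measurableP.
    apply: (sub_measurable_seed (T := Xi)) => //.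
      by move=> k; under eq_fun do rewrite mxE; case: (aq' i k).
    move=> E mE; apply: sub_sigma_algebra; exists setT, E; split => //.
      exact: (@measurableT _ (g_sigma_algebraType (HG t t.-1))).
    by rewrite setTI.
  have [mg _] := adapted_stacked_grad aq i j.
  by move=> E mE; apply: sub; move: (mg E mE); under eq_fun do rewrite mxE.
- exact: noise_centered.
- exact: adapted_noise.
- exact: expect_noise_le.
Qed.

Let adapted_state k := [/\ adapted_mx P (HG k.+1 k) (iter_x k),
  adapted_mx P (HG k.+1 k) (iter_D k) & adapted_mx P (HG k.+1 k) (iter_H k)].

Let adapted_iter_y k : adapted_state k ->
  adapted_mx P (HG k.+2 k) (iter_y k) /\ adapted_mx P (HG k.+2 k) (residual k).
Proof.
move=> [ax aD aH].
have sub : <<s HG k.+1 k >> `<=` <<s HG k.+2 k >> by exact: history_le.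
have aN : adapted_mx P (HG k.+2 k) (noise k.+1) by exact: (adapted_noise (t := k.+1)).
have ay : adapted_mx P (HG k.+2 k) (iter_y k).
  apply: adapted_mxB => //; last exact: adapted_mx_sub aD.
  apply: adapted_mxB => //; first exact: adapted_mx_sub ax.
  apply: adapted_mxZ => //; apply: adapted_mxD => //; apply: adapted_stacked_grad.
  exact: adapted_mx_sub ax.
by split => //; apply: adapted_mxB => //; exact: adapted_mx_sub aH.
Qed.

Lemma comp_err_row k w i : row i (comp_err k w) =
  comp (row i (residual k w)) (zeta i k w) - row i (residual k w).
Proof. by apply/rowP => j; rewrite !mxE. Qed.

(* The compressor assumption applies because the residual is square integrable. *)
Let compressor_row k i : adapted_mx P (HG k.+2 k) (residual k) ->
  (forall j, is_condexp P <<s HG k.+2 k >>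
     (fun w => comp (row i (residual k w)) (zeta i k w) 0 j)
     (fun w => row i (residual k w) 0 j)) /\
  condexp_le P <<s HG k.+2 k >>
    (fun w => frob (comp (row i (residual k w)) (zeta i k w) - row i (residual k w)) ^+ 2)
    (fun w => C * frob (row i (residual k w)) ^+ 2).
Proof.
move=> ar; have [_] := UC k i; apply.
  by move=> j; under eq_fun do rewrite mxE; case: (ar i j).
rewrite unlock; have := has_mean_sqn (@mH k.+2 k) (adapted_row i ar).
under eq_fun do rewrite -frob_sqr.
by move=> /integrable_lty; apply.
Qed.

Let comp_err_centered k i j : adapted_mx P (HG k.+2 k) (residual k) ->
  centered P <<s HG k.+2 k >> (fun w => comp_err k w i j).
Proof.
move=> ar; have [cc _] := compressor_row i ar.
have := condexp_centered (@mH k.+2 k) (cc j).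
by congr centered; apply/funext => w; rewrite !mxE.
Qed.

Let comp_err_row_le k i : adapted_mx P (HG k.+2 k) (residual k) ->
  has_mean P (fun w => sqn (row i (comp_err k w))) /\
  \int[P]_w sqn (row i (comp_err k w)) <= C * \int[P]_w sqn (row i (residual k w)).
Proof.
move=> ar; have [_ cl] := compressor_row i ar.
have ir : has_mean P (fun w => sqn (row i (residual k w))).
  exact: has_mean_sqn (@mH k.+2 k) (adapted_row i ar).
rewrite -expectZ//; move: cl; under eq_fun do rewrite -comp_err_row frob_sqr.
under [X in condexp_le _ _ _ X -> _]eq_fun do rewrite frob_sqr.
by apply: condexp_le_expect => //; exact: has_meanZ.
Qed.

Let adapted_comp_err k : adapted_mx P (HG k.+2 k) (residual k) ->
  adapted_mx P (HG k.+2 k.+1) (comp_err k).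
Proof.
move=> ar i j.
have sub : <<s HG k.+2 k >> `<=` <<s HG k.+2 k.+1 >> by apply: history_le.
have ar' := adapted_mx_sub sub ar.
have mc : sub_measurable <<s HG k.+2 k.+1 >>
    (fun w => comp (row i (residual k w)) (zeta i k w) 0 j).
  apply: (sub_measurable_seed (T := S)) => //.
    by move=> l; under eq_fun do rewrite mxE; case: (ar' i l).
  by move=> E mE; exact: history_seed.
have [mr _] := ar' i j.
have mN : sub_measurable <<s HG k.+2 k.+1 >> (fun w => comp_err k w i j).
  apply/sub_measurableP.
  rewrite (_ : (fun w => _) = fun w => comp (row i (residual k w)) (zeta i k w) 0 j
                                        - residual k w i j).
    by apply: measurable_funB; exact/sub_measurableP.
  by apply/funext => w; rewrite !mxE.
split => //.
apply: (@le_has_mean _ _ _ _ _ (fun w => sqn (row i (comp_err k w)))).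
- by apply: measurable_funX; exact: sub_measurable_meas mN.
- move=> w; rewrite ger0_norm ?sqr_ge0//.
  by have := entry_sqr_le (row i (comp_err k w)) j; rewrite mxE.
- by case: (comp_err_row_le i ar).
Qed.

(** The square integrability that the compressor assumption asks of its inputs
    is itself a consequence of the assumptions on the earlier rounds, hence a
    single induction. *)
Lemma iter_adapted k : adapted_state k.
Proof.
elim: k => [|k IH].
  split.
  - have -> : iter_x 0 = fun w => xm1 - eta *: (gF xm1 + noise 0 w).
      by apply/funext => w; exact: iter_x0.
    apply: adapted_mxB => //; first exact: adapted_mx_cst.
    apply: adapted_mxZ => //; apply: adapted_mxD => //; first exact: adapted_mx_cst.
    by apply: (adapted_noise (t := 0)); exact: adapted_mx_cst.
  - exact: adapted_mx_cst.
  - exact: adapted_mx_cst.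
have [ay ar] := adapted_iter_y IH; have [ax aD aH] := IH.
have s1 : <<s HG k.+1 k >> `<=` <<s HG k.+2 k.+1 >> by apply: history_le.
have s2 : <<s HG k.+2 k >> `<=` <<s HG k.+2 k.+1 >> by apply: history_le.
have ae := adapted_comp_err ar.
have ay' := adapted_mx_sub s2 ay.
have aN : adapted_mx P (HG k.+2 k.+1) (noise k.+1).
  by apply: adapted_mx_sub s2 _; exact: (adapted_noise (t := k.+1)).
have ax' := adapted_mx_sub s1 ax.
have aD' : adapted_mx P (HG k.+2 k.+1) (iter_D k.+1).
  have -> : iter_D k.+1 = fun w => iter_D k w + B *m (iter_y k w + comp_err k w).
    by apply/funext => w; exact: iter_DS.
  apply: adapted_mxD => //; first exact: adapted_mx_sub s1 aD.
  by apply: adapted_mxM => //; exact: adapted_mxD.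
split => //.
- have -> : iter_x k.+1 = fun w => iter_x k w - eta *: (gF (iter_x k w) + noise k.+1 w) - iter_D k.+1 w.
    by apply/funext => w; exact: iter_xS.
  apply: adapted_mxB => //; apply: adapted_mxB => //; apply: adapted_mxZ => //.
  by apply: adapted_mxD => //; exact: adapted_stacked_grad.
- have -> : iter_H k.+1 = fun w => iter_H k w + alpha *: (iter_y k w - iter_H k w + comp_err k w).
    by apply/funext => w; exact: iter_HS.
  have aH' := adapted_mx_sub s1 aH.
  apply: adapted_mxD => //; apply: adapted_mxZ => //; apply: adapted_mxD => //.
  exact: adapted_mxB.
Qed.

Lemma expect_comp_err_le k : \int[P]_w sqn (comp_err k w)
  <= C * \int[P]_w sqn (residual k w).
Proof.
have [_ ar] := adapted_iter_y (iter_adapted k).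
under eq_Rintegral do rewrite sqn_rows.
under [in leRHS]eq_Rintegral do rewrite sqn_rows.
rewrite expect_sum => [|i]; last by case: (comp_err_row_le i ar).
rewrite [in leRHS]expect_sum => [|i]; last first.
  exact: has_mean_sqn (@mH k.+2 k) (adapted_row i ar).
by rewrite mulr_sumr; apply: ler_sum => i _; case: (comp_err_row_le i ar).
Qed.

Variable delta : R.
Hypothesis gamma_gt0 : 0 < gamma.
Hypothesis gamma_le : gamma <= 1 / 2.
Hypothesis delta_gt0 : 0 < delta.
Hypothesis delta_le : delta <= gamma.
Hypothesis eta_gt0 : 0 < eta.
Hypothesis eta_le : eta * L <= delta / 32.
Hypothesis alpha_gt0 : 0 < alpha.
Hypothesis alpha_le1 : alpha <= 1.
Hypothesis B_tr : B^T = B.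
Hypothesis BJ : B *m avg_mx n = 0.
Hypothesis B_ge : forall m (v : 'M[R]_(n, m)), avg_mx n *m v = 0 ->
  delta / 2 * sqn v <= dot v (B *m v).
Hypothesis B_le : forall m (v : 'M[R]_(n, m)),
  dot v (B *m v) <= gamma / 2 * sqn v.

Local Notation J := (avg_mx n).
Local Notation Pi := (cen_mx n).
Local Notation gap := (dual_gap f eta).

Lemma iter_D_avg k w : J *m iter_D k w = 0.
Proof.
elim: k => [|k IH]; first exact: mulmx0.
by rewrite iter_DS mulmxDr IH add0r (avg_gossipM B_tr BJ).
Qed.

Ltac has_mean_tac := repeat first [assumption | apply: has_meanB
  | apply: has_meanD | apply: has_meanZ | exact: has_mean_cst].

Ltac expect_tac := repeat first
  [ rewrite expectB; [| by has_mean_tac | by has_mean_tac]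
  | rewrite expectD; [| by has_mean_tac | by has_mean_tac]
  | rewrite expectZ; [| by has_mean_tac] ].

(* Linear arithmetic in which the expectations are atoms. *)
Ltac lra_int :=
  repeat match goal with |- context [Rintegral ?m ?D ?h] =>
    generalize (Rintegral m D h) end;
  clear - gamma_gt0 delta_gt0 eta_gt0 alpha_gt0 n_gt0 L_gt0 df Lf C_gt0 msgrad
    mcomp SG UC gamma_le delta_le eta_le alpha_le1 B_tr BJ B_ge B_le mxi mzeta mH L_ge0;
  intros; lra.

Let adapted_gap k : adapted_mx P (HG k.+1 k) (fun w => gap (iter_x k w) (iter_D k w)).
Proof.
have [ax aD _] := iter_adapted k.
apply: adapted_mxD => //; apply: adapted_mxZ => //; apply: adapted_mxM => //.
by apply: adapted_stacked_grad; exact: adapted_mxM.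
Qed.

Let adapted_res k : adapted_mx P (HG k.+1 k) (fun w => consensus_res f (iter_x k w)).
Proof.
have [ax _ _] := iter_adapted k.
apply: adapted_mxM => //; apply: adapted_mxB => //; first exact: adapted_stacked_grad.
by apply: adapted_stacked_grad; exact: adapted_mxM.
Qed.

Let has_mean_energy k : has_mean P (fun w => energy f B eta (iter_x k w) (iter_D k w)).
Proof.
have [ax _ _] := iter_adapted k; have ag := adapted_gap k.
apply: has_meanB; last exact: has_mean_sqn ag.
apply: has_meanD; first by apply: (has_mean_sqn (@mH k.+1 k)); exact: adapted_mxM.
by apply: (has_mean_dot (@mH k.+1 k) (@mH k.+1 k)) => //; exact: adapted_mxM.
Qed.

Lemma energy_recursion k :
  \int[P]_w energy f B eta (iter_x k.+1 w) (iter_D k.+1 w) <=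
  \int[P]_w energy f B eta (iter_x k w) (iter_D k w)
  - delta / 4 * (\int[P]_w sqn (Pi *m iter_x k w))
  - 1 / 2 * (\int[P]_w sqn (gap (iter_x k w) (iter_D k w)))
  + gamma * (C * \int[P]_w sqn (residual k w))
  + 3 * eta ^+ 2 * (n%:R * sigma ^+ 2)
  + 1 / 30 * eta ^+ 2 * (\int[P]_w sqn (J *m gF (iter_x k w))).
Proof.
have [ax aD aH] := iter_adapted k.
have [ay ar] := adapted_iter_y (iter_adapted k).
have ag := adapted_gap k; have are := adapted_res k.
have aN : adapted_mx P (HG k.+2 k) (noise k.+1) by exact: (adapted_noise (t := k.+1)).
have ae := adapted_comp_err ar.
have step w := energy_step n_gt0 L_gt0 Lf gamma_gt0 gamma_le delta_gt0 delta_le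
  eta_gt0 eta_le B_tr BJ B_ge B_le (iter_D_avg k w)
  (erefl (iter_y k w)) (iter_DS k w) (iter_xS k w).
have iX : has_mean P (fun w => sqn (Pi *m iter_x k w)).
  by apply: (has_mean_sqn (@mH k.+1 k)); exact: adapted_mxM.
have iG : has_mean P (fun w => sqn (gap (iter_x k w) (iter_D k w))).
  exact: has_mean_sqn ag.
have ie : has_mean P (fun w => sqn (comp_err k w)) by exact: has_mean_sqn ae.
have iN : has_mean P (fun w => sqn (noise k.+1 w)) by exact: has_mean_sqn aN.
have ih : has_mean P (fun w => sqn (J *m gF (iter_x k w))).
  apply: (has_mean_sqn (@mH k.+1 k)); apply: adapted_mxM => //.
  exact: adapted_stacked_grad.
have iE := has_mean_energy k.
pose u w := Pi *m iter_x k w - eta *: consensus_res f (iter_x k w).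
pose v w := gap (iter_x k w) (iter_D k w) - B *m gap (iter_x k w) (iter_D k w).
have au : adapted_mx P (HG k.+1 k) u.
  by apply: adapted_mxB => //; [exact: adapted_mxM|exact: adapted_mxZ].
have av : adapted_mx P (HG k.+2 k) v.
  apply: (@adapted_mx_sub _ _ _ _ (HG k.+1 k)); first by apply: history_le.
  by apply: adapted_mxB => //; exact: adapted_mxM.
have iuN : has_mean P (fun w => dot (u w) (noise k.+1 w)).
  exact: has_mean_dot au aN.
have iev : has_mean P (fun w => dot (comp_err k w) (v w)).
  exact: has_mean_dot ae av.
have uN0 : \int[P]_w dot (u w) (noise k.+1 w) = 0.
  apply: (expect_dot_eq0 (@mH k.+1 k) (@mH k.+2 k)) => //.
  exact: (noise_centered k.+1).
have ev0 : \int[P]_w dot (comp_err k w) (v w) = 0.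
  under eq_Rintegral do rewrite dotC.
  apply: (expect_dot_eq0 (@mH k.+2 k) (@mH k.+2 k.+1)) => //.
  by move=> i j; exact: comp_err_centered.
have ic : has_mean P (fun w => energy_cross f B delta eta (iter_x k w)
    (iter_D k w) (noise k.+1 w) (comp_err k w)).
  by rewrite /energy_cross; has_mean_tac.
have c0 : \int[P]_w energy_cross f B delta eta (iter_x k w)
    (iter_D k w) (noise k.+1 w) (comp_err k w) = 0.
  by rewrite /energy_cross -/u -/v; expect_tac; rewrite uN0 ev0; ring.
have lin (e0 x g e nn h c : Omega -> R) : has_mean P e0 -> has_mean P x ->
    has_mean P g -> has_mean P e -> has_mean P nn -> has_mean P h -> has_mean P c ->
    \int[P]_w (e0 w - delta / 4 * x w - 1 / 2 * g w + gamma * e w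
      + 3 * eta ^+ 2 * nn w + 1 / 30 * eta ^+ 2 * h w + c w) =
    \int[P]_w e0 w - delta / 4 * (\int[P]_w x w) - 1 / 2 * (\int[P]_w g w)
      + gamma * (\int[P]_w e w) + 3 * eta ^+ 2 * (\int[P]_w nn w)
      + 1 / 30 * eta ^+ 2 * (\int[P]_w h w) + \int[P]_w c w.
  by move=> *; expect_tac.
have := le_expect (has_mean_energy k.+1) _ step.
move=> /(_ _)/le_trans; apply; first by has_mean_tac.
rewrite lin// c0 addr0.
have hN := expect_noise_le k.+1; have he := expect_comp_err_le k.
have := ler_wpM2l (ltW gamma_gt0) he.
have : 3 * eta ^+ 2 * \int[P]_w sqn (noise k.+1 w) <= 3 * eta ^+ 2 * (n%:R * sigma ^+ 2).
  by rewrite ler_wpM2l// mulr_ge0// sqr_ge0.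
by lra_int.
Qed.

Lemma residual_recursion k :
  \int[P]_w sqn (residual k.+1 w) <=
  (1 + alpha) * ((1 - alpha) ^+ 2 * (\int[P]_w sqn (residual k w))
     + alpha ^+ 2 * (C * \int[P]_w sqn (residual k w)))
  + 2 / alpha * (6 * gamma ^+ 2 * (\int[P]_w sqn (Pi *m iter_x k.+1 w))
     + 5 * gamma ^+ 2 * (C * \int[P]_w sqn (residual k w))
     + 5 * (\int[P]_w sqn (gap (iter_x k.+1 w) (iter_D k.+1 w)))
     + 5 * eta ^+ 2 * (n%:R * sigma ^+ 2)
     + 5 * eta ^+ 2 * (\int[P]_w sqn (J *m gF (iter_x k.+1 w)))).
Proof.
have [ay ar] := adapted_iter_y (iter_adapted k).
have [_ ar'] := adapted_iter_y (iter_adapted k.+1).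
have [ax' aD' aH'] := iter_adapted k.+1.
have aN : adapted_mx P (HG k.+3 k.+1) (noise k.+2) by exact: (adapted_noise (t := k.+2)).
have ae := adapted_comp_err ar; have ag' := adapted_gap k.+1.
have step w := residual_step n_gt0 L_gt0 Lf gamma_gt0 gamma_le delta_gt0 delta_le
  eta_gt0 eta_le B_tr BJ B_ge B_le (iter_D_avg k w) alpha_gt0 alpha_le1
  (erefl (iter_y k w)) (iter_DS k w) (iter_xS k w) (iter_HS k w)
  (erefl (iter_y k.+1 w)).
have ir : has_mean P (fun w => sqn (residual k w)) by exact: has_mean_sqn ar.
have ir' : has_mean P (fun w => sqn (residual k.+1 w)) by exact: has_mean_sqn ar'.
have iX : has_mean P (fun w => sqn (Pi *m iter_x k.+1 w)).
  by apply: (has_mean_sqn (@mH k.+2 k.+1)); exact: adapted_mxM.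
have iG : has_mean P (fun w => sqn (gap (iter_x k.+1 w) (iter_D k.+1 w))).
  exact: has_mean_sqn ag'.
have ie : has_mean P (fun w => sqn (comp_err k w)) by exact: has_mean_sqn ae.
have iN : has_mean P (fun w => sqn (noise k.+2 w)) by exact: has_mean_sqn aN.
have ih : has_mean P (fun w => sqn (J *m gF (iter_x k.+1 w))).
  apply: (has_mean_sqn (@mH k.+2 k.+1)); apply: adapted_mxM => //.
  exact: adapted_stacked_grad.
have ire : has_mean P (fun w => dot (residual k w) (comp_err k w)).
  exact: has_mean_dot ar ae.
have re0 : \int[P]_w dot (residual k w) (comp_err k w) = 0.
  apply: (expect_dot_eq0 (@mH k.+2 k) (@mH k.+2 k.+1)) => //.
  by move=> i j; exact: comp_err_centered.
have lin (r e c x g nn h : Omega -> R) : has_mean P r -> has_mean P e ->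
    has_mean P c -> has_mean P x -> has_mean P g -> has_mean P nn -> has_mean P h ->
    has_mean P (fun w => (1 + alpha) * ((1 - alpha) ^+ 2 * r w + alpha ^+ 2 * e w
       - 2 * alpha * (1 - alpha) * c w)
     + 2 / alpha * (6 * gamma ^+ 2 * x w + 5 * gamma ^+ 2 * e w + 5 * g w
       + 5 * eta ^+ 2 * nn w + 5 * eta ^+ 2 * h w)) /\
    \int[P]_w ((1 + alpha) * ((1 - alpha) ^+ 2 * r w + alpha ^+ 2 * e w
       - 2 * alpha * (1 - alpha) * c w)
     + 2 / alpha * (6 * gamma ^+ 2 * x w + 5 * gamma ^+ 2 * e w + 5 * g w
       + 5 * eta ^+ 2 * nn w + 5 * eta ^+ 2 * h w)) =
    (1 + alpha) * ((1 - alpha) ^+ 2 * (\int[P]_w r w) + alpha ^+ 2 * (\int[P]_w e w)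
       - 2 * alpha * (1 - alpha) * \int[P]_w c w)
     + 2 / alpha * (6 * gamma ^+ 2 * (\int[P]_w x w) + 5 * gamma ^+ 2 * (\int[P]_w e w)
       + 5 * (\int[P]_w g w) + 5 * eta ^+ 2 * (\int[P]_w nn w)
       + 5 * eta ^+ 2 * \int[P]_w h w).
  by move=> *; split; [has_mean_tac|expect_tac].
have [irhs Erhs] := lin _ _ _ _ _ _ _ ir ie ire iX iG iN ih.
have := le_expect ir' irhs step; rewrite Erhs re0 mulr0 subr0 => h; apply: (le_trans h) => {h}.
have hN := expect_noise_le k.+2; have he := expect_comp_err_le k.
have c1 : 0 <= 1 + alpha by rewrite addr_ge0// ltW.
have c2 : 0 <= 2 / alpha by rewrite divr_ge0// ltW.
have gg : 0 <= 5 * gamma ^+ 2 by rewrite mulr_ge0// sqr_ge0.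
have ee : 0 <= 5 * eta ^+ 2 by rewrite mulr_ge0// sqr_ge0.
apply: lerD.
  by rewrite ler_wpM2l// lerD2l ler_wpM2l ?sqr_ge0.
rewrite ler_wpM2l// lerD2r; apply: lerD; last by rewrite ler_wpM2l.
by rewrite lerD2r lerD2l ler_wpM2l.
Qed.

Let adapted_query t : adapted_mx P (HG t t.-1) (query t).
Proof. by case: t => [|k]; [exact: adapted_mx_cst|case: (iter_adapted k)]. Qed.

Definition mean_grad t w := grad (average f) (row_mean (query t w)).

Definition objective_drop t w :=
  eta / 2 * sqn (mean_grad t w)
  + eta / 2 * (1 - L * eta) * sqn (row_mean (gF (query t w)))
  - eta / 2 * (L ^+ 2 / n%:R * sqn (Pi *m query t w))
  - L / 2 * eta ^+ 2 * sqn (row_mean (noise t w))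
  + dot (eta *: mean_grad t w - (L * eta ^+ 2) *: row_mean (gF (query t w)))
      (row_mean (noise t w)).

Lemma objective_query_step t w : average f (row_mean (query t.+1 w)) <=
  average f (row_mean (query t w)) - objective_drop t w.
Proof.
have h : exists D e y D', [/\ J *m D = 0,
    y = query t w - eta *: (gF (query t w) + noise t w) - D, D' = D + B *m (y + e)
    & query t.+1 w = query t w - eta *: (gF (query t w) + noise t w) - D'].
  (* the first step is one without dual variable whose compressed vector is 0 *)
  case: t => [|k].
    pose y0 := xm1 - eta *: (gF xm1 + noise 0 w) - 0.
    exists 0, (- y0), y0, 0; split => //.
    - exact: mulmx0.
    - by rewrite subrr mulmx0 addr0.
    - by rewrite subr0 -iter_x0.
  exists (iter_D k w), (comp_err k w), (iter_y k w), (iter_D k.+1 w); split => //.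
  - exact: iter_D_avg.
  - exact: iter_DS.
  - exact: iter_xS.
have [D [e [y [D' [JD yE D'E qE]]]]] := h.
have := objective_step n_gt0 L_gt0 df Lf eta_gt0 B_tr BJ JD yE D'E qE.
move=> h'; apply: (le_trans h'); rewrite /objective_drop -/(mean_grad t w).
by clear h h' JD yE D'E qE; lra.
Qed.

Lemma has_mean_iter_grad k :
  has_mean P (fun w => sqn (grad (average f) (row_mean (iter_x k w)))).
Proof.
have [ax _ _] := iter_adapted k.
under eq_fun do rewrite grad_average_mean//.
apply: (has_mean_sqn (@mH k.+1 k)); apply: adapted_row_mean => //.
by apply: adapted_stacked_grad; exact: adapted_mxM.
Qed.

Lemma objective_recursion m K : (forall x, m <= average f x) ->
  \sum_(t < K) (eta / 2 * (\int[P]_w sqn (mean_grad t w))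
    + eta / 2 * (1 - L * eta) * (\int[P]_w sqn (row_mean (gF (query t w))))
    - eta / 2 * (L ^+ 2 / n%:R * (\int[P]_w sqn (Pi *m query t w)))
    - L / 2 * eta ^+ 2 * (sigma ^+ 2 / n%:R))
  <= average f (row_mean xm1) - m.
Proof.
move=> fm.
have ag t : adapted_mx P (HG t t.-1) (mean_grad t).
  rewrite /mean_grad; under eq_fun do rewrite grad_average_mean//.
  by apply: adapted_row_mean => //; apply: adapted_stacked_grad; exact: adapted_mxM.
have ah t : adapted_mx P (HG t t.-1) (fun w => row_mean (gF (query t w))).
  by apply: adapted_row_mean => //; exact: adapted_stacked_grad.
have aN t : adapted_mx P (HG t.+1 t.-1) (fun w => row_mean (noise t w)).
  by apply: adapted_row_mean => //; exact: adapted_noise.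
have iG t : has_mean P (fun w => sqn (mean_grad t w)) by exact: has_mean_sqn (ag t).
have ih t : has_mean P (fun w => sqn (row_mean (gF (query t w)))).
  exact: has_mean_sqn (ah t).
have iX t : has_mean P (fun w => sqn (Pi *m query t w)).
  by apply: (has_mean_sqn (@mH t t.-1)); exact: adapted_mxM.
have iN t : has_mean P (fun w => sqn (row_mean (noise t w))).
  exact: has_mean_sqn (aN t).
pose u t w := eta *: mean_grad t w - (L * eta ^+ 2) *: row_mean (gF (query t w)).
have au t : adapted_mx P (HG t t.-1) (u t).
  by apply: adapted_mxB => //; exact: adapted_mxZ.
have iuN t : has_mean P (fun w => dot (u t w) (row_mean (noise t w))).
  exact: has_mean_dot (au t) (aN t).
have uN0 t : \int[P]_w dot (u t w) (row_mean (noise t w)) = 0.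
  apply: (expect_dot_eq0 (@mH t t.-1) (@mH t.+1 t.-1)) => // i j.
  under eq_fun do rewrite mxE summxE.
  split.
    by apply: has_meanZ; apply: has_mean_sum => k; under eq_fun do rewrite mxE;
      case: (noise_centered t k j).
  move=> A GA; have mA : measurable A := mH GA.
  rewrite Rintegral_in.
  under eq_Rintegral do rewrite mulrCA mulr_sumr.
  have iNk k : has_mean P (fun w => \1_A w * row k (noise t w) i j).
    under eq_fun do rewrite mxE.
    by apply: has_mean_indicM => //; case: (noise_centered t k j).
  rewrite expectZ; last exact: has_mean_sum.
  rewrite expect_sum// big1 ?mulr0// => k _; under eq_Rintegral do rewrite mxE.
  by rewrite -Rintegral_in; case: (noise_centered t k j) => _; apply.
have lin (g h x nn c : Omega -> R) : has_mean P g -> has_mean P h -> has_mean P x ->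
    has_mean P nn -> has_mean P c ->
    has_mean P (fun w => eta / 2 * g w + eta / 2 * (1 - L * eta) * h w
      - eta / 2 * (L ^+ 2 / n%:R * x w) - L / 2 * eta ^+ 2 * nn w + c w) /\
    \int[P]_w (eta / 2 * g w + eta / 2 * (1 - L * eta) * h w
      - eta / 2 * (L ^+ 2 / n%:R * x w) - L / 2 * eta ^+ 2 * nn w + c w) =
    eta / 2 * (\int[P]_w g w) + eta / 2 * (1 - L * eta) * (\int[P]_w h w)
      - eta / 2 * (L ^+ 2 / n%:R * (\int[P]_w x w))
      - L / 2 * eta ^+ 2 * (\int[P]_w nn w) + \int[P]_w c w.
  by move=> *; split; [has_mean_tac|expect_tac].
have dropE t := lin _ _ _ _ _ (iG t) (ih t) (iX t) (iN t) (iuN t).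
have tele w : \sum_(t < K) objective_drop t w <= average f (row_mean xm1) - m.
  apply: le_trans (sum_telescope K (fun t => objective_query_step t w)) _.
  by rewrite lerD2l lerN2.
have idrop (t : 'I_K) : has_mean P (objective_drop t) by case: (dropE t).
have := le_expect _ (has_mean_cst P _) tele.
rewrite expect_sum// expect_cst => /(_ (has_mean_sum _ idrop)).
apply: le_trans; apply: ler_sum => t _.
have [_ ->] := dropE t; rewrite uN0 addr0 lerD2l lerN2.
have c0 : 0 <= L / 2 * eta ^+ 2 by rewrite mulr_ge0 ?sqr_ge0// divr_ge0.
by rewrite ler_wpM2l//; exact: expect_mean_noise_le.
Qed.

Lemma initial_expect :
  \int[P]_w energy f B eta (iter_x 0 w) (iter_D 0 w) + \int[P]_w sqn (residual 0 w) <=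
  40 * (sqn xm1 + sqn H0 + eta ^+ 2 * (2 * (n%:R * sigma ^+ 2))
        + delta^-1 * eta ^+ 2 * sqn (gF xm1)).
Proof.
have [ax aD aH] := iter_adapted 0.
have [_ ar] := adapted_iter_y (iter_adapted 0).
have iE := has_mean_energy 0.
have ir : has_mean P (fun w => sqn (residual 0 w)) by exact: has_mean_sqn ar.
have iN0 : has_mean P (fun w => sqn (noise 0 w)).
  by apply: (has_mean_sqn (@mH 1 0)); exact: adapted_noise.
have iN1 : has_mean P (fun w => sqn (noise 1 w)).
  by apply: (has_mean_sqn (@mH 2 0)); exact: (adapted_noise (t := 1)).
rewrite -expectD//.
have lin (a b : Omega -> R) : has_mean P a -> has_mean P b ->
    has_mean P (fun w => 40 * (sqn xm1 + sqn H0 + eta ^+ 2 * (a w + b w)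
        + delta^-1 * eta ^+ 2 * sqn (gF xm1))) /\
    \int[P]_w (40 * (sqn xm1 + sqn H0 + eta ^+ 2 * (a w + b w)
        + delta^-1 * eta ^+ 2 * sqn (gF xm1))) =
    40 * (sqn xm1 + sqn H0 + eta ^+ 2 * (\int[P]_w a w + \int[P]_w b w)
        + delta^-1 * eta ^+ 2 * sqn (gF xm1)).
  move: (sqn xm1 + sqn H0) (delta^-1 * eta ^+ 2 * sqn (gF xm1)) => c c' ia ib.
  by split; [has_mean_tac|expect_tac; rewrite !expect_cst].
have [irhs Erhs] := lin _ _ iN0 iN1.
apply: le_trans (_ : _ <= \int[P]_w (40 * (sqn xm1 + sqn H0
    + eta ^+ 2 * (sqn (noise 0 w) + sqn (noise 1 w))
    + delta^-1 * eta ^+ 2 * sqn (gF xm1)))) _.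
  apply: le_expect => //; first exact: has_meanD.
  move=> w; have := initial_bound n_gt0 L_gt0 Lf gamma_le delta_gt0 delta_le
    eta_gt0 eta_le B_tr BJ B_ge H0 (noise 1 w) (iter_x0 w).
  by rewrite /residual /iter_y subr0.
rewrite Erhs ler_wpM2l// lerD2r lerD2l ler_wpM2l ?sqr_ge0// mulrDl mul1r.
by rewrite lerD// expect_noise_le.
Qed.

(** The energy balances give the consensus error, which the summed descent turns
    into a bound on the gradients at the mean. *)
Lemma run_bound (m omega : R) K : delta = gamma * omega -> omega <= 1 ->
  gamma * C <= alpha ^+ 2 * omega / 15872 -> alpha * (C + 1) <= 1 / 4 ->
  (forall x, m <= average f x) ->
  \sum_(k < K) \int[P]_w sqn (grad (average f) (row_mean (iter_x k w))) <=
  2 / eta * (average f (row_mean xm1) - m)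
  + L ^+ 2 / n%:R * (sqn xm1 + 5 / delta *
     (40 * (sqn xm1 + sqn H0 + eta ^+ 2 * (2 * (n%:R * sigma ^+ 2))
        + delta^-1 * eta ^+ 2 * sqn (gF xm1))
      + 4 * K%:R * eta ^+ 2 * (n%:R * sigma ^+ 2)))
  + K.+1%:R * (L * eta * (sigma ^+ 2 / n%:R)).
Proof.
move=> dE om1 gC aC fm.
have om0 : 0 < omega by rewrite -(pmulr_rgt0 _ gamma_gt0) -dE.
have N0 : 0 < n%:R :> R by rewrite ltr0n.
have V0 : 0 <= n%:R * sigma ^+ 2 by rewrite mulr_ge0// sqr_ge0.
have P1 k := energy_recursion k; rewrite dE in P1.
have en0 k : 0 <= \int[P]_w energy f B eta (iter_x k w) (iter_D k w).
  apply: Rintegral_ge0 => w _.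
  exact: (energy_ge0 f n_gt0 eta gamma_gt0 gamma_le delta_gt0 B_tr BJ B_ge B_le
    (iter_x k w) (iter_D_avg k w)).
have int0 m' q' (A : Omega -> 'M[R]_(m', q')) : 0 <= \int[P]_w sqn (A w).
  by apply: Rintegral_ge0 => w _; exact: sqn_ge0.
have cons := sum_consensus K alpha_gt0 alpha_le1 gamma_gt0 gamma_le om0 om1 C_gt0
  gC aC (sqr_ge0 eta) V0 (fun k => int0 _ _ (fun w => Pi *m iter_x k w))
  (fun k => int0 _ _ (fun w => gap (iter_x k w) (iter_D k w)))
  (fun k => int0 _ _ (residual k)) (fun k => int0 _ _ (fun w => J *m gF (iter_x k w)))
  en0 P1 residual_recursion.
have obj := objective_recursion K.+1 fm.
have xq0 : \int[P]_w sqn (Pi *m query 0 w) <= sqn xm1.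
  by have := expect_cst P (sqn (Pi *m xm1)) => ->; exact: sqn_cen_le.
have := sum_gradient (K := K) (Gq := fun t => \int[P]_w sqn (mean_grad t w))
  (hq := fun t => \int[P]_w sqn (row_mean (gF (query t w))))
  (xq := fun t => \int[P]_w sqn (Pi *m query t w)) eta_gt0 L_gt0 delta_gt0
  (le_trans delta_le gamma_le) eta_le N0 (fun t => int0 _ _ (mean_grad t))
  (fun t => int0 _ _ (fun w => row_mean (gF (query t w)))) xq0 obj.
apply.
rewrite -dE in cons; apply: (le_trans cons); rewrite -[leLHS]addrA -[leRHS]addrA lerD//.
  exact: initial_expect.
rewrite lerD2l; apply: ler_wpM2l; first by rewrite mulr_ge0// sqr_ge0.
apply: ler_sum => k _.
  rewrite -expectZ; last first.
    apply: (has_mean_sqn (@mH k.+1 k)); apply: adapted_row_mean => //.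
    by apply: adapted_stacked_grad; case: (iter_adapted k).
  by under eq_Rintegral do rewrite sqn_avg_mx//.
Qed.

End Run.

(** * The rate *)

Section Rate.
Context {R : realType}.

(** The stepsize with horizon k is at most sqrt(n / k) over this ratio. *)
Definition rate_ratio (L sigma Delta : R) := Num.sqrt (L * sigma ^+ 2 / Delta).

(** The terms come from the terms of the bound in [rate_bound], each multiplied
    by sqrt(n k) and estimated beyond the thresholds. *)
Definition rate_constant (L sigma Delta : R) : R :=
  let kappa := rate_ratio L sigma Delta in
  2 * Delta * kappa + 64 * Delta * L + 402 * L ^+ 2
  + 420 * (L ^+ 2 * sigma ^+ 2 / kappa ^+ 2) + 200 * (L ^+ 2 / kappa ^+ 2)
  + 2 * (L * sigma ^+ 2 / kappa).

Lemma ler_sqr_pos (a b : R) : 0 <= b -> a ^+ 2 <= b ^+ 2 -> a <= b.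
Proof.
move=> b0 h; have [a0|a0] := leP a 0; first exact: le_trans b0.
by rewrite -(ler_pXn2r (isT : (0 < 2)%N)) ?nnegrE// ltW.
Qed.

(** Each term of the bound is at most a constant over sqrt(n k) once k passes
    the thresholds: n^3 / delta^2 for the noise and for the part of
    the stepsize that does not depend on k, the second one for the starting
    point, the third one for the initial gradient. *)
Lemma rate_bound (L sigma Delta delta N k A h g eta : R) :
  0 < L -> 0 < sigma -> 0 < Delta -> 0 < delta -> delta <= 1 -> 1 <= N -> 1 <= k ->
  0 <= A -> 0 <= h -> 0 <= g ->
  N ^+ 3 <= k * delta ^+ 2 -> A ^+ 2 + h ^+ 2 <= k * (N * delta ^+ 2) ->
  N * g ^+ 2 <= k ^+ 3 * delta ^+ 4 ->
  eta = (Num.sqrt (L * sigma ^+ 2 * k / (N * Delta)) + 32 * L / delta)^-1 ->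
  k^-1 * (2 / eta * Delta + L ^+ 2 / N * (A + 5 / delta *
      (40 * (A + h + eta ^+ 2 * (2 * (N * sigma ^+ 2)) + delta^-1 * eta ^+ 2 * g)
       + 4 * k * eta ^+ 2 * (N * sigma ^+ 2)))
    + (k + 1) * (L * eta * (sigma ^+ 2 / N)))
  <= rate_constant L sigma Delta / Num.sqrt (N * k).
Proof.
move=> L0 s0 D0 d0 d1 N1 k1 A0 h0 g0 T1 T2 T3 etaE.
have N0 : 0 < N by exact: lt_le_trans N1.
have k0 : 0 < k by exact: lt_le_trans k1.
rewrite /rate_constant; set kappa := rate_ratio _ _ _.
have K2 : kappa ^+ 2 = L * sigma ^+ 2 / Delta.
  by rewrite sqr_sqrtr// divr_ge0 ?ltW// mulr_gt0// exprn_gt0.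
have K0 : 0 < kappa by rewrite sqrtr_gt0 divr_gt0// mulr_gt0// exprn_gt0.
set r := Num.sqrt (N * k).
have r2 : r ^+ 2 = N * k by rewrite sqr_sqrtr// mulr_ge0// ltW.
have r0 : 0 < r by rewrite sqrtr_gt0 mulr_gt0.
have uE : Num.sqrt (L * sigma ^+ 2 * k / (N * Delta)) = kappa * k / r.
  rewrite -[RHS]ger0_norm; last by rewrite divr_ge0 ?mulr_ge0// ltW.
  rewrite -sqrtr_sqr; congr Num.sqrt; rewrite !exprMn exprVn r2 K2.
  by field; rewrite !gt_eqF.
have ei : eta^-1 = kappa * k / r + 32 * L / delta by rewrite etaE uE invrK.
have u0 : 0 < kappa * k / r by rewrite divr_gt0// mulr_gt0.
have e0 : 0 < eta.
  by rewrite -invr_gt0 ei addr_gt0// divr_gt0// mulr_gt0.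
have eu : eta <= r / (kappa * k).
  rewrite -[eta]invrK -invf_div lef_pV2 ?posrE ?invr_gt0//.
  by rewrite ei lerDl divr_ge0 ?mulr_ge0// ltW.
have e2 : eta ^+ 2 <= N / (kappa ^+ 2 * k).
  have -> : N / (kappa ^+ 2 * k) = (r / (kappa * k)) ^+ 2.
    by rewrite !exprMn exprVn r2; field; rewrite !gt_eqF.
  by rewrite ler_pXn2r ?nnegrE// ?ltW// divr_gt0// mulr_gt0.
have ri : 0 < r^-1 by rewrite invr_gt0.
have F1 : (delta * k)^-1 <= r^-1.
  rewrite lef_pV2 ?posrE ?mulr_gt0//; apply: ler_sqr_pos; first by rewrite mulr_ge0// ltW.
  rewrite r2 exprMn expr2 [k ^+ 2]expr2 mulrA ler_pM2r//.
  apply: le_trans (_ : N ^+ 3 <= _); last by rewrite -expr2 mulrC.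
  by rewrite exprS ler_peMr ?expr_ge1// ltW.
have F2 : (A + h) / (N * delta * k) <= 2 / r.
  rewrite ler_pdivrMr ?mulr_gt0// mulrAC ler_pdivlMr//.
  apply: ler_sqr_pos; first by rewrite !mulr_ge0// ltW.
  have : (A + h) ^+ 2 <= 4 * (k * (N * delta ^+ 2)).
    have := sqr_ge0 (A - h); have := sqr_ge0 A; have := sqr_ge0 h; move: T2; lra.
  move=> hh; have := ler_wpM2r (ltW (mulr_gt0 N0 k0)) hh.
  by rewrite exprMn r2 => /le_trans; apply; rewrite le_eqVlt; apply/orP; left; apply/eqP; ring.
have F3 : g / (k ^+ 2 * delta ^+ 2) <= r^-1.
  rewrite ler_pdivrMr ?mulr_gt0 ?exprn_gt0// mulrC ler_pdivlMr//.
  apply: ler_sqr_pos; first by rewrite mulr_ge0 ?sqr_ge0.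
  rewrite exprMn r2; have := ler_wpM2r (ltW k0) T3.
  have -> : k ^+ 3 * delta ^+ 4 * k = (k ^+ 2 * delta ^+ 2) ^+ 2 by ring.
  by have -> : N * g ^+ 2 * k = g ^+ 2 * (N * k) by ring.
have F4 : N / (k * delta) <= r^-1.
  rewrite ler_pdivrMr ?mulr_gt0// mulrC ler_pdivlMr//.
  apply: ler_sqr_pos; first by rewrite mulr_ge0// ltW.
  rewrite exprMn r2; have := ler_wpM2r (ltW k0) T1.
  have -> : k * delta ^+ 2 * k = (k * delta) ^+ 2 by ring.
  by have -> : N ^+ 3 * k = N ^+ 2 * (N * k) by ring.
have s2 : 0 <= sigma ^+ 2 by exact: sqr_ge0.
have L2 : 0 <= L ^+ 2 by exact: sqr_ge0.
have ki : k^-1 <= 1 by rewrite invf_le1.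
pose P1 := (A + h) / (N * delta * k).
pose P4 := eta ^+ 2 / delta.
have P1le : L ^+ 2 * A / (N * k) <= L ^+ 2 * P1.
  rewrite -mulrA ler_wpM2l// /P1 ler_pdivrMr ?mulr_gt0// mulrAC ler_pdivlMr ?mulr_gt0//.
  have := mulr_ge0 (ltW N0) (ltW k0) => Nk; have Ad := ler_wpM2l A0 d1.
  have : A * delta <= A + h by move: Ad h0; lra.
  by move=> /(ler_wpM2r Nk); rewrite [N * delta * k]mulrAC mulrA mulrAC; lra.
have P4le : P4 <= (kappa ^+ 2)^-1 * r^-1.
  apply: le_trans (ler_wpM2l _ F4); last by rewrite invr_ge0 sqr_ge0.
  rewrite /P4 ler_pdivrMr//; apply: (le_trans e2).
  by rewrite le_eqVlt; apply/orP; left; apply/eqP; field; rewrite !gt_eqF.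
have P4ge : 0 <= P4 by rewrite divr_ge0 ?sqr_ge0// ltW.
have P5le : eta ^+ 2 * g / (N * k * delta ^+ 2) <= (kappa ^+ 2)^-1 * r^-1.
  apply: le_trans (ler_wpM2l _ F3); last by rewrite invr_ge0 sqr_ge0.
  rewrite ler_pdivrMr ?mulr_gt0 ?exprn_gt0//; apply: le_trans (ler_wpM2r g0 e2) _.
  by rewrite le_eqVlt; apply/orP; left; apply/eqP; field; rewrite !gt_eqF.
have P7le : (k + 1) / k * (L * sigma ^+ 2 * (eta / N)) <= 2 * (L * sigma ^+ 2 / kappa) * r^-1.
  have c0 : 0 <= L * sigma ^+ 2 by rewrite mulr_ge0// ltW.
  have h1 : (k + 1) / k <= 2 by rewrite ler_pdivrMr//; move: k1; lra.
  have h2 : eta / N <= kappa^-1 * r^-1.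
    rewrite ler_pdivrMr//; apply: (le_trans eu).
    have -> : r / (kappa * k) = r ^+ 2 / (kappa * k * r) by field; rewrite !gt_eqF.
    by rewrite r2 le_eqVlt; apply/orP; left; apply/eqP; field; rewrite !gt_eqF.
  have -> : 2 * (L * sigma ^+ 2 / kappa) * r^-1 = 2 * (L * sigma ^+ 2 * (kappa^-1 * r^-1)).
    by ring.
  apply: ler_pM => //; first by rewrite divr_ge0 ?addr_ge0// ltW.
    by rewrite mulr_ge0// divr_ge0// ltW.
  by rewrite ler_wpM2l.
have -> : k^-1 * (2 / eta * Delta + L ^+ 2 / N * (A + 5 / delta *
      (40 * (A + h + eta ^+ 2 * (2 * (N * sigma ^+ 2)) + delta^-1 * eta ^+ 2 * g)
       + 4 * k * eta ^+ 2 * (N * sigma ^+ 2)))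
    + (k + 1) * (L * eta * (sigma ^+ 2 / N))) =
  2 * Delta / k * eta^-1 + L ^+ 2 * A / (N * k) + 200 * (L ^+ 2 * P1)
  + 400 * (L ^+ 2 * sigma ^+ 2 * (k^-1 * P4))
  + 200 * (L ^+ 2 * (eta ^+ 2 * g / (N * k * delta ^+ 2)))
  + 20 * (L ^+ 2 * sigma ^+ 2 * P4)
  + (k + 1) / k * (L * sigma ^+ 2 * (eta / N)).
  by rewrite /P1 /P4; field; rewrite !gt_eqF.
have q1 : 2 * Delta / k * eta^-1 <= (2 * Delta * kappa + 64 * Delta * L) / r.
  rewrite ei.
  have -> : 2 * Delta / k * (kappa * k / r + 32 * L / delta) =
    2 * Delta * kappa / r + 64 * Delta * L * (delta * k)^-1 by field; rewrite !gt_eqF.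
  by rewrite [leRHS]mulrDl lerD2l ler_wpM2l// !mulr_ge0// ltW.
have q2 := ler_wpM2l L2 F2; rewrite -/P1 in q2.
have q3 : L ^+ 2 * sigma ^+ 2 * P4 <= L ^+ 2 * sigma ^+ 2 * ((kappa ^+ 2)^-1 * r^-1).
  by rewrite ler_wpM2l// mulr_ge0.
have q4 : L ^+ 2 * sigma ^+ 2 * (k^-1 * P4) <= L ^+ 2 * sigma ^+ 2 * P4.
  by apply: ler_wpM2l; [exact: mulr_ge0|exact: ler_piMl].
have q5 := ler_wpM2l L2 P5le.
move: q1 q2 q3 q4 q5 P1le P7le.
clear; move: (eta ^+ 2 * g / _) => w5; move: (eta / N) => w7; move: P4 P1 => w4 w1.
move: (eta^-1) => ie; clear; intros; lra.
Qed.

End Rate.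

(** * The gossip matrix of a network, and the transient time *)

Section Network.
Context {R : realType} {n : nat}.
Variables (W : 'M[R]_n) (lam : seq R) (gamma : R).
Hypothesis n_ge2 : (2 <= n)%N.
Hypothesis W_tr : W^T = W.
Hypothesis W_psd : forall x : 'rV[R]_n, 0 <= (x *m W *m x^T) 0 0.
Hypothesis W1 : W *m const_mx 1 = const_mx 1 :> 'cV[R]_n.
Hypothesis W_eig : sorted_eigenvalues W lam.
Hypothesis lam2_lt1 : lam`_1 < 1.
Hypothesis gamma_gt0 : 0 < gamma.

Local Notation B := (gossip_mx W gamma).

Lemma gossip_mx_tr : B^T = B.
Proof. by rewrite linearZ linearB/= trmx1 W_tr. Qed.

Lemma gossip_mx_avg : B *m avg_mx n = 0.
Proof.
rewrite -scalemxAl mulmxBl mul1mx (_ : W *m avg_mx n = avg_mx n) ?subrr ?scaler0//.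
apply/matrixP => i j; have := congr1 (fun u : 'cV[R]_n => u i 0) W1.
rewrite !mxE => h; rewrite -[RHS]mul1r -{1}h mulr_suml; apply: eq_bigr => k _.
by rewrite !mxE mulr1.
Qed.

Lemma dot_quad m (v : 'M[R]_(n, m)) :
  dot v (W *m v) = \sum_j (row j v^T *m W *m (row j v^T)^T) 0 0.
Proof.
rewrite /dot exchange_big; apply: eq_bigr => j _.
have -> : row j v^T *m W = (col j (W *m v))^T.
  by rewrite tr_col trmx_mul W_tr row_mul.
rewrite [RHS]mxE; apply: eq_bigr => i _; rewrite !mxE.
by rewrite mulrC; congr (_ * _); apply: eq_bigr => k _; rewrite !mxE.
Qed.

Lemma sqn_quad m (v : 'M[R]_(n, m)) :
  sqn v = \sum_j (row j v^T *m (row j v^T)^T) 0 0.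
Proof.
rewrite /sqn /dot exchange_big; apply: eq_bigr => j _; rewrite [RHS]mxE.
by apply: eq_bigr => i _; rewrite !mxE.
Qed.

Lemma gossip_dotE m (v : 'M[R]_(n, m)) :
  dot v (B *m v) = gamma / 2 * (sqn v - dot v (W *m v)).
Proof. by rewrite -scalemxAl dotZr mulmxBl mul1mx dotDr dotNr. Qed.

Lemma gossip_mx_ge m (v : 'M[R]_(n, m)) : avg_mx n *m v = 0 ->
  gamma * (1 - lam`_1) / 2 * sqn v <= dot v (B *m v).
Proof.
move=> Jv; rewrite gossip_dotE.
have -> : gamma * (1 - lam`_1) / 2 * sqn v = gamma / 2 * ((1 - lam`_1) * sqn v) by ring.
rewrite ler_wpM2l ?divr_ge0 ?(ltW gamma_gt0)//.
rewrite mulrBl mul1r lerD2l lerN2 dot_quad sqn_quad mulr_sumr; apply: ler_sum => j _.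
apply: (spectral_gap W_tr W1 W_eig lam2_lt1).
apply/matrixP => i k; rewrite !ord1 !mxE.
have := congr1 (fun u : 'M[R]_(n, m) => u (Ordinal (ltnW n_ge2)) j) Jv.
rewrite !mxE => h; have n0 : n%:R^-1 != 0 :> R.
  by rewrite invr_neq0// pnatr_eq0 -lt0n ltnW.
apply: (mulfI n0); rewrite mulr0 -[RHS]h mulr_sumr; apply: eq_bigr => l _.
by rewrite !mxE mulr1.
Qed.

Lemma gossip_mx_le m (v : 'M[R]_(n, m)) : dot v (B *m v) <= gamma / 2 * sqn v.
Proof.
rewrite gossip_dotE ler_wpM2l ?divr_ge0 ?(ltW gamma_gt0)// gerDl oppr_le0 dot_quad.
by apply: sumr_ge0 => j _; exact: W_psd.
Qed.

(** The gap inequality on a difference of two basis vectors, as W >= 0. *)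
Lemma gap_le1 : 1 - lam`_1 <= 1.
Proof.
pose i0 := Ordinal (ltnW n_ge2 : (0 < n)%N); pose i1 := Ordinal (n_ge2 : (1 < n)%N).
pose v : 'cV[R]_n := delta_mx i0 0 - delta_mx i1 0.
have Jv : avg_mx n *m v = 0.
  apply/matrixP => i j; rewrite !mxE (bigD1 i0)//= (bigD1 i1)//= big1 => [|k].
    by rewrite !mxE !ord1/= mulr1n mulr0n; ring.
  by move=> /andP[k0 k1]; rewrite !mxE (negbTE k0) (negbTE k1) subrr mulr0.
have v0 : 0 < sqn v.
  rewrite /sqn /dot (bigD1 i0)//= big_ord1 !mxE/= subr0 mulr1 ltr_wpDr ?ltr01//.
  by apply: sumr_ge0 => i _; apply: sumr_ge0 => j _; exact: sqr_ge0.
have := le_trans (gossip_mx_ge Jv) (gossip_mx_le v).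
rewrite ler_pM2r// ler_pM2r ?invr_gt0// -[leRHS]mulr1 ler_pM2l//.
Qed.

End Network.

Lemma rate_constant_gt0 (R : realType) (L sigma Delta : R) :
  0 < L -> 0 < sigma -> 0 < Delta -> 0 < rate_constant L sigma Delta.
Proof.
move=> L0 s0 D0; have k0 : 0 < rate_ratio L sigma Delta.
  by rewrite sqrtr_gt0 divr_gt0// mulr_gt0// exprn_gt0.
have L2 : 0 < L ^+ 2 by exact: exprn_gt0.
have s2 : 0 < sigma ^+ 2 by exact: exprn_gt0.
rewrite /rate_constant; set kappa := rate_ratio _ _ _ in k0 *.
have k2 : 0 < kappa ^+ 2 by exact: exprn_gt0.
have p1 : 0 < 2 * Delta * kappa by rewrite !mulr_gt0.
have p2 : 0 < 64 * Delta * L by rewrite !mulr_gt0 ?ltr0n.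
have p3 : 0 < 402 * L ^+ 2 by rewrite mulr_gt0 ?ltr0n.
have p4 : 0 < 420 * (L ^+ 2 * sigma ^+ 2 / kappa ^+ 2) by rewrite mulr_gt0 ?ltr0n ?divr_gt0 ?mulr_gt0.
have p5 : 0 < 200 * (L ^+ 2 / kappa ^+ 2) by rewrite mulr_gt0 ?ltr0n ?divr_gt0.
have p6 : 0 < 2 * (L * sigma ^+ 2 / kappa) by rewrite mulr_gt0// divr_gt0// mulr_gt0.
by rewrite !addr_gt0.
Qed.

Theorem theorem2 (R : realType) (L sigma Delta0 : R)
    (L_gt0 : 0 < L) (sigma_gt0 : 0 < sigma) (Delta0_gt0 : 0 < Delta0) :
  exists c c1 c2 c3 : R, [/\ 0 < c, 0 < c1, 0 < c2 & 0 < c3] /\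
  forall (n p : nat) (f : 'I_n -> 'rV[R]_p -> R)
    (e : rel 'I_n) (W : 'M[R]_n) (lam : seq R) (C alpha gamma : R)
    (xm1 H0 : 'M[R]_(n, p))
    (d dX dS : measure_display) (Omega : measurableType d)
    (Xi : measurableType dX) (S : measurableType dS) (P : probability Omega R)
    (sgrad : 'I_n -> 'rV[R]_p -> Xi -> 'rV[R]_p)
    (comp : 'rV[R]_p -> S -> 'rV[R]_p)
    (xi : nat -> 'I_n -> nat -> Omega -> Xi)
    (zeta : nat -> 'I_n -> nat -> Omega -> S),
  let lambda2 := lam`_1 in
  let eta := cedas_stepsize n L sigma Delta0 gamma lambda2 in
  let x K := run_x W alpha gamma (eta K) sgrad comp xm1 H0 (xi K) (zeta K) in
  let q K := run_query W alpha gamma (eta K) sgrad comp xm1 H0 (xi K) (zeta K) in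
  let gradF := rowwise (fun i => grad (f i)) in
  (2 <= n)%N ->
  (forall i v, differentiable (f i) v) ->
  has_lbound (range (average f)) ->
  Delta0 = average f (row_mean xm1) - inf (range (average f)) ->
  network_assumption e W ->
  sorted_eigenvalues W lam ->
  smoothness_assumption f L ->
  0 < C -> 0 < alpha -> 0 < gamma ->
  gamma <= Num.min (1 / 2) (Num.min (alpha ^+ 2 * (1 - lambda2) / (15872 * C))
                                    (alpha / 2)) ->
  alpha <= 1 / (4 * (C + 1)) ->
  (forall i, jointly_measurable (sgrad i)) ->
  jointly_measurable comp ->
  (forall K, (0 < K)%N ->
     stochastic_gradient_assumption (xi K) (zeta K) P f sgrad (q K) sigma) ->
  (forall K, (0 < K)%N ->
     unbiased_compressor_assumption (xi K) (zeta K) P comp C) ->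
  (transient_time P c f x
   <= (Num.max (c1 * (n%:R ^+ 3 / (gamma ^+ 2 * (1 - lambda2) ^+ 2)))
        (Num.max
          (c2 * ((frob xm1 ^+ 4 + frob H0 ^+ 4)
                 / (n%:R * gamma ^+ 2 * (1 - lambda2) ^+ 2)))
          (c3 * (n%:R * frob (gradF xm1) ^+ 4
                 / (gamma ^+ 4 * (1 - lambda2) ^+ 4)) `^ 3^-1)))%:E)%E.
Proof.
exists (rate_constant L sigma Delta0), 2, 2, 2; split.
  by split => //; exact: rate_constant_gt0.
move=> n p f e W lam C alpha gamma xm1 H0 d dX dS Omega Xi S P sgrad comp xi zeta.
move=> lambda2 eta x q gradF n_ge2 df f_lb DeltaE [_ [W_tr _ W_psd] W1 _] W_eig Lf.
move=> C_gt0 alpha_gt0 gamma_gt0 gamma_min alpha_le msgrad mcomp SG UC.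
move: gamma_min; rewrite !le_min => /and3P[gamma_le gamma_gap _].
have gC : gamma * C <= alpha ^+ 2 * (1 - lambda2) / 15872.
  have := ler_wpM2r (ltW C_gt0) gamma_gap.
  have -> // : alpha ^+ 2 * (1 - lambda2) / (15872 * C) * C =
    alpha ^+ 2 * (1 - lambda2) / 15872 by field; rewrite gt_eqF.
have gap_gt0 : 0 < 1 - lambda2.
  rewrite -(pmulr_rgt0 _ (exprn_gt0 2 alpha_gt0)).
  have : 0 < alpha ^+ 2 * (1 - lambda2) / 15872.
    by apply: lt_le_trans gC; rewrite mulr_gt0.
  by move: (alpha ^+ 2 * (1 - lambda2)); clear; intros; lra.
have lam2_lt1 : lam`_1 < 1 by rewrite -subr_gt0.
have n_gt0 : (0 < n)%N by exact: ltnW.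
have aC : alpha * (C + 1) <= 1 / 4.
  have C1 : 0 < C + 1 by rewrite addr_gt0.
  have := ler_wpM2r (ltW C1) alpha_le.
  by have -> // : 1 / (4 * (C + 1)) * (C + 1) = 1 / 4 by field; rewrite gt_eqF.
have alpha_le1 : alpha <= 1.
  have : alpha * 1 <= alpha * (C + 1) by rewrite ler_pM2l// lerDr ltW.
  by move: aC; clear; lra.
have gap1 : 1 - lambda2 <= 1.
  exact: (gap_le1 n_ge2 W_tr W_psd W1 W_eig lam2_lt1 gamma_gt0).
pose delta := gamma * (1 - lambda2).
have delta_gt0 : 0 < delta by rewrite mulr_gt0.
have delta_le : delta <= gamma by rewrite ler_piMr// ltW.
have delta1 : delta <= 1 by apply: (le_trans delta_le); move: gamma_le; clear; lra.
pose u k := Num.sqrt (L * sigma ^+ 2 * k%:R / (n%:R * Delta0)).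
have etaE k : eta k = (u k + 32 * L / delta)^-1 by [].
have c0 : 0 < 32 * L / delta by rewrite divr_gt0 ?mulr_gt0 ?ltr0n.
have u_ge0 k : 0 <= u k by exact: sqrtr_ge0.
have eta_gt0 k : 0 < eta k by rewrite etaE invr_gt0 ltr_wpDl.
have eta_le k : eta k * L <= delta / 32.
  have h : eta k <= (32 * L / delta)^-1.
    by rewrite etaE lef_pV2 ?posrE ?ltr_wpDl// lerDr.
  apply: le_trans (ler_wpM2r (ltW L_gt0) h) _.
  by rewrite le_eqVlt; apply/orP; left; apply/eqP; field; rewrite !gt_eqF.
set M := Num.max _ _.
have [M1 M2 M3] : [/\ 2 * (n%:R ^+ 3 / (gamma ^+ 2 * (1 - lambda2) ^+ 2)) <= M,
    2 * ((frob xm1 ^+ 4 + frob H0 ^+ 4) / (n%:R * gamma ^+ 2 * (1 - lambda2) ^+ 2)) <= M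
  & 2 * (n%:R * frob (gradF xm1) ^+ 4 / (gamma ^+ 4 * (1 - lambda2) ^+ 4)) `^ 3^-1 <= M].
  by rewrite /M !le_max !lexx !orbT.
have N1 : 1 <= n%:R :> R by rewrite ler1n.
have N0 : 0 < n%:R :> R by exact: lt_le_trans N1.
have d2 : 0 < delta ^+ 2 by exact: exprn_gt0.
have T1E : n%:R ^+ 3 / (gamma ^+ 2 * (1 - lambda2) ^+ 2) = n%:R ^+ 3 / delta ^+ 2.
  by rewrite -exprMn.
have M_ge2 : 2 <= M.
  apply: le_trans M1; rewrite T1E -[leLHS]mulr1 ler_pM2l// ler_pdivlMr// mul1r.
  apply: le_trans (_ : 1 <= _); last by rewrite exprn_ege1.
  by rewrite expr_le1// ltW.
have M_ge0 : 0 <= M by apply: le_trans M_ge2.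
(* M >= 2, so the integer part of M is at least M / 2 *)
pose K0 := Num.truncn M.
have K0_le : K0%:R <= M by rewrite truncn_le.
have K0_gt : M / 2 <= K0%:R.
  have := truncnS_gt M; rewrite -/K0 -natr1 => h.
  by move: h M_ge2; clear; lra.
have K0_gt0 : (0 < K0)%N.
  by rewrite -(ltr_nat R); apply: lt_le_trans K0_gt; apply: lt_le_trans (_ : 1 <= _); rewrite // ler_pdivlMr// mul1r.
apply: (@le_trans _ _ K0%:R%:E); last by rewrite lee_fin.
apply: ereal_inf_lbound; exists K0 => //; split => // k K0k.
have k_gt0 : (0 < k)%N by exact: leq_trans K0k.
have k1 : 1 <= k%:R :> R by rewrite ler1n.
have Mk : M / 2 <= k%:R by apply: (le_trans K0_gt); rewrite ler_nat.
have half a : 2 * a <= M -> a <= k%:R by move: Mk; clear; intros; lra.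
have T1 : n%:R ^+ 3 <= k%:R * delta ^+ 2 by rewrite -ler_pdivrMr// -T1E half.
have T2 : sqn xm1 ^+ 2 + sqn H0 ^+ 2 <= k%:R * (n%:R * delta ^+ 2).
  rewrite -ler_pdivrMr ?mulr_gt0//; apply: half; apply: le_trans M2.
  by rewrite /delta exprMn !mulrA -!frob_sqr -!exprM.
have T3 : n%:R * sqn (gradF xm1) ^+ 2 <= k%:R ^+ 3 * delta ^+ 4.
  rewrite -ler_pdivrMr ?exprn_gt0//.
  set X := n%:R * _ / _.
  have X0 : 0 <= X.
    apply: divr_ge0; last by apply: exprn_ge0; exact: ltW.
    by apply: mulr_ge0 (sqr_ge0 _); exact: ltW.
  have XE : (X `^ 3^-1) ^+ 3 = X.
    by rewrite -powR_mulrn ?powR_ge0// -powRrM mulVf// powRr1.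
  rewrite -XE ler_pXn2r ?nnegrE ?powR_ge0//; apply: half; apply: le_trans M3.
  by rewrite /X /delta exprMn -frob_sqr -exprM.
have eS := run_bound n_gt0 L_gt0 df Lf C_gt0 msgrad mcomp (SG k k_gt0) (UC k k_gt0)
  gamma_gt0 gamma_le delta_gt0 delta_le (eta_gt0 k) (eta_le k) alpha_gt0 alpha_le1
  (gossip_mx_tr gamma W_tr) (gossip_mx_avg gamma W1)
  (gossip_mx_ge n_ge2 W_tr W1 W_eig lam2_lt1 gamma_gt0)
  (gossip_mx_le W_tr W_psd gamma_gt0) k erefl gap1 gC aC
  (fun v => ge_inf f_lb (imageP _ (Logic.I : setT v))).
have iS j := has_mean_iter_grad L_gt0 df Lf msgrad mcomp (SG k k_gt0) (UC k k_gt0) j.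
have ES j : ('E_P[fun w => (frob (grad (average f) (row_mean (x k j w))) ^+ 2)%R] =
    (\int[P]_w sqn (grad (average f) (row_mean (x k j w))))%:E)%E.
  rewrite unlock; under eq_integral do rewrite frob_sqr.
  by rewrite expectE//; exact: iS.
rewrite /mean_sq_grad; under eq_bigr do rewrite ES.
rewrite sumEFin -EFinM lee_fin.
have rb := rate_bound L_gt0 sigma_gt0 Delta0_gt0 delta_gt0 delta1 N1 k1
  (sqn_ge0 xm1) (sqn_ge0 H0) (sqn_ge0 (gradF xm1)) T1 T2 T3 (erefl (eta k)).
rewrite natrM; apply: le_trans rb; rewrite ler_wpM2l//.
rewrite -DeltaE -[k.+1%:R]natr1 in eS; exact: eS.
Qed.
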